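(* (i) Let $f$ be a real-valued functional of binary trees and let $F(T):=\sum_{v\in T}f(T(v))$. Assume that $$\sum_{k=1}^\infty\frac{(\mathrm{Var} f(\mathcal{T}_k))^{1/2}}{k^{3/2}}<\infty,\qquad \lim_{k\to\infty}\frac{\mathrm{Var} f(\mathcal{T}_k)}{k}=0,\qquad \sum_{k=1}^\infty\frac{(\mathbb{E} f(\mathcal{T}_k))^2}{k^2}<\infty.$$ Then, as $n\to\infty$, $$\frac{\mathbb{E}(F(\mathcal{T}_n))}{n}\to\mu_F:=\sum_{k=1}^\infty\frac{2}{(k+1)(k+2)}\mathbb{E} f(\mathcal{T}_k),$$ $$\frac{\mathrm{Var}(F(\mathcal{T}_n))}{n}\to\sigma_F^2:=\lim_{N\to\infty}\sum_{|T|,|T'|\le N}f(T)f(T')\sigma_{T,T'}<\infty$$ (the limit existing, the sum being over pairs of binary trees), and $$\frac{F(\mathcal{T}_n)-\mathbb{E} F(\mathcal{T}_n)}{\sqrt n}\xrightarrow{d}\mathcal{N}(0,\sigma_F^2).$$ (ii) Let $f$ be a real-valued functional of ordered (or unordered) rooted trees and let $F(\Lambda):=\sum_{v\in\Lambda}f(\Lambda(v))$. Assume that $$\sum_{k=1}^\infty\frac{(\mathrm{Var} f(\Lambda_k))^{1/2}}{k^{3/2}}<\infty,\qquad \lim_{k\to\infty}\frac{\mathrm{Var} f(\Lambda_k)}{k}=0,\qquad \sum_{k=1}^\infty\frac{(\mathbb{E} f(\Lambda_k))^2}{k^2}<\infty.$$ Then, as $n\to\infty$, $$\frac{\mathbb{E}(F(\Lambda_n))}{n}\to\hat\mu_F:=\sum_{k=1}^\infty\frac{1}{k(k+1)}\mathbb{E}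 f(\Lambda_k),$$ $$\frac{\mathrm{Var}(F(\Lambda_n))}{n}\to\hat\sigma_F^2:=\lim_{N\to\infty}\sum_{|\Lambda|,|\Lambda'|\le N}f(\Lambda)f(\Lambda')\hat\sigma_{\Lambda,\Lambda'}<\infty$$ (the limit existing, the sum being over pairs of ordered, respectively unordered, rooted trees), and $$\frac{F(\Lambda_n)-\mathbb{E} F(\Lambda_n)}{\sqrt n}\xrightarrow{d}\mathcal{N}(0,\hat\sigma_F^2).$$
   Context: Random binary search tree $\mathcal{T}_n$: insert the keys of a uniformly random permutation of $\{1,\dots,n\}$ one by one; the first key is placed at the root, and each later key starts at the root and at each occupied node proceeds to the left child position if it is smaller than the key there and to the right child position if it is larger, until it reaches an empty position, where it is placed. It is regarded as an unlabelled binary tree (left and right children distinguished). Random recursive tree $\Lambda_n$: start with a root labelled $1$; for $i=2,\dots,n$, node $i$ is attached as a child of a uniformly random node among $1,\dots,i-1$ (independently of earlier choices). It is regarded as an ordered rooted tree by ordering the children of each node by increasing labels from left to right and then ignoring the labels, or as an unordered rooted tree by ignoring also the ordering. All trees are nonempty; $|T|$ is the number of nodes. $T(v)$ is the fringe subtree of $T$ rooted at $v$ ($v$ together with all its descendants). ''Subtree'' means fringe subtree and ''copy'' means isomorphic (as a binary, ordered or unordered tree, respectively). $\mathcal{N}(0,0)$ is the point mass at $0$. Covariance constants. For binary trees $T,T'$ of sizes $k\ge m$, let $p_{k,T}:=\mathbb{P}(\mathcal{T}_k=T)$, $p_{m,T'}:=\mathbb{P}(\mathcal{T}_m=T')$,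 let $q^T_{T'}$ be the number of subtrees of $T$ that are copies of $T'$, and $$\sigma_{T,T'}=\sigma_{T',T}:=\tfrac{2}{(k+1)(k+2)}q^T_{T'}p_{k,T}-\beta(k,m)p_{k,T}p_{m,T'},$$ $$\beta(k,m):=\tfrac{4(k+m+3)}{(k+1)(k+2)(m+1)(m+2)}-\tfrac{4(k^2+3km+m^2+4k+4m+3)}{(k+1)(m+1)(k+m+1)(k+m+2)(k+m+3)}.$$ For ordered (or unordered) rooted trees $\Lambda,\Lambda'$ of sizes $k\ge m$, let $\hat p_{k,\Lambda}:=\mathbb{P}(\Lambda_k=\Lambda)$, $\hat p_{m,\Lambda'}:=\mathbb{P}(\Lambda_m=\Lambda')$, let $\hat q^\Lambda_{\Lambda'}$ be the number of subtrees of $\Lambda$ that are copies of $\Lambda'$, and $$\hat\sigma_{\Lambda,\Lambda'}=\hat\sigma_{\Lambda',\Lambda}:=\tfrac{1}{k(k+1)}\hat q^\Lambda_{\Lambda'}\hat p_{k,\Lambda}-\hat\beta(k,m)\hat p_{k,\Lambda}\hat p_{m,\Lambda'},\qquad \hat\beta(k,m):=\tfrac{k^2+km+m^2+k+m}{k(k+1)m(m+1)(k+m+1)}.$$ *)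

(* Defs.v *)
From HB Require Import structures.
From mathcomp Require Import all_boot all_order all_algebra perm.
From mathcomp Require Import all_classical all_reals all_analysis.
Import Order.TTheory GRing.Theory Num.Theory.
Import numFieldNormedType.Exports.

Set Implicit Arguments.
Unset Strict Implicit.
Unset Printing Implicit Defensive.

Local Open Scope classical_set_scope.
Local Open Scope ring_scope.
Local Open Scope quotient_scope.

(* Nonempty binary trees; [None] is an absent left or right child. *)
Unset Elimination Schemes.
Inductive btree : Type := BNode of option btree & option btree.
Set Elimination Schemes.

Lemma btree_ind (P : btree -> Prop) :
  (forall l r, (forall t, l = Some t -> P t) -> (forall t, r = Some t -> P t) ->
     P (BNode l r)) ->
  forall t, P t.
Proof.
move=> H; fix IH 1 => -[l r]; apply: H => t.
- by case: l => [a|] e; [case: e => <-; exact: (IH a)|discriminate].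
- by case: r => [a|] e; [case: e => <-; exact: (IH a)|discriminate].
Qed.

Fixpoint bencode (t : btree) : GenTree.tree unit :=
  let: BNode l r := t in
  GenTree.Node 0 [:: oapp bencode (GenTree.Leaf tt) l;
                     oapp bencode (GenTree.Leaf tt) r].

Fixpoint bdecode (c : GenTree.tree unit) : option btree :=
  if c is GenTree.Node _ [:: l; r] then Some (BNode (bdecode l) (bdecode r))
  else None.

Lemma bencodeK : pcancel bencode bdecode.
Proof.
elim=> l r IHl IHr /=; congr (Some (BNode _ _)).
  by case: l IHl => //= a ->.
by case: r IHr => //= a ->.
Qed.

HB.instance Definition _ := Countable.copy btree (pcan_type bencodeK).

Fixpoint bsize (t : btree) : nat :=
  let: BNode l r := t in (oapp bsize 0 l + oapp bsize 0 r).+1.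

(* The list of the fringe subtrees [t(v)], one entry for each node [v]. *)
Fixpoint bfringe (t : btree) : seq btree :=
  let: BNode l r := t in t :: oapp bfringe [::] l ++ oapp bfringe [::] r.

Unset Elimination Schemes.
Inductive otree : Type := ONode of seq otree.
Set Elimination Schemes.

Fixpoint oencode (t : otree) : GenTree.tree void :=
  let: ONode ts := t in GenTree.Node 0 (map oencode ts).

Fixpoint odecode (c : GenTree.tree void) : otree :=
  if c is GenTree.Node _ cs then ONode (map odecode cs) else ONode [::].

Lemma oencodeK : cancel oencode odecode.
Proof.
rewrite /cancel; fix IH 1 => -[ts] /=; congr ONode.
by elim: ts => [|t ts IHts]; [reflexivity|rewrite /= IHts (IH t)].
Qed.

HB.instance Definition _ := Countable.copy otree (can_type oencodeK).

Lemma otree_ind (P : otree -> Prop) :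
  (forall ts, (forall t, t \in ts -> P t) -> P (ONode ts)) -> forall t, P t.
Proof.
move=> H; fix IH 1 => -[ts]; apply: H.
elim: ts => [|t ts IHts] u; first by move=> e; discriminate e.
by rewrite inE => /orP[/eqP->|]; [exact: (IH t)|exact: IHts].
Qed.

Fixpoint osize (t : otree) : nat :=
  let: ONode ts := t in (sumn (map osize ts)).+1.

Fixpoint ofringe (t : otree) : seq otree :=
  let: ONode ts := t in t :: flatten (map ofringe ts).

(* Isomorphism of rooted trees: the children of the two roots can be matched
   bijectively so that matched children are isomorphic. *)
Fixpoint uiso (t u : otree) : bool :=
  let: ONode ts := t in let: ONode us := u in
  has (fun us' => all2 uiso ts us') (permutations us).

Lemma uisoP ts us :
  reflect (exists2 us', perm_eq us' us & all2 uiso ts us')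
          (uiso (ONode ts) (ONode us)).
Proof.
apply: (iffP hasP) => -[us']; first by rewrite mem_permutations; exists us'.
by move=> pus ?; exists us'; rewrite ?mem_permutations.
Qed.

Lemma uiso_refl : reflexive uiso.
Proof.
elim=> ts IH; apply/uisoP; exists ts => //.
elim: ts IH => //= t ts IHts IH; rewrite IH ?mem_head//= IHts// => u uts.
by rewrite IH// inE uts orbT.
Qed.

Lemma all2_permr (T : Type) (A : eqType) (r : T -> A -> bool) ts us us' :
  all2 r ts us -> perm_eq us us' ->
  exists2 s, perm_eq s (iota 0 (size ts)) &
    forall t0, all2 r (map (nth t0 ts) s) us'.
Proof.
case: ts => [|t ts]; case: us => [|u us] //.
  by move=> _ /perm_size/esym/size0nil ->; exists [::].
rewrite all2E => /andP[/eqP sz rtu].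
rewrite perm_sym => /(perm_iotaP u)[s ps ->]; rewrite -sz in ps.
exists s => // t0; rewrite all2E !size_map eqxx/= zip_map all_map.
apply/allP => i; rewrite (perm_mem ps) mem_iota add0n /= => lti.
have /(all_nthP (t0, u))/(_ i) := rtu.
by rewrite size_zip -sz minnn nth_zip//; exact.
Qed.

Lemma all2_flip (T U : Type) (r : T -> U -> bool) ts us :
  all2 r ts us = all2 (fun u t => r t u) us ts.
Proof. by elim: ts us => [|t ts IH] [|u us] //=; rewrite IH. Qed.

Lemma uiso_impl_sym t u : uiso t u -> uiso u t.
Proof.
elim: t u => ts IH [us] /uisoP[us' pus rtu]; apply/uisoP.
have [s ps /(_ (ONode [::]))] := all2_permr rtu pus.
set ts' := map _ _ => rtu'.
have pts : perm_eq ts' ts by apply/(perm_iotaP (ONode [::])); exists s.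
exists ts' => //; rewrite all2_flip.
have : {subset ts' <= ts} by move=> x; rewrite (perm_mem pts).
elim: ts' us rtu' {pus pts rtu} => [|t ts' IHts] [|u us] //= /andP[tu rtu] sub.
rewrite IH ?sub ?mem_head//= IHts// => x xts.
by rewrite sub// inE xts orbT.
Qed.

Lemma uiso_sym : symmetric uiso.
Proof. by move=> t u; apply/idP/idP; exact: uiso_impl_sym. Qed.

Lemma uiso_trans : transitive uiso.
Proof.
move=> u t v; elim: t u v => ts IH [us] [vs] /uisoP[us' pus rtu].
move=> /uisoP[vs' pvs]; rewrite all2_flip => ruv; rewrite perm_sym in pus.
have [s ps /(_ (ONode [::]))] := all2_permr ruv pus.
set vs'' := map _ _; rewrite all2_flip => ruv'.
have pvs' : perm_eq vs'' vs' by apply/(perm_iotaP (ONode [::])); exists s.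
apply/uisoP; exists vs''; first exact: perm_trans pvs.
elim: ts us' vs'' IH rtu ruv' {ruv pus pvs'} => [|t ts IHts] [|u us'] [|v vs''];
  rewrite //= => IH /andP[tu rtu] /andP[uv ruv].
rewrite (IH _ _ _ _ tu uv) ?mem_head//= (IHts _ _ _ rtu)// => x xts.
by apply: IH; rewrite inE xts orbT.
Qed.

Canonical uiso_equiv := EquivRel uiso uiso_refl uiso_sym uiso_trans.

Definition utree := {eq_quot uiso}.
HB.instance Definition _ := EqQuotient.on utree.
HB.instance Definition _ := Choice.on utree.

Definition usize (u : utree) : nat := osize (repr u).

(* See [ufringe_pi]: up to order, this does not depend on the representative. *)
Definition ufringe (u : utree) : seq utree :=
  [seq \pi_utree t | t <- ofringe (repr u)].

Lemma size_ofringe t : size (ofringe t) = osize t.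
Proof.
elim: t => ts IH /=; rewrite size_flatten /shape -map_comp.
by congr (sumn _).+1; apply/eq_in_map.
Qed.

Lemma uiso_fringe t u : uiso t u ->
  perm_eq [seq \pi_utree s | s <- ofringe t] [seq \pi_utree s | s <- ofringe u].
Proof.
elim: t u => ts IH [us] tu /=.
rewrite (_ : \pi_utree (ONode ts) = \pi_utree (ONode us)) ?perm_cons; last first.
  by apply/eqP; rewrite pi_eq_quot.
case/uisoP: tu => us' /(perm_map ofringe)/perm_flatten pus rtu.
apply: (perm_trans _ (perm_map _ pus)) => {us pus}.
elim: ts us' IH rtu => [|t ts IHts] [|u us] //= IH /andP[tu rtu].
rewrite !map_cat; apply: perm_cat; first by apply: IH; rewrite ?mem_head.
by apply: IHts => // x xts; apply: IH; rewrite inE xts orbT.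
Qed.

Lemma uiso_repr_pi t : uiso (repr (\pi_utree t)) t.
Proof. by rewrite -(pi_eq_quot (s := utree)) reprK. Qed.

Lemma ufringe_pi t :
  perm_eq (ufringe (\pi_utree t)) [seq \pi_utree s | s <- ofringe t].
Proof. exact/uiso_fringe/uiso_repr_pi. Qed.

Lemma usize_pi t : usize (\pi_utree t) = osize t.
Proof.
by have /perm_size := ufringe_pi t; rewrite !size_map !size_ofringe.
Qed.

Inductive bkeys : Type := KNode of option bkeys & nat & option bkeys.

Fixpoint binsert (x : nat) (t : bkeys) : bkeys :=
  let: KNode l y r := t in
  if (x < y)%N
  then KNode (Some (oapp (binsert x) (KNode None x None) l)) y r
  else KNode l y (Some (oapp (binsert x) (KNode None x None) r)).

Fixpoint bshape (t : bkeys) : btree :=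
  let: KNode l _ r := t in BNode (omap bshape l) (omap bshape r).

Definition bst_of (xs : seq nat) : btree :=
  bshape (foldl (fun t x => binsert x t)
                (KNode None (head 0 xs) None) (behead xs)).

(* The keys 1, ..., n are inserted in the order s(1), ..., s(n).  For n = 0 the
   value is meaningless, since all trees are nonempty. *)
Definition bst (n : nat) (s : 'S_n) : btree :=
  bst_of [seq (s i).+1 | i : 'I_n].

Unset Elimination Schemes.
Inductive olabels : Type := LNode of nat & seq olabels.
Set Elimination Schemes.

(* Attach a node labelled [i] to the node labelled [p].  Labels arrive in
   increasing order, so that a new child goes to the right of its siblings. *)
Fixpoint oattach (p i : nat) (t : olabels) : olabels :=
  let: LNode x ts := t in
  let ts' := map (oattach p i) ts in
  LNode x (if x == p then rcons ts' (LNode i [::]) else ts').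

Fixpoint oshape (t : olabels) : otree :=
  let: LNode _ ts := t in ONode (map oshape ts).

(* Independent uniform choices of the parents amount to a uniform element of
   this product: the node i + 2 (with i = 0, ..., n - 2) is attached to the
   node w i + 1, which ranges over 1, ..., i + 1. *)
Definition parents (n : nat) := {dffun forall i : 'I_n.-1, 'I_i.+1}.
HB.instance Definition _ (n : nat) := Finite.on (parents n).

Definition rrt (n : nat) (w : parents n) : otree :=
  oshape (foldl (fun t i => oattach (w i).+1 i.+2 t)
                (LNode 1 [::]) (enum 'I_n.-1)).

Definition urrt (n : nat) (w : parents n) : utree := \pi_utree (rrt w).

Section uniform.
Context {R : realType} {Omega : finType}.

Definition Prob (A : pred Omega) : R := #|A|%:R / #|Omega|%:R.

Definition Mean (X : Omega -> R) : R := (\sum_w X w) / #|Omega|%:R.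

Definition Var (X : Omega -> R) : R := Mean (fun w => (X w - Mean X) ^+ 2).

End uniform.

(* The normal law with mean 0 and variance [v].  The library's [normal_prob]
   takes a standard deviation, and it is not a point mass when this is 0. *)
Definition centered_normal (R : realType) (v : R) :
    probability (measurableTypeR R) R :=
  if v == 0 then (\d_(0 : measurableTypeR R) : probability _ _)
  else (normal_prob 0 (Num.sqrt v) : probability _ _).

Definition cvg_in_distribution (R : realType) (Omega : nat -> finType)
    (X : forall n, Omega n -> R) (P : probability (measurableTypeR R) R) : Prop :=
  forall h : R -> R, continuous h -> (exists M, forall x, `|h x| <= M) ->
    Mean (fun w => h (X n w)) @[n --> \oo] --> Rintegral P setT h.

Section fringe.
Context {R : realType}.

Definition bsum (f : btree -> R) (t : btree) : R := \sum_(s <- bfringe t) f s.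
Definition osum (f : otree -> R) (t : otree) : R := \sum_(s <- ofringe t) f s.
Definition usum (f : utree -> R) (t : utree) : R := \sum_(s <- ufringe t) f s.

Definition beta_bst (k m : nat) : R :=
  4 * (k + m + 3)%N%:R / ((k + 1) * (k + 2) * (m + 1) * (m + 2))%N%:R
  - 4 * (k ^ 2 + 3 * k * m + m ^ 2 + 4 * k + 4 * m + 3)%N%:R
    / ((k + 1) * (m + 1) * (k + m + 1) * (k + m + 2) * (k + m + 3))%N%:R.

Definition beta_rrt (k m : nat) : R :=
  (k ^ 2 + k * m + m ^ 2 + k + m)%N%:R
  / (k * (k + 1) * m * (m + 1) * (k + m + 1))%N%:R.

Definition pbst (t : btree) : R := Prob (fun s : 'S_(bsize t) => bst s == t).
Definition prrt (t : otree) : R :=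
  Prob (fun w : parents (osize t) => rrt w == t).
Definition purrt (t : utree) : R :=
  Prob (fun w : parents (usize t) => urrt w == t).

(* The covariance constants when the first tree is the larger one; [c] is the
   number of copies of the second tree in the first one. *)
Definition bcov (t t' : btree) : R :=
  let k := bsize t in let c := count_mem t' (bfringe t) in
  2 / ((k + 1) * (k + 2))%N%:R * c%:R * pbst t
  - beta_bst k (bsize t') * pbst t * pbst t'.
Definition ocov (t t' : otree) : R :=
  let k := osize t in let c := count_mem t' (ofringe t) in
  1 / (k * (k + 1))%N%:R * c%:R * prrt t
  - beta_rrt k (osize t') * prrt t * prrt t'.
Definition ucov (t t' : utree) : R :=
  let k := usize t in let c := count_mem t' (ufringe t) in
  1 / (k * (k + 1))%N%:R * c%:R * purrt t
  - beta_rrt k (usize t') * purrt t * purrt t'.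

Definition bsigma (t t' : btree) : R :=
  if (bsize t' <= bsize t)%N then bcov t t' else bcov t' t.
Definition osigma (t t' : otree) : R :=
  if (osize t' <= osize t)%N then ocov t t' else ocov t' t.
Definition usigma (t t' : utree) : R :=
  if (usize t' <= usize t)%N then ucov t t' else ucov t' t.

End fringe.

(* These sets index sums [\sum_(x \in A) _], which are 0 by convention when the
   support is infinite. *)

Lemma finite_btree N : finite_set [set t : btree | (bsize t <= N)%N].
Proof.
elim: N => [|N IH].
  by rewrite (_ : [set _ | _] = set0)//; apply/seteqP; split=> // -[].
pose A := None |` (Some @` [set t : btree | (bsize t <= N)%N]).
have fA : finite_set A by rewrite /A finite_setU; split; last exact: finite_image.
apply: (sub_finite_set _ (finite_image (fun p => BNode p.1 p.2)
  (finite_setX fA fA))).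
move=> -[l r] /=; rewrite ltnS => le_lr; exists (l, r) => //=.
split.
  case: l le_lr => [t|] le_lr; [right; exists t => //|by left].
  exact: leq_trans (leq_addr _ _) le_lr.
case: r le_lr => [t|] le_lr; [right; exists t => //|by left].
exact: leq_trans (leq_addl _ _) le_lr.
Qed.

Lemma finite_seqs (T : choiceType) (A : set T) n : finite_set A ->
  finite_set [set s : seq T | (size s <= n)%N /\ forall x, x \in s -> A x].
Proof.
move=> fA; elim: n => [|n IH].
  apply: (sub_finite_set _ (finite_set1 [::])) => s [/=].
  by rewrite leqn0 size_eq0 => /eqP.
have fX : finite_set ([set [::]] `|` (fun p => p.1 :: p.2) @` (A `*`
    [set s : seq T | (size s <= n)%N /\ forall x, x \in s -> A x])).
  rewrite finite_setU; split; first exact: finite_set1.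
  exact/finite_image/finite_setX.
apply: (sub_finite_set _ fX) => -[|x s] [/=]; first by left.
rewrite ltnS => les sA; right; exists (x, s) => //=; split.
  by apply: sA; rewrite mem_head.
by split=> // y ys; apply: sA; rewrite inE ys orbT.
Qed.

Lemma osize_gt0 t : (0 < osize t)%N. Proof. by case: t. Qed.

Lemma finite_otree N : finite_set [set t : otree | (osize t <= N)%N].
Proof.
elim: N => [|N IH].
  by rewrite (_ : [set _ | _] = set0)//; apply/seteqP; split=> // -[].
apply: (sub_finite_set _ (finite_image ONode (finite_seqs N IH))).
move=> -[ts] /=; rewrite ltnS => lets; exists ts => //; split.
  apply: leq_trans lets; elim: ts => //= t ts IHts.
  by rewrite -add1n leq_add// osize_gt0.
move=> t /=; elim: ts lets => //= u ts IHts lets.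
rewrite inE => /orP[/eqP->|]; first exact: leq_trans (leq_addr _ _) lets.
by apply: IHts; exact: leq_trans (leq_addl _ _) lets.
Qed.

Lemma finite_utree N : finite_set [set t : utree | (usize t <= N)%N].
Proof.
apply: (sub_finite_set _ (finite_image \pi_utree (finite_otree N))) => u /= uN.
by exists (repr u) => //; rewrite reprK.
Qed.

(* Main.v *)
(* A uniform random permutation, and a uniform random choice of parents, are both
   encoded by binary trees grown by adding a node at a uniform external position
   (for recursive trees, through the left child, right sibling correspondence).
   In such a tree of size n + 1 the left subtree has a uniform size in 0, ..., n,
   and given the sizes the two subtrees are independent trees of the same kind.
   So F(node l r) = g(l, r) + F(l) + F(r) yields quicksort recurrences for the
   means and the variances of the additive functional F with toll g.  Solving
   them gives three facts.
   - The parts of F coming from the fringe subtrees of size k and of size m have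
     covariance exactly (n + 1) times a constant, as soon as n >= k + m + 2.
   - The variance of F is at most (n + 1) times a quantity that tends to 0 when f
     is restricted to the trees of size > N and N tends to infinity.
   - If f vanishes on the trees of size > N, then E cos(t (F - E F) + theta)
     differs from exp(- v t^2 / 2)^(n + 1) cos theta by O(n |t|^3): the recurrence
     loses only O(|t|^3) per node.  This is a central limit theorem.
   The theorem follows by approximation.  Convergence in distribution is deduced
   from that of the characteristic functions by comparing the test function with
   a polynomial in sin(x / L). *)

Require Import Defs.
From mathcomp Require Import all_boot all_order all_algebra perm.
From mathcomp Require Import all_classical all_reals all_analysis.
From mathcomp Require Import measurable_realfun.
From mathcomp Require Import ring lra zify.
Import Order.TTheory GRing.Theory Num.Theory.
Import numFieldNormedType.Exports.

Set Implicit Arguments.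
Unset Strict Implicit.
Unset Printing Implicit Defensive.

Local Open Scope classical_set_scope.
Local Open Scope ring_scope.

(** * Binary trees grown at uniform external positions *)

(** The number of external positions, one more than the size, is additive when a tree is split at
    its root. A mean or a variance proportional to it, and a power q^(n + 1), therefore pass through
    the split without error, so for a truncated toll only the subtrees below a fixed size perturb
    the recurrence. Real cosines with a phase do the work of complex characteristic functions:
    conditioning on one of the two independent subtrees merely changes theta, so an error bound
    uniform in theta closes the induction. The obstacle for the variance is that the toll is
    correlated with the functional on the subtrees, while the hypotheses only control its standard
    deviation. Cauchy-Schwarz then brings in the square root of the variance being estimated; since
    a square root grows more slowly than its argument, this circular bound can still be closed. In
    the encoding of a recursive tree the descendants of a node form its left subtree, so the toll
    depends on l alone. The root of the recursive tree has no node in the encoding; its toll is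
    added at the end and is negligible at scale sqrt n. *)

Notation tree0 := (option btree).
Definition leaf := BNode None None.
Definition node (l r : tree0) : tree0 := Some (BNode l r).
Definition size0 (t : tree0) : nat := oapp bsize 0 t.

(** An absent child counts as one external position, to be filled by [leaf]; a tree with n nodes has
    n + 1 of them. *)
Fixpoint bext (t : btree) : seq btree :=
  let: BNode l r := t in
  [seq BNode (Some l') r | l' <- oapp bext [:: leaf] l] ++
  [seq BNode l (Some r') | r' <- oapp bext [:: leaf] r].

Definition ext (t : tree0) : seq tree0 := map Some (oapp bext [:: leaf] t).

Lemma ext_node l r :
  ext (node l r) = [seq node l' r | l' <- ext l] ++ [seq node l r' | r' <- ext r].
Proof. by rewrite /ext /= map_cat -!map_comp. Qed.

Lemma tree0_ind (P : tree0 -> Prop) :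
  P None -> (forall l r, P l -> P r -> P (node l r)) -> forall t, P t.
Proof.
move=> P0 PN; case=> [t|//]; elim: t => l r IHl IHr; apply: PN.
  by case: l IHl => // t; exact.
by case: r IHr => // t; exact.
Qed.

Lemma size_node l r : size0 (node l r) = (size0 l + size0 r).+1.
Proof. by []. Qed.

Lemma size_ext t : size (ext t) = (size0 t).+1.
Proof.
elim/tree0_ind: t => [//|l r IHl IHr].
by rewrite ext_node size_cat (size_map (node^~ r)) (size_map (node l)) IHl IHr addSn addnS.
Qed.

Lemma ext_size t t' : t' \in ext t -> size0 t' = (size0 t).+1.
Proof.
elim/tree0_ind: t t' => [|l r IHl IHr] t'; first by rewrite inE => /eqP->.
rewrite ext_node mem_cat => /orP[] /mapP[u uext ->]; rewrite !size_node.
  by rewrite (IHl _ uext).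
by rewrite (IHr _ uext) addnS.
Qed.

(** Enumerates growth histories, not trees: a tree occurs once for each order in which its nodes can
    be added. A uniform entry thus has the law of the grown tree. *)
Fixpoint hist (n : nat) : seq tree0 :=
  if n is n'.+1 then flatten [seq ext t | t <- hist n'] else [:: None].

Lemma hist_size n t : t \in hist n -> size0 t = n.
Proof.
elim: n t => [|n IH] t; first by rewrite inE => /eqP->.
by move=> /flatten_mapP[u /IH <-] /ext_size.
Qed.

Lemma size_hist n : size (hist n) = n`!.
Proof.
elim: n => //= n IH; rewrite size_flatten /shape -map_comp.
rewrite (_ : map _ _ = [seq n.+1 | _ <- hist n]).
  by rewrite sumnE big_map big_const_seq count_predT IH iter_addn_0 factS.
by apply/eq_in_map => t /hist_size <- /=; exact: size_ext.
Qed.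

Section expectation.
Context {R : realType}.
Implicit Types (phi psi : tree0 -> R) (n : nat).

Definition E n phi : R := (\sum_(t <- hist n) phi t) / n`!%:R.

Lemma eq_E n phi psi :
  (forall t, size0 t = n -> phi t = psi t) -> E n phi = E n psi.
Proof.
by move=> e; congr (_ / _); apply: eq_big_seq => t /hist_size; exact: e.
Qed.

Lemma E0 phi : E 0 phi = phi None.
Proof. by rewrite /E big_seq1 fact0 divr1. Qed.

Lemma ED n phi psi : E n (fun t => phi t + psi t) = E n phi + E n psi.
Proof. by rewrite /E big_split mulrDl. Qed.

Lemma EZ n a phi : E n (fun t => a * phi t) = a * E n phi.
Proof. by rewrite /E -mulr_sumr mulrA. Qed.

Lemma EZr n a phi : E n (fun t => phi t * a) = E n phi * a.
Proof. by rewrite /E -mulr_suml mulrAC. Qed.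

Lemma EN n phi : E n (fun t => - phi t) = - E n phi.
Proof. by rewrite /E sumrN mulNr. Qed.

Lemma EB n phi psi : E n (fun t => phi t - psi t) = E n phi - E n psi.
Proof. by rewrite ED EN. Qed.

Lemma E_cst n a : E n (fun=> a) = a.
Proof.
by rewrite /E big_const_seq count_predT size_hist iter_addr addr0 -[a *+ _]mulr_natr mulfK.
Qed.

Lemma E_sum n (I : Type) (r : seq I) (P : pred I) (phi : I -> tree0 -> R) :
  E n (fun t => \sum_(i <- r | P i) phi i t) = \sum_(i <- r | P i) E n (phi i).
Proof. by rewrite /E exchange_big mulr_suml. Qed.

Lemma le_E n phi psi :
  (forall t, size0 t = n -> phi t <= psi t) -> E n phi <= E n psi.
Proof.
move=> le; rewrite /E ler_wpM2r// ?invr_ge0// !big_seq.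
by apply: ler_sum => t /hist_size; exact: le.
Qed.

Lemma E_ge0 n phi : (forall t, size0 t = n -> 0 <= phi t) -> 0 <= E n phi.
Proof. by move=> le; rewrite -(E_cst n 0); exact: le_E. Qed.

Lemma normr_E n phi : `|E n phi| <= E n (fun t => `|phi t|).
Proof.
rewrite /E normrM normfV normr_nat ler_wpM2r ?invr_ge0//.
exact: ler_norm_sum.
Qed.

Lemma E_grow n phi : E n.+1 phi = E n (fun t => \sum_(t' <- ext t) phi t') / n.+1%:R.
Proof.
rewrite /E /= big_flatten big_map factS natrM invfM mulrA mulrAC.
by [].
Qed.

Lemma E_fubini i j (phi : tree0 -> tree0 -> R) :
  E i (fun l => E j (fun r => phi l r)) = E j (fun r => E i (fun l => phi l r)).
Proof.
rewrite /E; under eq_bigr do rewrite mulr_suml.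
under [in RHS]eq_bigr do rewrite mulr_suml.
rewrite exchange_big /= !mulr_suml; apply: eq_bigr => t _.
by rewrite !mulr_suml; apply: eq_bigr => u _; rewrite mulrAC.
Qed.

(* Growing a node at a uniform external position makes the size of the left
   subtree a Polya urn, whence the uniform split at the root. *)
Lemma E_split n phi :
  E n.+1 phi = (\sum_(i < n.+1) E i (fun l => E (n - i) (fun r => phi (node l r))))
               / n.+1%:R.
Proof.
elim: n phi => [|n IH] phi.
  by rewrite big_ord1 E_grow !E0 /ext /= big_seq1.
rewrite E_grow IH; congr (_ / _).
(* The new node falls into the left or the right subtree; the weights i + 1 and n - i + 1 are their
   numbers of external positions. *)
transitivity ((\sum_(i < n.+1)
   (i.+1%:R * E i.+1 (fun l => E (n - i) (fun r => phi (node l r)))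
   + (n - i).+1%:R * E i (fun l => E (n - i).+1 (fun r => phi (node l r))))) / n.+1%:R).
  congr (_ / _); apply: eq_bigr => i _.
  rewrite E_grow mulrC divfK ?pnatr_eq0//.
  under [in X in _ + X]eq_E => l _ do rewrite E_grow.
  rewrite EZr [in X in _ + X]mulrC divfK ?pnatr_eq0//.
  under eq_E => l _ do under eq_E => r _ do
    rewrite ext_node big_cat /= !big_map.
  under eq_E => l _ do rewrite ED.
  rewrite ED; congr (_ + _).
    by apply: eq_E => l _; rewrite E_sum big_map.
  by apply: eq_E => l _; apply: eq_E => r _; rewrite big_map.
rewrite big_split /=.
pose T i := E i (fun l => E (n.+1 - i) (fun r => phi (node l r))).
have e1 : \sum_(i < n.+1) i.+1%:R * E i.+1 (fun l => E (n - i) (fun r => phi (node l r)))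
   = \sum_(i < n.+2) i%:R * T i.
  rewrite [RHS]big_ord_recl mul0r add0r; apply: eq_bigr => i _.
  by rewrite lift0 /T subSS.
have e2 : \sum_(i < n.+1) (n - i).+1%:R * E i (fun l => E (n - i).+1 (fun r => phi (node l r)))
   = \sum_(i < n.+2) (n.+1 - i)%:R * T i.
  rewrite [RHS]big_ord_recr /= subnn mul0r addr0; apply: eq_bigr => i _.
  by rewrite /T subSn// -ltnS.
(* After reindexing, a left subtree of size i carries weight i from growth on the left and n + 1 - i
   from growth on the right. The total n + 1 is the same for all i, so the size remains uniform. *)
rewrite e1 e2 -big_split /= mulr_suml; apply: eq_bigr => i _.
rewrite -mulrDl -natrD subnKC; last by rewrite -ltnS.
by rewrite mulrAC divff ?pnatr_eq0// mul1r.
Qed.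

End expectation.

(** * Random binary search trees *)

Fixpoint inorder (t : bkeys) : seq nat :=
  let: KNode l y r := t in oapp inorder [::] l ++ y :: oapp inorder [::] r.

Fixpoint kmap (h : nat -> nat) (t : bkeys) : bkeys :=
  let: KNode l y r := t in KNode (omap (kmap h) l) (h y) (omap (kmap h) r).

Lemma bkeys_ind' (P : bkeys -> Prop) :
  (forall l y r, (forall t, l = Some t -> P t) -> (forall t, r = Some t -> P t) ->
     P (KNode l y r)) -> forall t, P t.
Proof.
move=> H; fix IH 1 => -[l y r]; apply: H => t.
- by case: l => [a|] e; [case: e => <-; exact: (IH a)|discriminate].
- by case: r => [a|] e; [case: e => <-; exact: (IH a)|discriminate].
Qed.

Lemma perm_inorder_binsert x t : perm_eq (inorder (binsert x t)) (x :: inorder t).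
Proof.
apply/seq.permP => a; elim/bkeys_ind': t => l y r IHl IHr /=; case: ltnP => _ /=.
  rewrite !count_cat /=; case: l IHl => [l|] IHl /=; last by lia.
  by rewrite (IHl _ erefl) /=; lia.
rewrite !count_cat /=; case: r IHr => [r|] IHr /=; last by lia.
by rewrite (IHr _ erefl) /=; lia.
Qed.

Lemma pairwise_inorder_binsert x t : x \notin inorder t ->
  pairwise ltn (inorder t) -> pairwise ltn (inorder (binsert x t)).
Proof.
elim/bkeys_ind': t => l y r IHl IHr /=.
rewrite mem_cat inE !negb_or => /and3P[xl xy xr].
rewrite pairwise_cat /= => /and4P[lr pl yr pr].
have al x' (s : seq nat) : (forall z, z \in s -> (x' < z)%N) -> all (ltn x') s.
  by move=> h; apply/allP.
move/allrelP : lr => lr; move/allP : yr => yr.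
case: ltnP => [lxy|lyx] /=; rewrite pairwise_cat /=.
- apply/and4P; split=> //; last exact/allP.
    apply/allrelP => u v ul vr; have [uxl|uo] : u = x \/ u \in oapp inorder [::] l.
    + case: l ul {IHl pl xl lr} => [l|] /=; last by rewrite inE => /eqP; left.
      by rewrite (perm_mem (perm_inorder_binsert _ _)) inE => /orP[/eqP|]; [left|right].
    + rewrite {}uxl /=; move: vr; rewrite inE => /orP[/eqP->//|/yr].
      exact: ltn_trans.
    + exact: lr.
  by case: l IHl pl xl {lr} => //= l /(_ _ erefl) IHl pl xl; apply: IHl.
- have ylx : (y < x)%N by rewrite ltn_neqAle eq_sym xy.
  have mr v : v \in inorder (oapp (binsert x) (KNode None x None) r) ->
      v = x \/ v \in oapp inorder [::] r.
    case: r {IHr yr pr xr lr} => [r|] /=; last by rewrite inE => /eqP; left.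
    by rewrite (perm_mem (perm_inorder_binsert _ _)) inE => /orP[/eqP|]; [left|right].
  apply/and4P; split=> //.
  + apply/allrelP => u v ul; rewrite inE => /orP[/eqP->|/mr[->|vr]].
    * by apply: lr; rewrite ?mem_head.
    * by apply: ltn_trans ylx; apply: lr; rewrite ?mem_head.
    * by apply: lr; rewrite // inE vr orbT.
  + by apply/allP => v /mr[->//|]; exact: yr.
  + by case: r IHr pr xr {lr yr mr} => //= r /(_ _ erefl) IHr pr xr; apply: IHr.
Qed.

Lemma bshape_kmap h t : bshape (kmap h t) = bshape t.
Proof.
elim/bkeys_ind': t => l y r IHl IHr /=; congr BNode.
  by case: l IHl => //= l /(_ _ erefl) ->.
by case: r IHr => //= r /(_ _ erefl) ->.
Qed.

Lemma binsert_kmap h x t : {mono h : x y / (x < y)%N} ->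
  binsert (h x) (kmap h t) = kmap h (binsert x t).
Proof.
move=> hm; elim/bkeys_ind': t => l y r IHl IHr /=; rewrite hm.
case: ifP => _ /=; congr (KNode _ _ _).
  by case: l IHl => //= l /(_ _ erefl) ->.
by case: r IHr => //= r /(_ _ erefl) ->.
Qed.

Definition key_tree (xs : seq nat) : bkeys :=
  foldl (fun t x => binsert x t) (KNode None (head 0%N xs) None) (behead xs).

Lemma key_tree_rcons xs x : xs != [::] ->
  key_tree (rcons xs x) = binsert x (key_tree xs).
Proof. by case: xs => // y xs _; rewrite /key_tree /= foldl_rcons. Qed.

Lemma key_tree_map h xs : xs != [::] -> {mono h : x y / (x < y)%N} ->
  key_tree (map h xs) = kmap h (key_tree xs).
Proof.
move=> xs0 hm; elim/last_ind: xs xs0 => // xs x IH _.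
have [->//|xs0] := eqVneq xs [::].
have mxs0 : map h xs != [::] by rewrite -size_eq0 size_map size_eq0.
by rewrite map_rcons !key_tree_rcons// IH// (binsert_kmap _ _ hm).
Qed.

Lemma inorder_key_tree xs : xs != [::] -> uniq xs ->
  perm_eq (inorder (key_tree xs)) xs /\ pairwise ltn (inorder (key_tree xs)).
Proof.
elim/last_ind: xs => // xs x IH _; rewrite rcons_uniq => /andP[xxs uxs].
have [->//|xs0] := eqVneq xs [::].
have [p1 p2] := IH xs0 uxs; rewrite key_tree_rcons//; split.
  apply: (perm_trans (perm_inorder_binsert _ _)).
  by rewrite perm_sym perm_rcons perm_cons perm_sym.
by apply: pairwise_inorder_binsert; rewrite ?(perm_mem p1).
Qed.

(* The rank of the new key decides which external position is filled. *)
Lemma sum_bshape_binsert (V : nmodType) (phi : btree -> V) a t n :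
  inorder t = iota a n ->
  \sum_(a <= j < a + n.+1) phi (bshape (binsert j (kmap (bump j) t)))
  = \sum_(t' <- bext (bshape t)) phi t'.
Proof.
elim/bkeys_ind': t phi a n => l y r IHl IHr phi a n /=.
set il := oapp inorder [::] l; set ir := oapp inorder [::] r => e.
have sz : n = (size il + (size ir).+1)%N.
  by rewrite -(size_iota a n) -e size_cat.
move: e; rewrite sz iotaD => /eqP; rewrite eqseq_cat ?size_iota//= eqseq_cons.
move=> /and3P[/eqP el /eqP ey /eqP er].
have aux (w : option bkeys) : (forall t, w = Some t -> forall (phi : btree -> V) a n,
    inorder t = iota a n ->
    \sum_(a <= j < a + n.+1) phi (bshape (binsert j (kmap (bump j) t))) =
    \sum_(t' <- bext (bshape t)) phi t') ->
  forall (phi : btree -> V) a n, oapp inorder [::] w = iota a n ->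
  \sum_(a <= j < a + n.+1) phi (bshape
     (oapp (binsert j) (KNode None j None) (omap (kmap (bump j)) w))) =
  \sum_(t' <- oapp bext [:: leaf] (omap bshape w)) phi t'.
  case: w => [w|] h phi' a' n' /=; first exact: h.
  by case: n' => // _; rewrite addn1 big_nat1 big_seq1.
have osh (w : option bkeys) h : omap bshape (omap (kmap h) w) = omap bshape w.
  by case: w => //= w; rewrite bshape_kmap.
rewrite big_cat /= !big_map.
(* The root key is y = a + size il. A new key j <= y pushes it up to y + 1 and goes left; a key j >
   y leaves it in place and goes right. *)
rewrite (@big_cat_nat _ _ _ (a + (size il).+1)%N) /=; [|lia|lia].
congr (_ + _).
  rewrite -(aux l IHl (fun u => phi (BNode (Some u) (omap bshape r))) a (size il) el).
  apply: eq_big_nat => j /andP[_ lt]; rewrite /bump.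
  have -> : (j <= y)%N = true by lia.
  have -> : (j < true + y)%N = true by lia.
  by rewrite /= osh.
rewrite -(aux r IHr (fun u => phi (BNode (omap bshape l) (Some u))) y.+1 (size ir)).
  rewrite (_ : (y.+1 + (size ir).+1 = a + (size il + (size ir).+1).+1)%N); last by lia.
  rewrite (_ : (a + (size il).+1 = y.+1)%N); last by lia.
  apply: eq_big_nat => j /andP[lt _]; rewrite /bump.
  have -> : (j <= y)%N = false by lia.
  have -> : (j < false + y)%N = false by lia.
  by rewrite /= osh.
by rewrite ey -er.
Qed.

(** A permutation amounts to its last value together with the relative order of the others
    ([lift_perm]). Relabelling by the increasing map [bump] keeps the shape, so the last key meets
    the tree of the shorter permutation, and its rank is uniform. *)
Lemma sum_bst (V : nmodType) (phi : btree -> V) n :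
  \sum_(s : 'S_n.+2) phi (bst s)
  = \sum_(s : 'S_n.+1) \sum_(t <- bext (bst s)) phi t.
Proof.
pose L (p : 'I_n.+2 * 'S_n.+1) := lift_perm ord_max p.1 p.2.
have Linj : injective L.
  move=> [j s] [j' s'] e; have ej : j = j'.
    by have := congr1 (fun u : 'S__ => u ord_max) e; rewrite /L !lift_perm_id.
  subst j'; congr pair; apply/permP => i; apply: (@lift_inj _ j).
  by have := congr1 (fun u : 'S__ => u (lift ord_max i)) e; rewrite /L !lift_perm_lift.
have Lbij : bijective L.
  by apply: inj_card_bij => //; rewrite card_prod !card_Sn card_ord factS.
rewrite (reindex L); last exact: onW_bij.
rewrite -(pair_bigA _ (fun j s => phi (bst (L (j, s))))) exchange_big /=.
apply: eq_bigr => s _.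
set xs := [seq (s i).+1 | i : 'I_n.+1].
have xs0 : xs != [::] by rewrite -size_eq0 size_map size_enum_ord.
have uxs : uniq xs.
  by rewrite map_inj_uniq ?enum_uniq// => i j [] /val_inj; exact: perm_inj.
have pxs : perm_eq xs (iota 1 n.+1).
  apply: uniq_perm; rewrite ?iota_uniq// => k; rewrite mem_iota add1n.
  apply/mapP/idP => [[i _ ->]|/andP[k0 kn]]; first by rewrite /= 2!ltnS -ltnS ltn_ord.
  have kn' : (k.-1 < n.+1)%N by lia.
  exists ((s^-1)%g (Ordinal kn')); first by rewrite mem_enum.
  by rewrite permKV /= prednK.
have [p1 p2] := inorder_key_tree xs0 uxs.
have io : inorder (key_tree xs) = iota 1 n.+1.
  apply: (irr_sorted_eq ltn_trans ltnn).
  - by rewrite sorted_pairwise//; exact: ltn_trans.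
  - exact: iota_ltn_sorted.
  - by move=> k; rewrite (perm_mem p1) (perm_mem pxs).
rewrite -[bst s]/(bshape (key_tree xs)) -(sum_bshape_binsert _ io).
rewrite big_add1 /= big_mkord; apply: eq_bigr => j _; congr phi.
rewrite /bst -[bst_of _]/(bshape (key_tree _)) /image_mem enum_ordSr map_rcons -map_comp.
rewrite /L lift_perm_id /=; congr bshape.
have -> : [seq ((fun i : 'I_n.+2 => (lift_perm ord_max j s i).+1)
    \o widen_ord (leqnSn n.+1)) i | i <- enum 'I_n.+1] = map (bump j.+1) xs.
  rewrite -[RHS]map_comp; apply: eq_map => i /=.
  rewrite (_ : widen_ord _ i = lift ord_max i) ?lift_perm_lift /=; last first.
    by apply: val_inj; rewrite /= /bump leqNgt ltn_ord.
  by rewrite /bump ltnS addnS.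
rewrite key_tree_rcons; last by rewrite -size_eq0 size_map size_eq0.
by rewrite key_tree_map// => x y; rewrite !ltnNge leq_bump2.
Qed.

Section bst_mean.
Context {R : realType}.

Lemma Mean_bst (phi : btree -> R) n :
  Mean (fun s : 'S_n.+1 => phi (bst s)) = E n.+1 (oapp phi 0).
Proof.
elim: n phi => [|n IH] phi.
  rewrite E_grow E0 /ext /= big_seq1 /= /Mean card_Sn factS fact0 mul1n.
  congr (_ / _); rewrite (eq_bigr (fun=> phi leaf)).
    by rewrite big_const card_Sn /= addr0.
  by move=> s _; rewrite /bst /image_mem enum_ordSr (_ : enum 'I_0 = [::])//; apply: size0nil; rewrite size_enum_ord.
rewrite /Mean sum_bst card_Sn factS mulnC natrM invfM mulrA -card_Sn.
rewrite -/(Mean (fun s : 'S_n.+1 => \sum_(t <- bext (bst s)) phi t)).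
rewrite (IH (fun t => \sum_(t <- bext t) phi t)) [RHS]E_grow; congr (_ / _).
by apply: eq_E => -[t|] //= _; rewrite /ext big_map.
Qed.

End bst_mean.

(** * Random recursive trees *)

Fixpoint labels (t : olabels) : seq nat :=
  let: LNode y ts := t in y :: flatten (map labels ts).

Lemma olabels_ind' (P : olabels -> Prop) (Q : seq olabels -> Prop) :
  Q [::] -> (forall t ts, P t -> Q ts -> Q (t :: ts)) ->
  (forall y ts, Q ts -> P (LNode y ts)) ->
  (forall t, P t) /\ (forall ts, Q ts).
Proof.
move=> Q0 QS PN; suff Pt t : P t by split=> //; elim=> // *; exact: QS.
move: t; fix IH 1 => -[y ts]; apply: PN; elim: ts => [//|t ts IHts].
by apply: QS => //; exact: IH.
Qed.

Lemma count_labels_oattach a p x t :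
  count a (labels (oattach p x t)) =
  (count a (labels t) + a x * count_mem p (labels t))%N.
Proof.
pose Q ts := count a (flatten (map labels (map (oattach p x) ts))) =
  (count a (flatten (map labels ts)) + a x * count_mem p (flatten (map labels ts)))%N.
have ind := @olabels_ind' (fun t => count a (labels (oattach p x t)) =
  (count a (labels t) + a x * count_mem p (labels t))%N) Q.
refine (proj1 (ind _ _ _) t).
- by rewrite /Q /= muln0.
- by rewrite /Q => {}t ts IH IHs /=; rewrite !count_cat IH IHs mulnDr addnACA.
- rewrite /Q => y ts IH /=; case: eqVneq => [->|yp] /=; last by rewrite IH addnA.
  by rewrite map_rcons flatten_rcons count_cat IH /= mulnDr muln1 !addn0 -!addnA; congr (_ + (_ + _))%N; rewrite addnC.
Qed.

Lemma oattach_notin p x t : p \notin labels t -> oattach p x t = t.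
Proof.
have ind := @olabels_ind' (fun t => p \notin labels t -> oattach p x t = t)
  (fun ts => p \notin flatten (map labels ts) -> map (oattach p x) ts = ts).
refine (proj1 (ind _ _ _) t).
- by [].
- by move=> {}t ts IH IHs /=; rewrite mem_cat negb_or => /andP[/IH-> /IHs->].
- move=> y ts IH /=; rewrite inE negb_or eq_sym => /andP[/negbTE-> /IH->].
  by [].
Qed.

Fixpoint bforest (t : btree) : seq otree :=
  let: BNode l r := t in ONode (oapp bforest [::] l) :: oapp bforest [::] r.

Definition forest (t : tree0) : seq otree := oapp bforest [::] t.

(* Left child, right sibling: a rooted ordered tree with [n.+1] nodes becomes a
   binary tree with [n] nodes. *)
Definition rtree (t : tree0) : otree := ONode (forest t).

Lemma forest_node l r : forest (node l r) = rtree l :: forest r.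
Proof. by []. Qed.

Fixpoint btree_of (t : otree) : tree0 :=
  let: ONode ts := t in foldr (fun u acc => node (btree_of u) acc) None ts.

Lemma rtreeK : cancel rtree btree_of.
Proof.
elim/tree0_ind => [//|l r IHl IHr].
by move: IHl IHr; rewrite /rtree forest_node /= => -> ->.
Qed.

Lemma btree_ofK : cancel btree_of rtree.
Proof.
elim=> ts IH; rewrite /rtree /=; congr ONode.
elim: ts IH => // t ts IHts IH; rewrite [foldr _ _ _]/= forest_node IH ?mem_head// IHts// => u uts.
by apply: IH; rewrite inE uts orbT.
Qed.

Lemma osize_rtree t : osize (rtree t) = (size0 t).+1.
Proof.
elim/tree0_ind: t => [//|l r IHl IHr]; move: IHr; rewrite /rtree forest_node /= => -[IHr].
by rewrite -/(forest l) -[(sumn _).+1]/(osize (rtree l)) IHl IHr addSn.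
Qed.

(** External positions correspond to parents: a new last child of p goes to the end of the chain of
    right siblings in the left subtree of p. The end of the chain at the root of t belongs to the
    virtual parent of the whole forest, hence the separate term. *)
Lemma sum_oshape_oattach (V : nmodType) (phi : seq otree -> V) x t ts :
  map oshape ts = forest t -> uniq (flatten (map labels ts)) ->
  \sum_(p <- flatten (map labels ts)) phi (map oshape (map (oattach p x) ts))
    + phi (rcons (forest t) (ONode [::]))
  = \sum_(t' <- ext t) phi (forest t').
Proof.
elim/tree0_ind: t phi ts => [|l r IHl IHr] phi ts.
  by case: ts => //= _ _; rewrite big_nil add0r big_seq1.
rewrite forest_node; case: ts => [//|[y vs] us] /= [evs eus].
rewrite cat_uniq mem_cat negb_or => /and3P[/andP[yv yu] uv /andP[dis uu]].
have off p : p \notin flatten (map labels us) ->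
    map oshape (map (oattach p x) us) = forest r.
  move=> pu; rewrite -eus; congr map; elim: us pu {eus yu dis uu} => //= u us IHu.
  by rewrite mem_cat negb_or => /andP[/oattach_notin-> /IHu->].
rewrite ext_node big_cat big_map big_map /=.
(* In the induction the separate term for [l] is the attachment to the first root y, and the one for
   [r] is the attachment to the common parent. *)
rewrite -(IHl (fun s => phi (ONode s :: forest r)) vs)//.
rewrite -(IHr (fun s => phi (rtree l :: s)) us)//.
rewrite big_cons eqxx big_cat /= -!addrA addrC -!addrA.
have offv p : p \notin flatten (map labels vs) ->
    map oshape (map (oattach p x) vs) = forest l.
  move=> pu; rewrite -evs; congr map; elim: vs pu {evs yv uv dis} => //= u ts IHu.
  by rewrite mem_cat negb_or => /andP[/oattach_notin-> /IHu->].
rewrite map_rcons offv// off//.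
have -> : \sum_(i <- flatten (map labels vs))
     phi (ONode (map oshape (if y == i then rcons (map (oattach i x) vs) (LNode x [::])
        else map (oattach i x) vs)) :: map oshape (map (oattach i x) us)) =
   \sum_(p <- flatten (map labels vs))
     phi (ONode (map oshape (map (oattach p x) vs)) :: forest r).
  apply: eq_big_seq => p pv; rewrite off.
    by case: eqVneq => // yp; rewrite yp pv in yv.
  by apply: contra dis => pu; apply/hasP; exists p.
have -> : \sum_(i <- flatten (map labels us))
     phi (ONode (map oshape (if y == i then rcons (map (oattach i x) vs) (LNode x [::])
        else map (oattach i x) vs)) :: map oshape (map (oattach i x) us)) =
   \sum_(p <- flatten (map labels us))
     phi (rtree l :: map oshape (map (oattach p x) us)).
  apply: eq_big_seq => p pu; rewrite ifN; last by apply: contraNneq yu => ->.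
  rewrite offv//; apply: contra dis => pv; apply/hasP; exists p => //.
by congr (_ + _); rewrite addrA addrC.
Qed.

Lemma sum_rrt_attach (V : nmodType) (phi : otree -> V) x t :
  uniq (labels t) ->
  \sum_(p <- labels t) phi (oshape (oattach p x t))
  = \sum_(t' <- ext (btree_of (oshape t))) phi (rtree t').
Proof.
case: t => y ts ut.
rewrite -(@sum_oshape_oattach _ (fun s => phi (ONode s)) x _ ts).
- move: ut; rewrite /= => /andP[yts uts]; rewrite big_cons addrC; congr (_ + _).
    by apply: eq_big_seq => p pts /=; rewrite ifN//; apply: contraNneq yts => ->.
  rewrite eqxx map_rcons /=; congr (phi (ONode (rcons _ _))).
  rewrite -[LHS]/(map oshape _).
  have -> : map (oattach y x) ts = ts.
    elim: ts yts {uts} => //= u ts IHu.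
    by rewrite mem_cat negb_or => /andP[/oattach_notin-> /IHu->].
  by have := btree_ofK (ONode (map oshape ts)); rewrite /rtree => -[].
- by have := btree_ofK (oshape (LNode y ts)); rewrite /rtree => -[].
- by move: ut => /= /andP[].
Qed.

Definition grow_labels n (w : parents n) : olabels :=
  foldl (fun t i => oattach (w i).+1 i.+2 t) (LNode 1 [::]) (enum 'I_n.-1).

Definition forget_last n (w : parents n.+2) : parents n.+1 :=
  [ffun i : 'I_n => w (widen_ord (leqnSn n) i) : 'I_i.+1].

Lemma grow_labels_recr n (w : parents n.+2) :
  grow_labels w = oattach (w ord_max).+1 n.+2 (grow_labels (forget_last w)).
Proof.
rewrite /grow_labels /= enum_ordSr foldl_rcons; congr oattach.
elim: (enum 'I_n) (LNode 1 [::]) => //= i s IH t.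
by rewrite IH /= ffunE.
Qed.

Lemma labels_grow n (w : parents n.+1) : perm_eq (labels (grow_labels w)) (iota 1 n.+1).
Proof.
elim: n w => [|n IH] w.
  by rewrite /grow_labels (_ : enum _ = [::])//; apply: size0nil; rewrite size_enum_ord.
rewrite grow_labels_recr; apply/seq.permP => a.
have /seq.permP e := IH (forget_last w); rewrite count_labels_oattach !e.
rewrite (_ : iota 1 n.+2 = iota 1 n.+1 ++ [:: n.+2]); last by have := iotaD 1 n.+1 1; rewrite addn1.
rewrite count_cat [in RHS]/= addn0; congr (_ + _)%N.
rewrite (count_uniq_mem _ (iota_uniq 1 n.+1)) mem_iota.
by rewrite (_ : _ && _ = true) ?muln1//; have := ltn_ord (w ord_max); rewrite /=; lia.
Qed.

Lemma card_parents n : #|parents n.+1| = n`!.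
Proof.
rewrite card_dep_ffun /image_mem -/(enum _) /= (eq_map (g := fun i : 'I_n => i.+1)).
  rewrite -[LHS]/(foldr muln 1%N _) foldrE big_map fact_prod big_add1 /= big_mkord.
  by rewrite big_enum.
by move=> i; rewrite card_ord.
Qed.

Lemma sum_rrt (V : nmodType) (phi : otree -> V) n :
  \sum_(w : parents n.+2) phi (rrt w) =
  \sum_(w : parents n.+1) \sum_(t <- ext (btree_of (rrt w))) phi (rtree t).
Proof.
pose L (w : parents n.+2) := (forget_last w, w ord_max : 'I_n.+1).
have Linj : injective L.
  move=> w w' [e1 e2]; apply/ffunP => i.
  have [->//|] := eqVneq i ord_max; rewrite -val_eqE /= => ni.
  have lti : (i < n)%N by have := ltn_ord i; rewrite /=; lia.
  have ei : i = widen_ord (leqnSn n) (Ordinal lti) by exact: val_inj.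
  rewrite ei; have := congr1 (fun u : parents n.+1 => u (Ordinal lti)) e1.
  by rewrite !ffunE.
have [K LK KL] : bijective L.
  apply: inj_card_bij => //; rewrite card_prod !card_parents card_ord factS.
  by rewrite mulnC.
rewrite (reindex K); last by exists L => w _; [exact: KL|exact: LK].
rewrite (eq_bigr (fun j => (fun w p => phi (rrt (K (w, p)))) j.1 j.2)); last by case.
rewrite -(pair_bigA _ (fun w p => phi (rrt (K (w, p))))) /=.
apply: eq_bigr => w _.
have pl := labels_grow w.
have ul : uniq (labels (grow_labels w)) by rewrite (perm_uniq pl) iota_uniq.
rewrite -[rrt w]/(oshape (grow_labels w)) -(sum_rrt_attach phi n.+2 ul).
rewrite (perm_big _ pl) /= -[RHS]/(\sum_(1 <= i < n.+2) _) big_add1 big_mkord.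
apply: eq_bigr => p _; rewrite -[rrt _]/(oshape (grow_labels _)) grow_labels_recr.
by have := KL (w, p); rewrite /L => -[-> ->].
Qed.

Section rrt_mean.
Context {R : realType}.

Lemma Mean_rrt (phi : otree -> R) n :
  Mean (fun w : parents n.+1 => phi (rrt w)) = E n (phi \o rtree).
Proof.
elim: n phi => [|n IH] phi.
  rewrite E0 /Mean card_parents fact0 divr1 /= (eq_bigr (fun=> phi (ONode [::]))).
    by rewrite big_const card_parents /= addr0.
  move=> w _; rewrite /rrt (_ : enum _ = [::])//; apply: size0nil.
  by rewrite size_enum_ord.
rewrite /Mean sum_rrt card_parents factS mulnC natrM invfM mulrA -card_parents.
rewrite -/(Mean (fun w : parents n.+1 => \sum_(t <- ext (btree_of (rrt w))) phi (rtree t))).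
rewrite (IH (fun u => \sum_(t <- ext (btree_of u)) phi (rtree t))) E_grow.
by congr (_ / _); apply: eq_E => t _; rewrite /comp rtreeK.
Qed.

End rrt_mean.

(** * Taylor bounds for sine and cosine *)

Section trig_taylor.
Context {R : realType}.
Implicit Types (x a b t theta : R).

(** One rung of a ladder: in each Taylor bound below the derivative of the remainder is nonnegative
    by an earlier bound, starting from cos <= 1 and sin <= 1. *)
Lemma is_derive_ge0 (f df : R -> R) : (forall x, is_derive x 1 f (df x)) ->
  f 0 = 0 -> (forall x, 0 <= x -> 0 <= df x) -> forall x, 0 <= x -> 0 <= f x.
Proof.
move=> fdf f0 df0 x; rewrite le_eqVlt => /predU1P[<-|x0]; first by rewrite f0.
have [|c + e] := @MVT R f df 0 x x0 (fun y _ => fdf y).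
  apply: continuous_subspaceT => y.
  by apply: differentiable_continuous; apply/derivable1_diffP; have [] := fdf y.
rewrite in_itv /= => /andP[c0 _].
by rewrite f0 !subr0 in e; rewrite e mulr_ge0// ?df0// ltW.
Qed.

Lemma sin_le x : 0 <= x -> sin x <= x.
Proof.
move=> x0; rewrite -subr_ge0; move: x x0.
apply: (@is_derive_ge0 (fun x => x - sin x) (fun x => 1 - cos x)).
- by rewrite sin0 subrr.
- by move=> y _; have := cos_max y; rewrite ler_norml => /andP[_]; rewrite subr_ge0.
Qed.

Lemma subr1_cos_le x : 0 <= x -> 1 - cos x <= x.
Proof.
move=> x0; rewrite -subr_ge0; move: x x0.
apply: (@is_derive_ge0 (fun x => x - (1 - cos x)) (fun x => 1 - sin x)).
- by move=> y; apply: is_derive_eq; rewrite /=; ring.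
- by rewrite cos0 !subrr.
- by move=> y _; have := sin_max y; rewrite ler_norml => /andP[_]; rewrite subr_ge0.
Qed.

Lemma subr_sin_le2 x : 0 <= x -> x - sin x <= x ^+ 2 / 2.
Proof.
move=> x0; rewrite -subr_ge0; move: x x0.
apply: (@is_derive_ge0 (fun x => x ^+ 2 / 2 - (x - sin x)) (fun x => x - (1 - cos x))).
- by move=> y; apply: is_derive_eq; rewrite /GRing.scale /=; field.
- by rewrite sin0 expr0n mul0r !subrr.
- by move=> y y0; rewrite subr_ge0 subr1_cos_le.
Qed.

Lemma subr1_cos_le2 x : 0 <= x -> 1 - cos x <= x ^+ 2 / 2.
Proof.
move=> x0; rewrite -subr_ge0; move: x x0.
apply: (@is_derive_ge0 (fun x => x ^+ 2 / 2 - (1 - cos x)) (fun x => x - sin x)).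
- by move=> y; apply: is_derive_eq; rewrite /GRing.scale /=; field.
- by rewrite cos0 expr0n mul0r !subrr.
- by move=> y y0; rewrite subr_ge0 sin_le.
Qed.

Lemma subr_sin_le3 x : 0 <= x -> x - sin x <= x ^+ 3 / 6.
Proof.
move=> x0; rewrite -subr_ge0; move: x x0.
apply: (@is_derive_ge0 (fun x => x ^+ 3 / 6 - (x - sin x)) (fun x => x ^+ 2 / 2 - (1 - cos x))).
- by move=> y; apply: is_derive_eq; rewrite /GRing.scale /=; field.
- by rewrite sin0 expr0n mul0r !subrr.
- by move=> y y0; rewrite subr_ge0 subr1_cos_le2.
Qed.

Lemma cos_le3 x : 0 <= x -> cos x - 1 + x ^+ 2 / 2 <= x ^+ 3 / 6.
Proof.
move=> x0; rewrite -subr_ge0; move: x x0.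
apply: (@is_derive_ge0 (fun x => x ^+ 3 / 6 - (cos x - 1 + x ^+ 2 / 2))
  (fun x => x ^+ 2 / 2 - (x - sin x))).
- by move=> y; apply: is_derive_eq; rewrite /GRing.scale /=; field.
- by rewrite cos0 !expr0n !mul0r subrr addr0 subrr.
- by move=> y y0; rewrite subr_ge0 subr_sin_le2.
Qed.

Lemma norm_subr1_cos x : `|1 - cos x| <= x ^+ 2 / 2.
Proof.
rewrite ger0_norm; last by have := cos_max x; rewrite ler_norml => /andP[_]; rewrite subr_ge0.
have [x0|x0] := leP 0 x; first exact: subr1_cos_le2.
by rewrite -[X in cos X]opprK cosN -sqrrN subr1_cos_le2// oppr_ge0 ltW.
Qed.

Lemma norm_subr_sin2 x : `|x - sin x| <= x ^+ 2 / 2.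
Proof.
have h (y : R) : 0 <= y -> `|y - sin y| <= y ^+ 2 / 2.
  by move=> y0; rewrite ger0_norm ?subr_ge0 ?sin_le// subr_sin_le2.
have [/h//|x0] := leP 0 x.
have := h (- x); rewrite oppr_ge0 (ltW x0) sinN sqrrN -opprD normrN; exact.
Qed.

Lemma norm_subr_sin3 x : `|x - sin x| <= `|x| ^+ 3 / 6.
Proof.
have h (y : R) : 0 <= y -> `|y - sin y| <= `|y| ^+ 3 / 6.
  by move=> y0; rewrite !ger0_norm ?subr_ge0 ?sin_le// subr_sin_le3.
have [/h//|x0] := leP 0 x.
have := h (- x); rewrite oppr_ge0 (ltW x0) sinN -opprD !normrN; exact.
Qed.

Lemma norm_cos3 x : `|cos x - 1 + x ^+ 2 / 2| <= `|x| ^+ 3 / 6.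
Proof.
rewrite ger0_norm.
  have [x0|x0] := leP 0 x; first by rewrite ger0_norm// cos_le3.
  by rewrite ltr0_norm// -cosN -sqrrN cos_le3// oppr_ge0 ltW.
by have := norm_subr1_cos x; rewrite ler_norml => /andP[_]; lra.
Qed.

Lemma cos_taylor2 a b : `|cos (a + b) - cos a + b * sin a| <= b ^+ 2.
Proof.
rewrite (_ : _ + _ = sin a * (b - sin b) - cos a * (1 - cos b)); last first.
  by rewrite cosD; ring.
rewrite (splitr (b ^+ 2)); apply: (le_trans (ler_normB _ _)); apply: lerD.
  rewrite normrM; apply: le_trans (norm_subr_sin2 _).
  by rewrite ler_piMl// sin_max.
rewrite normrM; apply: le_trans (norm_subr1_cos _).
by rewrite ler_piMl// cos_max.
Qed.

Lemma cos_taylor3 theta x :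
  `|cos (x + theta) - cos theta + x * sin theta + x ^+ 2 / 2 * cos theta| <= `|x| ^+ 3.
Proof.
rewrite (_ : _ + _ = sin theta * (x - sin x) + cos theta * (cos x - 1 + x ^+ 2 / 2)); last first.
  by rewrite cosD; ring.
have x3 : 0 <= `|x| ^+ 3 by rewrite exprn_ge0.
apply: (@le_trans _ _ (`|x| ^+ 3 / 6 + `|x| ^+ 3 / 6)); last by lra.
apply: (le_trans (ler_normD _ _)); apply: lerD; rewrite normrM.
  by apply: le_trans (norm_subr_sin3 _); rewrite ler_piMl// sin_max.
by apply: le_trans (norm_cos3 _); rewrite ler_piMl// cos_max.
Qed.

End trig_taylor.

(** * The characteristic function of the normal law *)

Section gaussian.
Context {R : realType}.
Variables (s : R) (s0 : s != 0).
Implicit Types (f g : R -> R) (x t theta : R).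
Local Notation mu := (@lebesgue_measure R).
Local Notation p := (normal_pdf 0 s).

Definition gauss_int f : R := (\int[mu]_x (f x * normal_pdf 0 s x))%R.

(** Wide enough for the second moment, which controls both remainders and tails, and narrow enough
    for integrability against the normal density. *)
Definition quad_growth f := continuous f /\ exists C, forall x, `|f x| <= C * (1 + x ^+ 2).

Lemma quad_growth_cst a : quad_growth (fun=> a).
Proof.
split; first exact: cst_continuous.
by exists `|a| => x; rewrite ler_peMr// lerDl sqr_ge0.
Qed.

Lemma quad_growthD f g : quad_growth f -> quad_growth g ->
  quad_growth (fun x => f x + g x).
Proof.
move=> [cf [C fC]] [cg [D gD]]; split; first by move=> x; exact: cvgD (cf x) (cg x).
exists (C + D) => x; rewrite mulrDl; apply: (le_trans (ler_normD _ _)).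
exact: lerD.
Qed.

Lemma quad_growthM b f g : continuous g -> (forall x, `|g x| <= b) -> quad_growth f ->
  quad_growth (fun x => f x * g x).
Proof.
move=> cg gb [cf [C fC]]; split; first by move=> x; exact: cvgM (cf x) (cg x).
exists (C * b) => x; rewrite normrM mulrAC.
by apply: ler_pM.
Qed.

Lemma quad_growthZ a f : quad_growth f -> quad_growth (fun x => a * f x).
Proof.
move=> [cf [C fC]]; split; first by move=> x; exact: cvgM (cvg_cst _) (cf x).
by exists (`|a| * C) => x; rewrite normrM -mulrA ler_wpM2l.
Qed.

Lemma quad_growthB f g : quad_growth f -> quad_growth g ->
  quad_growth (fun x => f x - g x).
Proof.
move=> qf /(quad_growthZ (-1)) qg.
have := quad_growthD qf qg; congr quad_growth.
by apply/funext => x; rewrite mulN1r.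
Qed.

(** Doubling the standard deviation absorbs x^2: the two exponents differ by y = 3 x^2 / (8 s^2),
    and y <= exp y. Integrability of quadratic growth thus reduces to that of another normal
    density. *)
Lemma sqr_normal_pdf_le x : x ^+ 2 * normal_pdf 0 s x <=
  8 * s ^+ 2 * (normal_peak s / normal_peak (2 * s)) * normal_pdf 0 (2 * s) x.
Proof.
have s20 : 2 * s != 0 by rewrite mulf_neq0.
rewrite !normal_pdfE// /normal_fun subr0.
have ss : 0 < s ^+ 2 by rewrite exprn_even_gt0.
have := expR_ge1Dx (3 * x ^+ 2 / (8 * s ^+ 2)).
have -> : - x ^+ 2 / (s ^+ 2 *+ 2) = - (3 * x ^+ 2 / (8 * s ^+ 2)) + - x ^+ 2 / ((2 * s) ^+ 2 *+ 2).
  by field.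
rewrite expRD expRN; set e := expR (3 * _ / _); set e' := expR _ => h.
have e0 : 0 < e by exact: expR_gt0.
have e'0 : 0 < e' by exact: expR_gt0.
have p0 : 0 < normal_peak s by exact: normal_peak_gt0.
have p20 : 0 < normal_peak (2 * s) by exact: normal_peak_gt0.
rewrite [leLHS](_ : _ = (x ^+ 2 / e) * (normal_peak s * e')); last first.
  by field; rewrite gt_eqF.
rewrite [leRHS](_ : _ = 8 * s ^+ 2 * (normal_peak s * e')); last first.
  by field; rewrite gt_eqF.
apply: ler_wpM2r; first by rewrite mulr_ge0// ltW.
rewrite ler_pdivrMr//.
have d0 : 0 < 8 * s ^+ 2 by rewrite mulr_gt0.
have : 3 * x ^+ 2 <= e * (8 * s ^+ 2).
  by rewrite -ler_pdivrMr//; apply: le_trans h; rewrite lerDr.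
by have := sqr_ge0 x; lra.
Qed.

Lemma integrable_quad_growth f : quad_growth f ->
  mu.-integrable setT (EFin \o (fun x => f x * p x)).
Proof.
move=> [cf [C fC]].
have s20 : 2 * s != 0 by rewrite mulf_neq0.
set K := 8 * s ^+ 2 * (normal_peak s / normal_peak (2 * s)).
have i1 := integrable_normal_pdf 0 s; have i2 := integrable_normal_pdf 0 (2 * s).
have i3 : mu.-integrable setT (fun x => C%:E * (normal_pdf 0 s x)%:E + (C * K)%:E * (normal_pdf 0 (2 * s) x)%:E)%E.
  by apply: integrableD => //; apply: integrableZl.
apply: (le_integrable _ _ _ i3) => //.
  apply/measurable_EFinP; apply: measurable_funM; last exact: measurable_normal_pdf.
  exact: continuous_measurable_fun.
move=> x _; rewrite /= lee_fin normrM.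
rewrite [X in _ * X]ger0_norm ?normal_pdf_ge0//.
apply: le_trans (ler_norm _).
apply: (@le_trans _ _ (C * (1 + x ^+ 2) * p x)).
  by rewrite ler_wpM2r// normal_pdf_ge0.
have C0 : 0 <= C by have := fC 0; rewrite expr0n addr0 mulr1; exact: le_trans.
rewrite -mulrA -[C * K * _]mulrA -mulrDr ler_wpM2l// mulrDl mul1r lerD2l.
exact: sqr_normal_pdf_le.
Qed.

Lemma gauss_intD f g : quad_growth f -> quad_growth g ->
  gauss_int (fun x => f x + g x) = gauss_int f + gauss_int g.
Proof.
move=> qf qg; rewrite /gauss_int -RintegralD//; try exact: integrable_quad_growth.
by apply: eq_Rintegral => x _; rewrite mulrDl.
Qed.

Lemma gauss_intZ a f : quad_growth f -> gauss_int (fun x => a * f x) = a * gauss_int f.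
Proof.
move=> qf; rewrite /gauss_int -RintegralZl//; last exact: integrable_quad_growth.
by apply: eq_Rintegral => x _; rewrite mulrA.
Qed.

Lemma gauss_intB f g : quad_growth f -> quad_growth g ->
  gauss_int (fun x => f x - g x) = gauss_int f - gauss_int g.
Proof.
move=> qf qg; rewrite -[X in _ = _ + X]mulN1r -gauss_intZ// -gauss_intD//; last exact: quad_growthZ.
by congr gauss_int; apply/funext => x; rewrite mulN1r.
Qed.

Lemma le_gauss_int f g : quad_growth f -> quad_growth g ->
  (forall x, f x <= g x) -> gauss_int f <= gauss_int g.
Proof.
move=> qf qg fg; apply: le_Rintegral => //; try exact: integrable_quad_growth.
by move=> x _; rewrite ler_wpM2r// normal_pdf_ge0.
Qed.

Lemma gauss_int_cst a : gauss_int (fun=> a) = a.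
Proof.
rewrite /gauss_int RintegralZl//; last exact: integrable_normal_pdf.
by rewrite /Rintegral integral_normal_pdf /= mulr1.
Qed.

Lemma gauss_int_norm_le f g : quad_growth f -> quad_growth g ->
  (forall x, `|f x| <= g x) -> `|gauss_int f| <= gauss_int g.
Proof.
move=> qf qg fg; rewrite ler_norml -[X in X <= _]mulN1r -gauss_intZ//.
apply/andP; split; apply: le_gauss_int => //; first exact: quad_growthZ.
  by move=> x; rewrite mulN1r lerNl; apply: le_trans (fg x); rewrite -normrN ler_norm.
by move=> x; apply: le_trans (fg x); exact: ler_norm.
Qed.

Lemma quad_growth_sqr : quad_growth (fun x => x ^+ 2).
Proof.
split; first by move=> x; exact: exprn_continuous.
by exists 1 => x; rewrite mul1r ger0_norm ?sqr_ge0// lerDr.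
Qed.

Lemma quad_growth_id : quad_growth id.
Proof.
split; first by move=> x; exact: cvg_id.
exists 1 => x; rewrite mul1r /= ler_norml; have := sqr_ge0 (x - 1); have := sqr_ge0 (x + 1); nra.
Qed.

Lemma continuous_cosMD t theta : continuous (fun x => cos (t * x + theta)).
Proof.
move=> x; apply: (cvg_comp (fun x => t * x + theta) cos); last exact: continuous_cos.
by apply: cvgD (cvg_cst _); apply: cvgM (cvg_cst _) cvg_id.
Qed.

Lemma continuous_sinMD t theta : continuous (fun x => sin (t * x + theta)).
Proof.
move=> x; apply: (cvg_comp (fun x => t * x + theta) sin); last exact: continuous_sin.
by apply: cvgD (cvg_cst _); apply: cvgM (cvg_cst _) cvg_id.
Qed.

Lemma quad_growth_cos t theta : quad_growth (fun x => cos (t * x + theta)).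
Proof.
have [] := @quad_growthM 1 (fun=> 1) (fun x => cos (t * x + theta)) => //.
- exact: continuous_cosMD.
- by move=> x; exact: cos_max.
- exact: quad_growth_cst.
move=> c1 [C hC]; split; first exact: continuous_cosMD.
by exists C => x; have := hC x; rewrite mul1r.
Qed.

Lemma quad_growth_xsin t theta : quad_growth (fun x => x * sin (t * x + theta)).
Proof.
apply: (@quad_growthM 1) quad_growth_id; first exact: continuous_sinMD.
by move=> x; exact: sin_max.
Qed.

Lemma is_derive_normal_pdf x : is_derive x 1 p (- (x / s ^+ 2) * p x).
Proof.
have -> : p = (fun x => normal_peak s * expR (- x ^+ 2 / (s ^+ 2 *+ 2))).
  by rewrite normal_pdfE//; apply/funext => y; rewrite /normal_fun subr0.
have h : is_derive x 1 (fun x => - x ^+ 2 / (s ^+ 2 *+ 2)) (- (x / s ^+ 2)).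
  by apply: is_derive_eq; rewrite /GRing.scale /=; field.
have := is_derive1_comp (is_derive_expR _) h => {}h.
by apply: is_derive_eq; rewrite /GRing.scale /=; ring.
Qed.

(** Stein's identity for h(x) = sin(t x + theta). The fundamental theorem of calculus is applied on
    [-(n + 1), n + 1] only; the boundary values and the discarded part of the integral are both O(1
    / n), so the constant to be shown zero is smaller than every C / (n + 1). *)
Lemma gauss_stein t theta :
  gauss_int (fun x => x * sin (t * x + theta))
  = s ^+ 2 * t * gauss_int (fun x => cos (t * x + theta)).
Proof.
apply/eqP; rewrite -subr_eq0 -mulNr -gauss_intZ; last exact: quad_growth_cos.
rewrite -gauss_intD; [|exact: quad_growth_xsin|exact/quad_growthZ/quad_growth_cos].
set g := fun x : R => _ + _.
have qg : quad_growth g.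
  by apply: quad_growthD; [exact: quad_growth_xsin|exact/quad_growthZ/quad_growth_cos].
have [cg _] := qg.
have pc : continuous p by exact: continuous_normal_pdf.
(* Antiderivative of g p, because p' = - (x / s^2) p. *)
pose G x := - s ^+ 2 * (sin (t * x + theta) * p x).
have dG x : is_derive x 1 G (g x * p x).
  have h : is_derive x 1 (fun x => t * x + theta) t.
    by apply: is_derive_eq; rewrite /GRing.scale /=; ring.
  have := is_derive1_comp (is_derive_sin _) h => {}h.
  have hp := is_derive_normal_pdf x.
  by apply: is_derive_eq; rewrite /g /GRing.scale /=; field.
have cG : continuous G.
  move=> x; apply: differentiable_continuous; apply/derivable1_diffP.
  by have [] := dG x.
have ftc (n : nat) : (\int[mu]_(x in `[- n.+1%:R, n.+1%:R]) (g x * p x))%R =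
    G n.+1%:R - G (- n.+1%:R).
  rewrite /Rintegral (@continuous_FTC2 _ _ G)//.
  - by rewrite -subr_gt0 opprK addr_gt0 ?ltr0n.
  - by apply: continuous_subspaceT => x; exact: cvgM (cg x) (pc x).
  - split => [x _| |]; first by have [] := dG x.
      by apply: cvg_at_right_filter; exact: cG.
    by apply: cvg_at_left_filter; exact: cG.
  - by move=> x _; rewrite derive1E; have [] := dG x.
(* x^2 p(x) is bounded by [sqr_normal_pdf_le], which makes the boundary values O(1 / n). *)
have Gb (n : nat) (x : R) : `|x| = n.+1%:R ->
    `|G x| <= s ^+ 2 * (8 * s ^+ 2 * normal_peak s) / n.+1%:R.
  move=> xn; rewrite /G normrM normrN (ger0_norm (sqr_ge0 s)) -mulrA ler_wpM2l ?sqr_ge0//.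
  rewrite normrM (ger0_norm (normal_pdf_ge0 _ _ _)).
  apply: (@le_trans _ _ (p x)); first by rewrite ler_piMl ?normal_pdf_ge0 ?sin_max.
  have s20 : 2 * s != 0 by rewrite mulf_neq0.
  have p20 : 0 < normal_peak (2 * s) by exact: normal_peak_gt0.
  have n1 : 1 <= n.+1%:R :> R by rewrite ler1n.
  rewrite ler_pdivlMr ?ltr0n//.
  apply: (@le_trans _ _ (x ^+ 2 * p x)).
    rewrite mulrC ler_wpM2r ?normal_pdf_ge0// -[x ^+ 2]ger0_norm ?sqr_ge0//.
    by rewrite normrX xn expr2 ler_peMl.
  apply: (le_trans (sqr_normal_pdf_le x)).
  rewrite -mulrA ler_wpM2l//.
    by rewrite mulr_ge0 ?sqr_ge0.
  rewrite mulrAC ler_pdivrMr// ler_wpM2l ?normal_peak_ge0//.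
  by apply: normal_pdf_ub.
pose c := s ^+ 2 * `|t|.
have c0 : 0 <= c by rewrite mulr_ge0 ?sqr_ge0.
(* A quadratic majorant of |x g(x)|. Outside the interval it gives |g| <= q / (n + 1), as in
   Markov's inequality. *)
pose q (x : R) := (1 + c) * x ^+ 2 + c.
have qq : quad_growth q.
  apply: quad_growthD; last exact: quad_growth_cst.
  exact/quad_growthZ/quad_growth_sqr.
have xg x : `|x| * `|g x| <= q x.
  have gx : `|g x| <= `|x| + c.
    rewrite /g; apply: (le_trans (ler_normD _ _)); apply: lerD.
      by rewrite normrM ler_piMr// sin_max.
    rewrite normrM normrN normrM ger0_norm ?sqr_ge0// -/c ler_piMr// cos_max.
    by [].
  apply: (le_trans (ler_wpM2l (normr_ge0 x) gx)).
  rewrite /q mulrDr -normrM ger0_norm -?expr2 ?sqr_ge0//.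
  have : `|x| <= x ^+ 2 + 1.
    by rewrite ler_norml; have := sqr_ge0 (x - 1); have := sqr_ge0 (x + 1); nra.
  nra.
have gD (n : nat) : mu.-integrable [set: R]
    (EFin \o ((fun x => g x * p x) \_ `[- n.+1%:R, n.+1%:R])).
  rewrite -restrict_EFin.
  have [+ _] := integrable_mkcond (mu := mu) (EFin \o (fun x => g x * p x))
    (measurable_itv `[- n.+1%:R, n.+1%:R]).
  by apply; apply: (integrableS _ _ (@subsetT _ _)) => //; exact: integrable_quad_growth.
have rest (n : nat) : `|gauss_int g - (\int[mu]_(x in `[- n.+1%:R, n.+1%:R]) (g x * p x))%R|
    <= gauss_int q / n.+1%:R.
  rewrite Rintegral_mkcond /gauss_int -RintegralB//; last first.
    exact: integrable_quad_growth.
  rewrite -RintegralZr//; last exact: integrable_quad_growth.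
  have ig : mu.-integrable [set: R] (EFin \o (fun x => g x * p x -
      ((fun x => g x * p x) \_ `[- n.+1%:R, n.+1%:R]) x)).
    pose gp x := g x * p x; pose gpD := gp \_ `[- n.+1%:R, n.+1%:R].
    rewrite (_ : _ \o _ = (EFin \o gp) \- (EFin \o gpD))%E//.
    apply: integrableB; [by []|exact: (integrable_quad_growth qg)|exact: gD].
  apply: (le_trans (le_normr_Rintegral _ _)) => //.
  apply: le_Rintegral => //.
  - by move/integrable_norm: ig.
  - have := integrable_quad_growth (quad_growthZ n.+1%:R^-1 qq).
    congr (integrable _ _ _); apply/funext => x /=; congr EFin.
    by rewrite -mulrA mulrC.
  - move=> x _; rewrite patchE; case: ifPn => xn.
      by rewrite subrr normr0 !mulr_ge0 ?normal_pdf_ge0// addr_ge0// mulr_ge0 ?sqr_ge0// addr_ge0.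
    rewrite subr0 normrM (ger0_norm (normal_pdf_ge0 _ _ _)) mulrAC ler_wpM2r ?normal_pdf_ge0//.
    rewrite ler_pdivlMr ?ltr0n//; apply: le_trans (xg x); rewrite mulrC ler_wpM2r//.
    move: xn; rewrite notin_setE /= in_itv /= => /negP; rewrite -ler_norml -ltNge.
    exact: ltW.
pose C := 2 * (s ^+ 2 * (8 * s ^+ 2 * normal_peak s)) + gauss_int q.
have fin (n : nat) : `|gauss_int g| <= C / n.+1%:R.
  rewrite -[X in `|X|](subrK (\int[mu]_(x in `[- n.+1%:R, n.+1%:R]) (g x * p x))%R).
  apply: (le_trans (ler_normD _ _)); rewrite /C mulrDl addrC; apply: lerD => //.
  rewrite ftc; apply: (le_trans (ler_normB _ _)).
  have g1 := Gb n n.+1%:R (normr_nat _ _).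
  have g2 := Gb n (- n.+1%:R); rewrite normrN normr_nat in g2.
  by rewrite -mulrA mulr_natl mulr2n; apply: lerD => //; exact: g2.
rewrite -normr_le0 leNgt; apply/negP => gpos.
have := archi_boundP (_ : 0 <= C / `|gauss_int g|).
set n := Num.bound _ => hn.
have C0 : 0 <= C by have := le_trans (normr_ge0 _) (fin 0); rewrite divr1.
have := fin n; rewrite ler_pdivlMr ?ltr0n// leNgt => /negP; apply.
rewrite mulrC -ltr_pdivrMr//; apply: lt_trans (hn _) _; first by rewrite divr_ge0// ltW.
by rewrite ltr_nat.
Qed.

(** Replaces differentiation under the integral sign: a second-order bound on the integrand,
    integrated, yields the derivative of the integral. *)
Lemma is_derive_quadratic (f : R -> R) (x df M : R) :
  (forall h, `|f (x + h) - f x - h * df| <= M * h ^+ 2) -> is_derive x 1 f df.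
Proof.
move=> fM.
have cv : h^-1 *: (f (h *: 1 + x) - f x) @[h --> 0^'] --> df.
  apply/cvgrPdist_le => e e0; near=> h.
  have h0 : h != 0 by near: h; exact: nbhs_dnbhs_neq.
  have hN : 0 < `|h| by rewrite normr_gt0.
  have -> : df - h^-1 *: (f (h *: 1 + x) - f x) = - h^-1 * (f (x + h) - f x - h * df).
    by rewrite /GRing.scale /= mulr1 (addrC h); field.
  rewrite normrM normrN normfV mulrC ler_pdivrMr//.
  apply: (le_trans (fM h)); rewrite -[h ^+ 2]ger0_norm ?sqr_ge0// normrX expr2 mulrA.
  rewrite ler_wpM2r//; apply: (@le_trans _ _ ((`|M| + 1) * `|h|)).
    by rewrite ler_wpM2r// ler_wpDr// ler_norm.
  rewrite -ler_pdivlMl ?ltr_wpDl// mulrC.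
  by near: h; apply: dnbhs0_le; rewrite divr_gt0// ltr_wpDl.
split; first exact: (cvgP _ cv).
exact/cvg_lim.
Unshelve. all: by end_near. Qed.

(** By Stein's identity the transform psi solves psi' = - s^2 t psi, so psi(t) exp(s^2 t^2 / 2) is
    constant and equals cos theta, its value at 0. *)
Lemma gauss_int_cos t theta :
  gauss_int (fun x => cos (t * x + theta)) = expR (- (s ^+ 2 * t ^+ 2 / 2)) * cos theta.
Proof.
pose psi t := gauss_int (fun x => cos (t * x + theta)).
have dpsi (u : R) : is_derive u 1 psi (- (s ^+ 2 * u * psi u)).
  apply: (@is_derive_quadratic _ _ _ (gauss_int (fun x => x ^+ 2))) => h.
  rewrite /psi -gauss_stein mulrN opprK -gauss_intZ; last exact: quad_growth_xsin.
  rewrite -gauss_intB; [|exact: quad_growth_cos..].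
  rewrite -gauss_intD; last 2 first.
  - by apply: quad_growthB; exact: quad_growth_cos.
  - exact/quad_growthZ/quad_growth_xsin.
  rewrite mulrC -gauss_intZ; last exact: quad_growth_sqr.
  apply: gauss_int_norm_le.
  - apply: quad_growthD; last exact/quad_growthZ/quad_growth_xsin.
    by apply: quad_growthB; exact: quad_growth_cos.
  - exact/quad_growthZ/quad_growth_sqr.
  - move=> x; have := cos_taylor2 (u * x + theta) (h * x).
    rewrite exprMn; apply: le_trans; rewrite le_eqVlt; apply/orP; left; apply/eqP; congr `|_|.
    rewrite (_ : (u + h) * x + theta = u * x + theta + h * x); ring.
pose k t := psi t * expR (s ^+ 2 * t ^+ 2 / 2).
have dk (u : R) : is_derive u 1 k 0.
  have h : is_derive u 1 (fun t => s ^+ 2 * t ^+ 2 / 2) (s ^+ 2 * u).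
    by apply: is_derive_eq; rewrite /GRing.scale /=; field.
  have := is_derive1_comp (is_derive_expR _) h => {}h.
  have hp := dpsi u.
  by apply: is_derive_eq; rewrite /GRing.scale /=; ring.
have : k t = k 0 by apply: is_derive_0_is_cst.
rewrite /k expr0n mulr0 mul0r expR0 mulr1 => e.
rewrite expRN -/(psi t) -[psi t](mulfK (lt0r_neq0 (expR_gt0 (s ^+ 2 * t ^+ 2 / 2)))) e mulrC.
congr (_ * _); rewrite /psi -[RHS]gauss_int_cst; congr gauss_int.
by apply/funext => x; rewrite mul0r add0r.
Qed.

Lemma Rintegral_normal_prob (h : R -> R) : continuous h -> (exists M, forall x, `|h x| <= M) ->
  Rintegral (normal_prob 0 s : probability (measurableTypeR R) R) setT h = gauss_int h.
Proof.
move=> ch [M hM]; rewrite /gauss_int /Rintegral; congr fine.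
have mh : measurable_fun [set: measurableTypeR R] h by exact: continuous_measurable_fun.
have dom := normal_prob_dominates 0 s.
have ih : (normal_prob 0 s : probability (measurableTypeR R) R).-integrable setT (EFin \o h).
  apply: measurable_bounded_integrable => //.
    by rewrite -ge0_fin_numE// fin_num_measure.
  by exists M; split; [exact: num_real|move=> x Mx y _; apply: le_trans (hM y) (ltW Mx)].
rewrite -(Radon_Nikodym_change_of_variables dom)//.
apply: ae_eq_integral => //.
- apply: emeasurable_funM; first exact/measurable_EFinP.
  by apply: (measurable_int mu); apply: Radon_Nikodym_integrable.
- apply/measurable_EFinP; apply: measurable_funM => //; exact: measurable_normal_pdf.
- under [X in ae_eq _ _ _ X]eq_fun do rewrite EFinM.
  apply: ae_eqe_mul2l.
  (* The Radon-Nikodym derivative and the explicit density have the same integral over every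
     measurable set, hence agree almost everywhere. *)
  rewrite Radon_NikodymE//; case: cid => /= f [f1 f2 f3].
  apply: integral_ae_eq => //=.
  + by apply/measurable_EFinP; exact: measurable_normal_pdf.
  + by move=> E E01 mE; rewrite -f3.
Qed.

End gaussian.

(** * Convergence in distribution from characteristic functions *)

Section bernstein.
Context {R : realType}.
Implicit Types (u c : R) (n : nat) (phi psi : nat -> R).

(* The Bernstein polynomial of [phi], as the expectation of [phi] under the
   binomial law with parameters [n] and [u]. *)
Fixpoint bernstein n phi u : R :=
  if n is n'.+1 then u * bernstein n' (phi \o succn) u + (1 - u) * bernstein n' phi u
  else phi 0%N.

Lemma le_bernstein n phi psi u : 0 <= u <= 1 ->
  (forall k, (k <= n)%N -> phi k <= psi k) -> bernstein n phi u <= bernstein n psi u.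
Proof.
move=> /andP[u0 u1]; elim: n phi psi => [|n IH] phi psi le /=; first exact: le.
apply: lerD; apply: ler_wpM2l; rewrite ?subr_ge0//; apply: IH => k kn; apply: le => //.
exact: leqW.
Qed.

Lemma bernsteinD n phi psi u :
  bernstein n (fun k => phi k + psi k) u = bernstein n phi u + bernstein n psi u.
Proof.
elim: n phi psi => //= n IH phi psi.
by rewrite (IH phi) (IH (phi \o succn) (psi \o succn)); ring.
Qed.

Lemma bernsteinZ n c phi u :
  bernstein n (fun k => c * phi k) u = c * bernstein n phi u.
Proof.
elim: n phi => //= n IH phi.
by rewrite (IH phi) (IH (phi \o succn)); ring.
Qed.

Lemma bernstein_cst n c u : bernstein n (fun=> c) u = c.
Proof. by elim: n => //= n IH; rewrite /comp IH; ring. Qed.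

Lemma bernstein_norm n phi psi u : 0 <= u <= 1 ->
  (forall k, (k <= n)%N -> `|phi k| <= psi k) -> `|bernstein n phi u| <= bernstein n psi u.
Proof.
move=> u01 le; rewrite ler_norml -mulN1r -bernsteinZ; apply/andP; split.
  by apply: le_bernstein => // k /le; rewrite mulN1r ler_norml => /andP[].
by apply: le_bernstein => // k /le; rewrite ler_norml => /andP[].
Qed.

(** The shift c is there for the induction: conditioning on the first trial replaces c by c + 1 - u
    or c - u. *)
Lemma bernstein_variance n c u :
  bernstein n (fun k => (c + k%:R - n%:R * u) ^+ 2) u = c ^+ 2 + n%:R * (u * (1 - u)).
Proof.
elim: n c => [|n IH] c /=; first by rewrite !mul0r subr0 !addr0.
transitivity (u * bernstein n (fun k => ((c + 1 - u) + k%:R - n%:R * u) ^+ 2) u +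
  (1 - u) * bernstein n (fun k => ((c - u) + k%:R - n%:R * u) ^+ 2) u).
  by congr (_ * _ + _ * _); congr bernstein; apply/funext => k /=; congr (_ ^+ 2);
     rewrite -!natr1; ring.
by rewrite !IH -natr1; ring.
Qed.

End bernstein.

Section trig_poly.
Context {R : realType}.
Implicit Types (f g : R -> R) (s : seq (R * R * R)).

(** The phases include sines among the terms and make the class closed under products, through the
    product-to-sum formula. *)
Definition trig_eval s (x : R) : R := \sum_(p <- s) p.1.1 * cos (p.1.2 * x + p.2).
Definition trig_poly f := exists s, f = trig_eval s.

Lemma trig_polyD f g : trig_poly f -> trig_poly g -> trig_poly (fun x => f x + g x).
Proof.
by move=> [s ->] [s' ->]; exists (s ++ s'); apply/funext => x; rewrite /trig_eval big_cat.
Qed.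

Lemma trig_poly_cst c : trig_poly (fun=> c).
Proof.
exists [:: (c, 0, 0)]; apply/funext => x.
by rewrite /trig_eval big_seq1 /= mul0r addr0 cos0 mulr1.
Qed.

Lemma trig_poly_sum (I : Type) (r : seq I) (F : I -> R -> R) :
  (forall i, trig_poly (F i)) -> trig_poly (fun x => \sum_(i <- r) F i x).
Proof.
move=> tF; elim: r => [|i r IH].
  rewrite (_ : (fun _ => _) = fun=> 0); first exact: trig_poly_cst.
  by apply/funext => x; rewrite big_nil.
rewrite (_ : (fun _ => _) = fun x => F i x + \sum_(j <- r) F j x); first exact: trig_polyD.
by apply/funext => x; rewrite big_cons.
Qed.

Lemma trig_polyM f g : trig_poly f -> trig_poly g -> trig_poly (fun x => f x * g x).
Proof.
move=> [s ->] [s' ->].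
rewrite (_ : (fun _ => _) = fun x => \sum_(p <- s) \sum_(q <- s')
    (p.1.1 * cos (p.1.2 * x + p.2)) * (q.1.1 * cos (q.1.2 * x + q.2))).
  apply: trig_poly_sum => -[[a t] th]; apply: trig_poly_sum => -[[b t'] th'] /=.
  exists [:: (a * b / 2, t + t', th + th'); (a * b / 2, t - t', th - th')].
  apply/funext => x; rewrite /trig_eval big_cons big_seq1 /=.
  rewrite (_ : (t + t') * x + _ = (t * x + th) + (t' * x + th')); last by ring.
  rewrite (_ : (t - t') * x + _ = (t * x + th) + - (t' * x + th')); last by ring.
  set A := t * x + th; set B := t' * x + th'.
  by rewrite (cosD A B) (cosD A (- B)) cosN sinN; field.
apply/funext => x; rewrite /trig_eval mulr_suml; apply: eq_bigr => p _.
by rewrite mulr_sumr.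
Qed.

Lemma trig_poly_sin t : trig_poly (fun x => sin (t * x)).
Proof.
exists [:: (-1, t, pi / 2)]; apply/funext => x.
by rewrite /trig_eval big_seq1 /= cosDpihalf mulN1r opprK.
Qed.

Lemma trig_poly_bernstein n (phi : nat -> R) f : trig_poly f ->
  trig_poly (fun x => bernstein n phi (f x)).
Proof.
move=> tf; elim: n phi => [|n IH] phi /=; first exact: trig_poly_cst.
have tg : trig_poly (fun x => 1 - f x).
  rewrite (_ : (fun _ => _) = fun x => 1 + (fun=> -1) x * f x).
    apply: trig_polyD; first exact: trig_poly_cst.
    by apply: trig_polyM => //; exact: trig_poly_cst.
  by apply/funext => x; rewrite mulN1r.
by apply: trig_polyD; apply: trig_polyM.
Qed.

Lemma continuous_trig_poly f : trig_poly f -> continuous f.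
Proof.
move=> [s ->]; rewrite /trig_eval; elim: s => [|p s IH].
  rewrite (_ : (fun _ => _) = fun=> 0); first exact: cst_continuous.
  by apply/funext => x; rewrite big_nil.
rewrite (_ : (fun _ => _) = fun x => p.1.1 * cos (p.1.2 * x + p.2) +
  \sum_(q <- s) q.1.1 * cos (q.1.2 * x + q.2)).
  move=> x; apply: cvgD; last exact: IH.
  by apply: cvgM; [exact: cvg_cst|exact: continuous_cosMD].
by apply/funext => x; rewrite big_cons.
Qed.

Lemma bounded_trig_poly f : trig_poly f -> exists M, forall x, `|f x| <= M.
Proof.
move=> [s ->]; exists (\sum_(p <- s) `|p.1.1|) => x.
apply: (le_trans (ler_norm_sum _ _ _)); apply: ler_sum => p _.
by rewrite normrM ler_piMr// cos_max.
Qed.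

End trig_poly.

(** * Weierstrass approximation by bounded trigonometric polynomials *)

Section approximation.
Context {R : realType}.
Implicit Types (h : R -> R) (a b x L : R).

(** With m and d the half-sum and half-difference, sin a - sin b = 2 cos m sin d. Here cos m >= sin
    d because |m| + d <= pi / 2, and sin d >= d / 3, so (a - b)^2 = 4 d^2 <= 36 (sin d)^2 <= 18 (sin
    a - sin b). *)
Lemma sqr_le_sin_dist a b : - (pi / 2) <= a <= pi / 2 -> - (pi / 2) <= b <= pi / 2 ->
  (a - b) ^+ 2 <= 18 * `|sin a - sin b|.
Proof.
wlog ba : a b / b <= a.
  move=> h ha hb; have [/h|/ltW/h] := leP b a; first exact.
  by rewrite -sqrrN opprB distrC; exact.
move=> /andP[a1 a2] /andP[b1 b2].
have p2 : pi / 2 < 2 :> R by have /andP[] := @pihalf_02 R.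
pose d := (a - b) / 2; pose m := (a + b) / 2.
have d0 : 0 <= d by rewrite divr_ge0// subr_ge0.
have d2 : d <= pi / 2 by rewrite /d; lra.
have -> : a = m + d by rewrite /m /d; field.
have -> : b = m - d by rewrite /m /d; field.
rewrite sinD sinB.
rewrite [X in `|X|](_ : _ = 2 * (cos m * sin d)); last by ring.
rewrite (_ : m + d - (m - d) = 2 * d); last by ring.
have sd : d / 3 <= sin d.
  have := subr_sin_le3 d0; have : d ^+ 2 <= 4 by nra.
  by rewrite (exprS d 2); nra.
have cm : sin d <= cos m.
  have nm : `|m| <= pi / 2 - d by rewrite ler_norml /m /d; apply/andP; split; lra.
  have -> : sin d = cos (pi / 2 - d) by rewrite -cosBpihalf -cosN opprB.
  have -> : cos m = cos `|m|.
    by have [m0|m0] := leP 0 m; [rewrite ger0_norm|rewrite ltr0_norm// cosN].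
  have m0 := normr_ge0 m.
  by rewrite leNgt ltr_cos ?in_itv /= -?leNgt//; apply/andP; split; lra.
rewrite ger0_norm; first by nra.
by rewrite mulr_ge0// mulr_ge0//; lra.
Qed.

Lemma uniformly_continuous_segment h a b : continuous h -> forall e : R, 0 < e ->
  exists2 d : R, 0 < d & forall x y, a <= x <= b -> `|x - y| < d -> `|h x - h y| <= e.
Proof.
move=> ch e e0.
have /compact_near_coveringP cov := @segment_compact R a b.
have := cov _ (0^'+ : set_system R) (fun d x => forall y, `|x - y| < d -> `|h x - h y| <= e) _ _.
case.
- move=> x _; have /cvgrPdist_lt := ch x => /(_ (e / 2)).
  rewrite divr_gt0// => /(_ isT) [r /= r0 hr].
  exists (ball x (r / 2), [set d | d < r / 2]).
    split; first by apply: nbhsx_ballx; rewrite divr_gt0.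
    by apply: nbhs_right_lt; rewrite divr_gt0.
  move=> [x' d] /= [xx' dr] y x'y.
  have h1 : `|h x - h x'| < e / 2.
    by apply: hr; apply: lt_le_trans xx' _; lra.
  have h2 : `|h x - h y| < e / 2.
    apply: hr => /=; rewrite -[x](subrK x') -addrA; apply: le_lt_trans (ler_normD _ _) _.
    have xx2 : `|x - x'| < r / 2 := xx'.
    by lra.
  rewrite -[h x'](subrK (h x)) -addrA; apply: le_trans (ler_normD _ _) _.
  by rewrite distrC; lra.
- move=> N /= N0 HN; exists (N / 2); first by rewrite divr_gt0.
  move=> x y xab; apply: (HN (N / 2)) => /=.
  + by rewrite sub0r normrN gtr0_norm ?divr_gt0// ltr_pdivrMr// mulr2n; lra.
  + by rewrite divr_gt0.
  + by rewrite in_itv.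
Qed.

(** Bernstein's proof of the Weierstrass theorem in the variable u = (1 + sin(x / L)) / 2. As u lies
    in [0, 1] for every real x, the approximant is an average of values of h and stays bounded by M
    outside [-L, L] as well. *)
Lemma trig_approximation h (M L : R) : continuous h -> (forall x, `|h x| <= M) -> 0 < L ->
  forall e : R, 0 < e -> exists T, [/\ trig_poly T, forall x, `|T x| <= M &
    forall x, `|x| <= L -> `|h x - T x| <= e].
Proof.
move=> ch hM L0 e e0.
have M0 : 0 <= M by apply: le_trans (hM 0).
have e20 : 0 < e / 2 by rewrite divr_gt0.
have [d d0 hd] := @uniformly_continuous_segment h (- L) L ch (e / 2) e20.
(* On [-L, L] one recovers x as [L * asin (sin (x / L))], because 1 <= pi / 2. *)
pose y n k : R := 2 * k%:R / n%:R - 1.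
pose g n k := h (L * asin (y n k)).
pose u x := (1 + sin (L^-1 * x)) / 2.
have u01 x : 0 <= u x <= 1.
  have := sin_max (L^-1 * x); rewrite ler_norml /u => /andP[? ?].
  by apply/andP; split; lra.
(* If |k - n u| < c n, the two sines differ by less than 2 c, so by [sqr_le_sin_dist] the squared
   distance of their arguments is below 18 * 2 c = (d / L)^2. *)
have [c c0 cd] : exists2 c : R, 0 < c & 36 * c = (d / L) ^+ 2.
  exists ((d / L) ^+ 2 / 36); last by rewrite mulrC divfK.
  by rewrite divr_gt0// exprn_gt0// divr_gt0.
(* Chosen so that Chebyshev's bound 2 M / (c^2 n) on the contribution of the far k is at most e /
   2. *)
pose n := (Num.bound (2 * M / (c ^+ 2) / (e / 2))).+1.
have n0 : 0 < n%:R :> R by rewrite ltr0n.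
have cn : 2 * M / (c ^+ 2) <= e / 2 * n%:R.
  rewrite -ler_pdivrMl// mulrC; apply/ltW/(lt_trans (archi_boundP _)); last by rewrite ltr_nat.
  apply: divr_ge0 (ltW e20); apply: divr_ge0; first by rewrite mulr_ge0.
  by rewrite exprn_ge0// ltW.
exists (fun x => bernstein n (g n) (u x)); split.
- apply: trig_poly_bernstein.
  rewrite (_ : u = fun x => (fun=> 2^-1) x * (1 + sin (L^-1 * x))).
    apply: trig_polyM; first exact: trig_poly_cst.
    by apply: trig_polyD; [exact: trig_poly_cst|exact: trig_poly_sin].
  by apply/funext => x; rewrite mulrC.
- move=> x; rewrite -(bernstein_cst n M (u x)); apply: bernstein_norm => // k _.
  exact: hM.
move=> x xL.
have -> : h x - bernstein n (g n) (u x) = bernstein n (fun k => h x + -1 * g n k) (u x).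
  by rewrite bernsteinD bernsteinZ bernstein_cst mulN1r.
(* For k near n u uniform continuity gives e / 2; for the other k the quadratic term is at least 2
   M. *)
apply: (@le_trans _ _ (bernstein n (fun k => e / 2 +
    2 * M / (c * n%:R) ^+ 2 * (0 + k%:R - n%:R * u x) ^+ 2) (u x))).
  apply: bernstein_norm => // k kn; rewrite mulN1r.
  have hsq : 0 <= 2 * M / (c * n%:R) ^+ 2 by apply: divr_ge0; [rewrite mulr_ge0|exact: sqr_ge0].
  have [far|close] := leP (c * n%:R) `|k%:R - n%:R * u x|.
    apply: (@le_trans _ _ (2 * M)).
      apply: (le_trans (ler_normB _ _)); rewrite mulr_natl mulr2n.
      by apply: lerD; exact: hM.
    apply: ler_wpDl; first exact: ltW.
    rewrite add0r mulrAC ler_pdivlMr ?exprn_gt0 ?mulr_gt0//.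
    apply: ler_wpM2l; first by rewrite mulr_ge0.
    rewrite -[leRHS]ger0_norm ?sqr_ge0// normrX lerXn2r// ?nnegrE ?mulr_ge0 ?ltW//.
  apply: ler_wpDr; first by rewrite mulr_ge0// sqr_ge0.
  apply: hd; first by rewrite -ler_norml.
  have kn1 : 0 <= (k%:R / n%:R : R) <= 1.
    by rewrite divr_ge0//= ler_pdivrMr// mul1r ler_nat.
  have yk : -1 <= y n k <= 1.
    move: kn1 => /andP[? ?]; rewrite /y -mulrA; apply/andP; split; lra.
  have pih := @pihalf_ge1 R.
  have xL1 : - (pi / 2) <= L^-1 * x <= pi / 2.
    have : `|L^-1 * x| <= 1 by rewrite normrM gtr0_norm ?invr_gt0// mulrC ler_pdivrMr// mul1r.
    by rewrite ler_norml => /andP[? ?]; apply/andP; split; lra.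
  have := @sqr_le_sin_dist (L^-1 * x) (asin (y n k)) xL1.
  rewrite asin_geNpi2// asin_lepi2// => /(_ isT); rewrite asinK; last by rewrite in_itv.
  have -> : sin (L^-1 * x) - y n k = - (2 * (k%:R - n%:R * u x) / n%:R).
    by rewrite /y /u; field; rewrite gt_eqF.
  rewrite normrN !normrM normfV (gtr0_norm n0) ger0_norm// => h1.
  have h2 : (L^-1 * x - asin (y n k)) ^+ 2 < (d / L) ^+ 2.
    apply: le_lt_trans h1 _.
    have : 2 * `|k%:R - n%:R * u x| / n%:R < 2 * c.
      by rewrite ltr_pdivrMr// -mulrA ltr_pM2l.
    by lra.
  rewrite (_ : x - L * asin (y n k) = L * (L^-1 * x - asin (y n k))); last first.
    by field; rewrite gt_eqF.
  rewrite normrM gtr0_norm// mulrC -ltr_pdivlMr//.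
  have dL : 0 <= d / L by rewrite divr_ge0// ltW.
  rewrite ltNge; apply/negP => ge; move: h2; rewrite ltNge => /negP; apply.
  by rewrite -[leRHS]ger0_norm ?sqr_ge0// normrX lerXn2r.
rewrite bernsteinD bernstein_cst bernsteinZ bernstein_variance expr0n add0r.
rewrite [leRHS](splitr e) lerD2l exprMn.
have uu : u x * (1 - u x) <= 1 by have /andP[? ?] := u01 x; nra.
apply: (@le_trans _ _ (2 * M / (c ^+ 2 * n%:R ^+ 2) * n%:R)).
  apply: ler_wpM2l; last by rewrite ger_pMr.
  by apply: divr_ge0; [rewrite mulr_ge0|apply: mulr_ge0; exact: sqr_ge0].
rewrite (_ : _ * _ = 2 * M / c ^+ 2 / n%:R); last first.
  by field; rewrite !gt_eqF.
by rewrite ler_pdivrMr.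
Qed.

End approximation.

(** * The continuity theorem *)

Section levy.
Context {R : realType}.

Lemma eq_Mean (Om : finType) (X Y : Om -> R) : X =1 Y -> Mean X = Mean Y.
Proof. by move=> e; congr (_ / _); apply: eq_bigr. Qed.

Lemma MeanD (Om : finType) (X Y : Om -> R) :
  Mean (fun w => X w + Y w) = Mean X + Mean Y.
Proof. by rewrite /Mean big_split mulrDl. Qed.

Lemma MeanZ (Om : finType) a (X : Om -> R) : Mean (fun w => a * X w) = a * Mean X.
Proof. by rewrite /Mean -mulr_sumr mulrA. Qed.

Lemma MeanB (Om : finType) (X Y : Om -> R) :
  Mean (fun w => X w - Y w) = Mean X - Mean Y.
Proof. by rewrite /Mean sumrB mulrBl. Qed.

Lemma Mean_cst (Om : finType) (a : R) : (0 < #|Om|)%N -> Mean (fun _ : Om => a) = a.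
Proof.
move=> Om0; rewrite /Mean big_const iter_addr addr0 -[a *+ _]mulr_natr mulfK//.
by rewrite pnatr_eq0 -lt0n.
Qed.

Lemma le_Mean (Om : finType) (X Y : Om -> R) : (forall w, X w <= Y w) -> Mean X <= Mean Y.
Proof. by move=> le; rewrite /Mean ler_wpM2r ?invr_ge0// ler_sum. Qed.

Lemma normr_Mean (Om : finType) (X : Om -> R) : `|Mean X| <= Mean (fun w => `|X w|).
Proof. by rewrite /Mean normrM normfV normr_nat ler_wpM2r ?invr_ge0// ler_norm_sum. Qed.

(** All that the continuity theorem needs of the limit law, stated so that the point mass at v = 0
    is covered too. W is the second moment. *)
Lemma Rintegral_centered_normal (v : R) : 0 <= v ->
  (forall s, Rintegral (centered_normal v) setT (trig_eval s)
     = \sum_(p <- s) p.1.1 * (expR (- (v * p.1.2 ^+ 2 / 2)) * cos p.2)) /\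
  exists2 W : R, 0 <= W & forall (h T : R -> R) (a b : R),
    continuous h -> (exists M : R, forall x, `|h x| <= M) -> trig_poly T -> 0 <= b ->
    (forall x, `|h x - T x| <= a + b * x ^+ 2) ->
    `|Rintegral (centered_normal v) setT h - Rintegral (centered_normal v) setT T| <= a + b * W.
Proof.
move=> v0; rewrite /centered_normal; case: ifPn => [/eqP->|vn0].
  have dirE (h : R -> R) : continuous h ->
      Rintegral (\d_(0 : measurableTypeR R) : probability _ _) setT h = h 0.
    move=> ch; rewrite /Rintegral integral_dirac//.
      by rewrite diracT mul1e.
    by apply/measurable_EFinP; exact: continuous_measurable_fun.
  split.
    move=> s; rewrite dirE; last by apply: continuous_trig_poly; exists s.
    rewrite /trig_eval; apply: eq_bigr => p _.
    by rewrite mulr0 add0r !mul0r oppr0 expR0 mul1r.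
  exists 0 => // h T a b ch _ tT _ le; rewrite !dirE//; last exact: continuous_trig_poly.
  by have := le 0; rewrite expr0n.
have s0 : Num.sqrt v != 0 by rewrite sqrtr_eq0 -ltNge lt_neqAle eq_sym vn0.
have quad (h : R -> R) : continuous h -> (exists M : R, forall x, `|h x| <= M) -> quad_growth h.
  move=> ch [M hM]; split=> //; exists M => x; apply: le_trans (hM x) _.
  by rewrite ler_peMr ?lerDl ?sqr_ge0//; apply: le_trans (hM 0).
have triq (T : R -> R) : trig_poly T -> quad_growth T.
  by move=> tT; apply: quad; [exact: continuous_trig_poly|exact: bounded_trig_poly].
split.
  move=> s; have ts : trig_poly (trig_eval s) by exists s.
  rewrite Rintegral_normal_prob//; last 2 first.
  - exact: continuous_trig_poly.
  - exact: bounded_trig_poly.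
  rewrite /trig_eval; elim: s {ts} => [|p s IH].
    rewrite big_nil -[RHS](gauss_int_cst (Num.sqrt v) 0); congr gauss_int.
    by apply/funext => x; rewrite big_nil.
  rewrite big_cons -IH.
  have := @gauss_int_cos _ _ s0 p.1.2 p.2; rewrite sqr_sqrtr// => <-.
  rewrite -gauss_intZ; [|exact: s0|exact: quad_growth_cos].
  rewrite -gauss_intD//.
  - by congr gauss_int; apply/funext => x; rewrite big_cons.
  - by apply: quad_growthZ; exact: quad_growth_cos.
  - by apply: triq; exists s.
exists (gauss_int (Num.sqrt v) (fun x => x ^+ 2)).
  rewrite -(gauss_int_cst (Num.sqrt v) 0); apply: le_gauss_int => //.
  - exact: quad_growth_cst.
  - exact: quad_growth_sqr.
  - by move=> x; exact: sqr_ge0.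
move=> h T a b ch bh tT b0 le.
rewrite !Rintegral_normal_prob//; last 2 first.
- exact: continuous_trig_poly.
- exact: bounded_trig_poly.
rewrite -gauss_intB//; [|exact: quad|exact: triq].
rewrite -gauss_intZ//; last exact: quad_growth_sqr.
rewrite -[X in _ <= X + _](gauss_int_cst (Num.sqrt v) a) -gauss_intD//; last 2 first.
- exact: quad_growth_cst.
- by apply: quad_growthZ; exact: quad_growth_sqr.
apply: gauss_int_norm_le => //.
- by apply: quad_growthB; [exact: quad|exact: triq].
- by apply: quad_growthD; [exact: quad_growth_cst|apply: quad_growthZ; exact: quad_growth_sqr].
Qed.

(** The second moment bound supplies tightness: beyond L the difference of the test function and its
    approximant is at most 2 M <= 2 M x^2 / L^2, whose mean is small under X n and under the limit
    law alike. *)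
Lemma levy_continuity (Om : nat -> finType) (X : forall n, Om n -> R) (v C : R) :
  0 <= v -> (forall n, (0 < #|Om n|)%N) ->
  (\forall n \near \oo, Mean (fun w => X n w ^+ 2) <= C) ->
  (forall t theta, Mean (fun w => cos (t * X n w + theta)) @[n --> \oo] -->
     expR (- (v * t ^+ 2 / 2)) * cos theta) ->
  cvg_in_distribution X (centered_normal v).
Proof.
move=> v0 Om0 XC Xcos h ch [M hM].
have [intT [W W0 approx]] := Rintegral_centered_normal v0.
have M0 : 0 <= M by apply: le_trans (hM 0).
have C0 : 0 <= C.
  have [n] := @filter_ex _ \oo _ _ XC; apply: le_trans.
  by rewrite /Mean divr_ge0// sumr_ge0// => w _; exact: sqr_ge0.
apply/cvgrPdist_le => /= e e0.
have e80 : 0 < e / 8 by rewrite divr_gt0.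
pose K := Num.max C W.
have K0 : 0 <= K by rewrite le_max C0.
(* As L >= 1, also L^2 >= L, whence 2 M K / L^2 <= e / 8. *)
pose L := 1 + 2 * M * K / (e / 8).
have MK0 : 0 <= 2 * M * K / (e / 8) by rewrite divr_ge0 ?mulr_ge0// ltW.
have L1 : 1 <= L by rewrite lerDl.
have L0 : 0 < L by exact: lt_le_trans L1.
have [T [tT TM hT]] := trig_approximation ch hM L0 e80.
have le x : `|h x - T x| <= e / 8 + 2 * M / L ^+ 2 * x ^+ 2.
  have b0 : 0 <= 2 * M / L ^+ 2 by rewrite divr_ge0 ?mulr_ge0 ?exprn_ge0// ltW.
  have [xL|xL] := leP `|x| L.
    by apply: le_trans (hT _ xL) _; rewrite lerDl mulr_ge0// sqr_ge0.
  apply: ler_wpDl; first exact: ltW.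
  apply: (@le_trans _ _ (2 * M)).
    by apply: (le_trans (ler_normB _ _)); rewrite mulr_natl mulr2n lerD.
  rewrite mulrAC ler_pdivlMr ?exprn_gt0// ler_wpM2l ?mulr_ge0//.
  by rewrite -[leRHS]ger0_norm ?sqr_ge0// normrX lerXn2r// ?nnegrE ?ltW.
have b0 : 0 <= 2 * M / L ^+ 2 by rewrite divr_ge0 ?mulr_ge0 ?exprn_ge0// ltW.
have bK : 2 * M / L ^+ 2 * K <= e / 8.
  rewrite mulrAC ler_pdivrMr ?exprn_gt0// -ler_pdivrMl// mulrC.
  apply: (@le_trans _ _ L); first by rewrite lerDr.
  by rewrite expr2 ler_peMr// ltW.
have bd : (exists M, forall x, `|h x| <= M) by exists M.
have IT := approx h T _ _ ch bd tT b0 le.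
have [s Ts] := tT.
have cvT : Mean (fun w => T (X n w)) @[n --> \oo] --> Rintegral (centered_normal v) setT T.
  rewrite Ts intT; elim: s {Ts} => [|p s IH].
    rewrite big_nil (_ : (fun _ => _) = fun=> 0); first exact: cvg_cst.
    apply/funext => n; rewrite (_ : (fun _ => _) = fun=> 0) ?Mean_cst//.
    by apply/funext => w; rewrite /trig_eval big_nil.
  rewrite big_cons (_ : (fun _ => _) = fun n =>
    p.1.1 * Mean (fun w => cos (p.1.2 * X n w + p.2)) + Mean (fun w => trig_eval s (X n w))).
    by apply: cvgD => //; apply: cvgM; [exact: cvg_cst|exact: Xcos].
  apply/funext => n; rewrite -MeanZ -MeanD; apply: eq_Mean => w.
  by rewrite /trig_eval big_cons.
have /cvgrPdist_le cvT' := cvT.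
near=> n.
have h1 : `|Rintegral (centered_normal v) setT T - Mean (fun w => T (X n w))| <= e / 8.
  by near: n; exact: cvT'.
have h2 : `|Mean (fun w => h (X n w)) - Mean (fun w => T (X n w))| <= e / 8 + 2 * M / L ^+ 2 * C.
  rewrite -MeanB; apply: (le_trans (normr_Mean _)).
  apply: (@le_trans _ _ (Mean (fun w => e / 8 + 2 * M / L ^+ 2 * X n w ^+ 2))).
    by apply: le_Mean => w; exact: le.
  rewrite MeanD Mean_cst// MeanZ lerD2l ler_wpM2l//.
  by near: n.
have h3 : 2 * M / L ^+ 2 * C <= e / 8.
  by apply: le_trans bK; rewrite ler_wpM2l// le_max lexx.
have h4 : 2 * M / L ^+ 2 * W <= e / 8.
  by apply: le_trans bK; rewrite ler_wpM2l// le_max lexx orbT.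
move: IT h1 h2; rewrite !ler_norml => /andP[? ?] /andP[? ?] /andP[? ?].
by apply/andP; split; lra.
Unshelve. all: by end_near. Qed.

End levy.

(** * Quicksort recurrences and split expectations *)

Ltac nat_field :=
  field; do ?[apply/andP; split]; apply: lt0r_neq0; rewrite ?ltr_wpDr ?ler0n//.

Section sums.
Context {R : realType}.
Implicit Types (a b c x w : nat -> R) (n : nat).

Lemma discriminant_le (A B C : R) : 0 <= C ->
  (forall t, 0 <= A - 2 * t * B + t ^+ 2 * C) -> B ^+ 2 <= A * C.
Proof.
rewrite le_eqVlt => /predU1P[<-|C0] h.
  have [->|B0] := eqVneq B 0; first by rewrite expr0n mulr0.
  (* For C = 0 the expression is affine in t; this t would give it the value -1. *)
  have := h ((A + 1) / (2 * B)); rewrite mulr0 addr0.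
  by rewrite (_ : 2 * _ * B = A + 1); [lra|field].
have := h (B / C).
rewrite (_ : _ + _ = (A * C - B ^+ 2) / C); last by field; rewrite gt_eqF.
by rewrite pmulr_lge0 ?invr_gt0// subr_ge0.
Qed.

Lemma sum_cauchy_schwarz (I : Type) (r : seq I) (w a : I -> R) : (forall i, 0 <= w i) ->
  (\sum_(i <- r) w i * a i) ^+ 2 <= (\sum_(i <- r) w i * a i ^+ 2) * \sum_(i <- r) w i.
Proof.
move=> w0; apply: discriminant_le; first exact: sumr_ge0.
move=> t; rewrite !mulr_sumr -sumrB -big_split /=.
apply: sumr_ge0 => i _; rewrite (_ : _ + _ = w i * (a i - t) ^+ 2); last by ring.
by rewrite mulr_ge0// sqr_ge0.
Qed.

(** The kernel of the solved quicksort recurrence. Twice this weight is the factor of E f in the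
    mean for search trees; the weight itself, with k + 1 for the size, is the one for recursive
    trees. *)
Definition qweight (k : nat) : R := ((k.+1 * k.+2)%:R)^-1.

Lemma qweight_ge0 k : 0 <= qweight k. Proof. by rewrite invr_ge0. Qed.

Lemma sum_qweight i n : (i <= n)%N ->
  \sum_(i <= k < n) qweight k = i.+1%:R^-1 - n.+1%:R^-1.
Proof.
move=> lein; rewrite (eq_bigr (fun k => - k.+2%:R^-1 - - k.+1%:R^-1)).
  by rewrite telescope_sumr// opprK addrC.
move=> k _; by rewrite /qweight natrM; nat_field.
Qed.

Lemma sum_below n : \sum_(0 <= i < n) i.+1%:R = n%:R * n.+1%:R / 2 :> R.
Proof.
elim: n => [|n IH]; first by rewrite big_geq// mul0r mul0r.
by rewrite big_nat_recr//= IH -!natr1; field.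
Qed.

Lemma sum_triangle b n :
  \sum_(0 <= i < n) i.+1%:R * \sum_(i <= k < n) b k
  = \sum_(0 <= k < n) b k * (k.+1%:R * k.+2%:R / 2).
Proof.
elim: n => [|n IH]; first by rewrite !big_geq.
rewrite [RHS]big_nat_recr//= -IH big_nat_recr//= big_nat1.
rewrite (eq_big_nat _ _ (F2 := fun i => i.+1%:R * (\sum_(i <= k < n) b k) + i.+1%:R * b n)).
  rewrite big_split /= -mulr_suml sum_below -addrA; congr (_ + _).
  by rewrite -!natr1; field.
by move=> i /andP[_ lt]; rewrite big_nat_recr ?mulrDr//= ltnW.
Qed.

(** The partial sums of x up to n, divided by n (n + 1), increase by exactly [qweight n * c n] at
    each step. *)
Lemma quicksort_eq x c : x 0%N = c 0%N ->
  (forall n, x n.+1 = c n.+1 + 2 / n.+1%:R * \sum_(0 <= i < n.+1) x i) ->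
  forall n, x n = c n + 2 * n.+1%:R * \sum_(0 <= k < n) qweight k * c k.
Proof.
move=> x0 rec; have P n : \sum_(0 <= i < n) x i =
    n%:R * n.+1%:R * \sum_(0 <= k < n) qweight k * c k.
  elim: n => [|n IH]; first by rewrite !big_geq// mulr0.
  have -> : \sum_(0 <= i < n.+1) x i = n%:R * n.+1%:R * (\sum_(0 <= k < n) qweight k * c k) +
      (c n + 2 * n.+1%:R * \sum_(0 <= k < n) qweight k * c k).
    rewrite big_nat_recr//= IH; congr (_ + _); case: n IH => [|n] IH.
      by rewrite big_geq// mulr0 addr0.
    by rewrite rec IH; congr (_ + _); nat_field.
  by rewrite [in RHS]big_nat_recr//= /qweight natrM; nat_field.
case=> [|n]; first by rewrite big_geq// mulr0 addr0.
by rewrite rec P; congr (_ + _); nat_field.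
Qed.

(** The recurrence is assumed below n only: in [var_bound] the inequality at k comes from the
    induction hypothesis at smaller sizes. *)
Lemma quicksort_le x c : x 0%N <= c 0%N ->
  forall n, (forall k, (k < n)%N -> x k.+1 <= c k.+1 + 2 / k.+1%:R * \sum_(0 <= i < k.+1) x i) ->
  x n <= c n + 2 * n.+1%:R * \sum_(0 <= k < n) qweight k * c k.
Proof.
move=> x0 n rec.
have P k : (k <= n)%N -> \sum_(0 <= i < k) x i <=
    k%:R * k.+1%:R * \sum_(0 <= k < k) qweight k * c k.
  elim: k => [|k IH] kn; first by rewrite !big_geq// mulr0.
  have le : x k <= c k + 2 * k.+1%:R * \sum_(0 <= k < k) qweight k * c k.
    case: k IH kn => [|k] IH kn; first by rewrite big_geq// mulr0 addr0.
    apply: (le_trans (rec _ (ltnW kn))); rewrite lerD2l.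
    apply: (@le_trans _ _ (2 / k.+1%:R * (k.+1%:R * k.+2%:R *
        \sum_(0 <= i < k.+1) qweight i * c i))).
      by rewrite ler_wpM2l// IH// ltnW.
    by rewrite le_eqVlt; apply/orP; left; apply/eqP; nat_field.
  rewrite big_nat_recr//=; apply: (le_trans (lerD (IH (ltnW kn)) le)).
  rewrite [in leRHS]big_nat_recr//= le_eqVlt; apply/orP; left; apply/eqP.
  by rewrite /qweight natrM; nat_field.
case: n rec P => [|n] rec P; first by rewrite big_geq// mulr0 addr0.
apply: (le_trans (rec _ (ltnSn n))); rewrite lerD2l.
apply: (@le_trans _ _ (2 / n.+1%:R * (n.+1%:R * n.+2%:R *
    \sum_(0 <= i < n.+1) qweight i * c i))).
  by rewrite ler_wpM2l// P.
by rewrite le_eqVlt; apply/orP; left; apply/eqP; nat_field.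
Qed.

Lemma sum_rev_ord n x : \sum_(i < n.+1) x (n - i)%N = \sum_(i < n.+1) x i.
Proof.
rewrite (reindex_inj rev_ord_inj) /=; apply: eq_bigr => i _.
by rewrite subSS subKn// -ltnS.
Qed.

End sums.

Section split_expectation.
Context {R : realType}.
Implicit Types (psi chi : tree0 -> tree0 -> R) (n : nat).

(** The law of the two subtrees of the root in a tree of size n + 1. *)
Definition E2 n psi : R :=
  (\sum_(i < n.+1) E i (fun l => E (n - i) (fun r => psi l r))) / n.+1%:R.

Lemma E_E2 n phi : E n.+1 phi = E2 n (fun l r => phi (node l r)).
Proof. exact: E_split. Qed.

Lemma eq_E2 n psi chi :
  (forall l r, (size0 l + size0 r = n)%N -> psi l r = chi l r) -> E2 n psi = E2 n chi.
Proof.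
move=> e; congr (_ / _); apply: eq_bigr => i _; apply: eq_E => l li.
by apply: eq_E => r ri; apply: e; rewrite li ri subnKC// -ltnS.
Qed.

Lemma E2D n psi chi : E2 n (fun l r => psi l r + chi l r) = E2 n psi + E2 n chi.
Proof.
rewrite /E2 -mulrDl -big_split; congr (_ / _); apply: eq_bigr => i _ /=.
by rewrite -ED; apply: eq_E => l _; rewrite ED.
Qed.

Lemma E2Z n a psi : E2 n (fun l r => a * psi l r) = a * E2 n psi.
Proof.
rewrite /E2 mulrA mulr_sumr; congr (_ / _); apply: eq_bigr => i _ /=.
by rewrite -EZ; apply: eq_E => l _; rewrite EZ.
Qed.

Lemma E2B n psi chi : E2 n (fun l r => psi l r - chi l r) = E2 n psi - E2 n chi.
Proof.
rewrite -mulN1r -E2Z -E2D; apply: eq_E2 => l r _; by rewrite mulN1r.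
Qed.

Lemma le_E2 n psi chi :
  (forall l r, (size0 l + size0 r = n)%N -> psi l r <= chi l r) -> E2 n psi <= E2 n chi.
Proof.
move=> e; rewrite /E2 ler_wpM2r ?invr_ge0//; apply: ler_sum => i _; apply: le_E => l li.
by apply: le_E => r ri; apply: e; rewrite li ri subnKC// -ltnS.
Qed.

Lemma E2_cst n a : E2 n (fun _ _ => a) = a.
Proof.
rewrite /E2 (eq_bigr (fun=> a)); last by move=> i _; rewrite !E_cst.
by rewrite sumr_const card_ord -[a *+ _]mulr_natr mulfK// pnatr_eq0.
Qed.

Lemma E2_ge0 n psi : (forall l r, 0 <= psi l r) -> 0 <= E2 n psi.
Proof. by move=> h; rewrite -(E2_cst n 0); apply: le_E2. Qed.

Lemma E2_prod n (f h : tree0 -> R) :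
  E2 n (fun l r => f l * h r) = (\sum_(i < n.+1) E i f * E (n - i) h) / n.+1%:R.
Proof.
congr (_ / _); apply: eq_bigr => i _; rewrite mulrC -EZ; apply: eq_E => l _.
by rewrite EZ mulrC.
Qed.

Lemma E2_left n f : E2 n (fun l _ => f l) = (\sum_(i < n.+1) E i f) / n.+1%:R.
Proof.
by congr (_ / _); apply: eq_bigr => i _; apply: eq_E => l _; rewrite E_cst.
Qed.

Lemma E2_right n f : E2 n (fun _ r => f r) = (\sum_(i < n.+1) E i f) / n.+1%:R.
Proof.
rewrite -(sum_rev_ord n (fun i => E i f)).
by congr (_ / _); apply: eq_bigr => i _; rewrite E_cst.
Qed.

Lemma E2_size n (q : nat -> nat -> R) :
  E2 n (fun l r => q (size0 l) (size0 r)) = (\sum_(i < n.+1) q i (n - i)%N) / n.+1%:R.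
Proof.
congr (_ / _); apply: eq_bigr => i _; rewrite -[RHS](E_cst i); apply: eq_E => l <-.
by rewrite -[RHS](E_cst (n - size0 l)); apply: eq_E => r <-.
Qed.

Lemma E2_cauchy_schwarz n psi chi :
  E2 n (fun l r => psi l r * chi l r) ^+ 2
  <= E2 n (fun l r => psi l r ^+ 2) * E2 n (fun l r => chi l r ^+ 2).
Proof.
apply: discriminant_le; first by apply: E2_ge0 => l r; exact: sqr_ge0.
move=> t; rewrite -!E2Z -E2B -E2D; apply: E2_ge0 => l r.
rewrite (_ : _ + _ = (psi l r - t * chi l r) ^+ 2); first exact: sqr_ge0.
by ring.
Qed.

Lemma E_cauchy_schwarz n (f h : tree0 -> R) :
  E n (fun t => f t * h t) ^+ 2 <= E n (fun t => f t ^+ 2) * E n (fun t => h t ^+ 2).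
Proof.
apply: discriminant_le; first by apply: E_ge0 => t _; exact: sqr_ge0.
move=> t; rewrite -!EZ -EB -ED; apply: E_ge0 => u _.
rewrite (_ : _ + _ = (f u - t * h u) ^+ 2); first exact: sqr_ge0.
by ring.
Qed.

Lemma sqr_E_le n (f : tree0 -> R) : E n f ^+ 2 <= E n (fun t => f t ^+ 2).
Proof.
have := E_cauchy_schwarz n f (fun=> 1).
rewrite expr1n E_cst mulr1; congr (_ ^+ 2 <= _); apply: eq_E => t _; exact: mulr1.
Qed.

End split_expectation.

(** * Additive functionals: mean and variance *)

Section functional.
Context {R : realType}.
Variable g : tree0 -> tree0 -> R.

Fixpoint bfun (t : btree) : R :=
  let: BNode l r := t in g l r + oapp bfun 0 l + oapp bfun 0 r.

Definition fringe_sum (t : tree0) : R := oapp bfun 0 t.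
Local Notation F := fringe_sum.

Lemma fringe_sum_node l r : F (node l r) = g l r + F l + F r.
Proof. by []. Qed.

Definition mean_toll (n : nat) : R := if n is n'.+1 then E2 n' g else 0.
Definition mean_add (n : nat) : R := E n F.
Local Notation a := mean_toll.
Local Notation m := mean_add.

Lemma mean_rec n : m n.+1 = a n.+1 + 2 / n.+1%:R * \sum_(0 <= i < n.+1) m i.
Proof.
rewrite /m E_E2; under eq_E2 => l r _ do rewrite fringe_sum_node.
rewrite !E2D E2_left E2_right big_mkord /= -addrA; congr (_ + _).
by rewrite -mulrDl -mulr2n -[_ *+ 2]mulr_natl mulrAC.
Qed.

Lemma mean_addE n : m n = a n + 2 * n.+1%:R * \sum_(0 <= k < n) qweight k * a k.
Proof.
by apply: (@quicksort_eq _ m a); [rewrite /m E0|exact: mean_rec].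
Qed.

Definition centered (t : tree0) : R := F t - m (size0 t).
Local Notation X := centered.
Definition var_add (n : nat) : R := E n (fun t => X t ^+ 2).
Local Notation V := var_add.

Lemma var_addE n : V n = E n (fun t => (F t - m n) ^+ 2).
Proof. by apply: eq_E => t <-. Qed.

Lemma var_add_ge0 n : 0 <= V n.
Proof. by apply: E_ge0 => t _; exact: sqr_ge0. Qed.

Lemma E_centered n : E n X = 0.
Proof.
transitivity (E n (fun t => F t - m n)); first by apply: eq_E => t <-.
by rewrite EB E_cst subrr.
Qed.

Lemma E2_centered_left n (q : nat -> nat -> R) :
  E2 n (fun l r => q (size0 l) (size0 r) * X l) = 0.
Proof.
rewrite /E2 big1 ?mul0r// => i _; rewrite E_fubini -[RHS](E_cst (n - i)).
apply: eq_E => r _; transitivity (E i (fun l => q i (size0 r) * X l)).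
  by apply: eq_E => l <-.
by rewrite EZ E_centered mulr0.
Qed.

Lemma E2_centered_right n (q : nat -> nat -> R) :
  E2 n (fun l r => q (size0 l) (size0 r) * X r) = 0.
Proof.
rewrite /E2 big1 ?mul0r// => i _; rewrite -[RHS](E_cst i).
apply: eq_E => l _; transitivity (E (n - i) (fun r => q (size0 l) (n - i)%N * X r)).
  by apply: eq_E => r <-.
by rewrite EZ E_centered mulr0.
Qed.

Lemma E2_centered n (q : nat -> nat -> R) :
  E2 n (fun l r => q (size0 l) (size0 r) * (X l + X r)) = 0.
Proof.
under eq_E2 => l r _ do rewrite mulrDr.
by rewrite E2D E2_centered_left E2_centered_right addr0.
Qed.

Lemma E2_centered_prod n : E2 n (fun l r => X l * X r) = 0.
Proof.
by rewrite E2_prod big1 ?mul0r// => i _; rewrite E_centered mul0r.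
Qed.

Lemma E2_sqr_centered n :
  E2 n (fun l r => (X l + X r) ^+ 2) = 2 / n.+1%:R * \sum_(0 <= i < n.+1) V i.
Proof.
transitivity (E2 n (fun l r => X l ^+ 2 + X r ^+ 2 + 2 * (X l * X r))).
  by apply: eq_E2 => l r _; ring.
rewrite !E2D E2Z E2_centered_prod mulr0 addr0 E2_left E2_right big_mkord.
by rewrite -mulrDl -mulr2n -[_ *+ 2]mulr_natl mulrAC.
Qed.

(** The toll of the centered functional: the toll g, plus the change in the means caused by the
    split. *)
Definition split_toll (l r : tree0) : R :=
  g l r + m (size0 l) + m (size0 r) - m (size0 l + size0 r).+1.
Local Notation H := split_toll.

Lemma centered_node l r : X (node l r) = H l r + (X l + X r).
Proof. by rewrite /X fringe_sum_node size_node /H; ring. Qed.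

(** Given the sizes, X l and X r are independent and centered, so their products with each other and
    with functions of the sizes vanish. Only the correlation with g survives. *)
Lemma var_rec n : V n.+1 = E2 n (fun l r => H l r ^+ 2)
  + 2 * E2 n (fun l r => g l r * (X l + X r))
  + 2 / n.+1%:R * \sum_(0 <= i < n.+1) V i.
Proof.
rewrite -E2_sqr_centered -E2Z /V E_E2.
transitivity (E2 n (fun l r => H l r ^+ 2 + 2 * (g l r * (X l + X r)) + (X l + X r) ^+ 2
   + 2 * (m (size0 l) + m (size0 r) - m (size0 l + size0 r).+1) * (X l + X r))).
  by apply: eq_E2 => l r _; rewrite centered_node /H; ring.
rewrite !E2D.
by rewrite (E2_centered n (fun i j => 2 * (m i + m j - m (i + j).+1))) addr0.
Qed.

(** The part of [split_toll] that is due to the random sizes alone; what remains is g minus its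
    mean. *)
Definition drift (i j : nat) : R := m i + m j - (m (i + j).+1 - a (i + j).+1).

(** A Hardy inequality: Cauchy-Schwarz with the weights [qweight], whose sum from i on is at most 1
    / (i + 1), followed by an exchange of the summations. *)
Lemma sum_mean_sqr n : \sum_(0 <= i < n.+1)
   (i.+1%:R * \sum_(i <= k < n.+1) qweight k * a k) ^+ 2
   <= (\sum_(0 <= k < n.+1) a k ^+ 2) / 2.
Proof.
apply: (@le_trans _ _ (\sum_(0 <= i < n.+1)
    i.+1%:R * \sum_(i <= k < n.+1) qweight k * a k ^+ 2)).
  apply: ler_sum_nat => i /andP[_ lei]; rewrite exprMn.
  apply: (@le_trans _ _ (i.+1%:R ^+ 2 * ((\sum_(i <= k < n.+1) qweight k * a k ^+ 2)
     * \sum_(i <= k < n.+1) qweight k))).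
    by rewrite ler_wpM2l ?sqr_ge0//; apply: sum_cauchy_schwarz; exact: qweight_ge0.
  rewrite sum_qweight; last exact: ltnW.
  rewrite expr2 -mulrA ler_wpM2l// mulrCA ler_piMr//.
    by apply: sumr_ge0 => k _; rewrite mulr_ge0 ?qweight_ge0 ?sqr_ge0.
  rewrite mulrBr mulfV ?pnatr_eq0// gerBl; exact: mulr_ge0.
rewrite (sum_triangle (fun k => qweight k * a k ^+ 2)) mulr_suml.
apply: ler_sum => k _; rewrite le_eqVlt; apply/orP; left; apply/eqP.
by rewrite /qweight natrM; nat_field.
Qed.

(** Each mean is a i + 2 (i + 1) Q - 2 T i with a common Q. Since (i + 1) + (n - i + 1) = n + 2, the
    terms in Q cancel and four terms remain, whose squares are summed by [sum_mean_sqr]; 24 = 2 * 4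
    * (1 + 4 / 2). *)
Lemma drift_le n : E2 n (fun l r => drift (size0 l) (size0 r) ^+ 2)
  <= 24 / n.+1%:R * \sum_(0 <= k < n.+1) a k ^+ 2.
Proof.
pose T i := i.+1%:R * \sum_(i <= k < n.+1) qweight k * a k.
pose u i := 4 * (a i ^+ 2 + 4 * T i ^+ 2).
have mT i : (i <= n)%N -> m i = a i + 2 * i.+1%:R * (\sum_(0 <= k < n.+1) qweight k * a k) - 2 * T i.
  move=> lei; rewrite mean_addE /T (@big_cat_nat _ _ _ i 0 n.+1)//=; last exact: leqW.
  by ring.
rewrite (E2_size n (fun i j => drift i j ^+ 2)).
apply: (@le_trans _ _ ((\sum_(i < n.+1) (u i + u (n - i)%N)) / n.+1%:R)).
  rewrite ler_wpM2r ?invr_ge0//; apply: ler_sum => i _.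
  have lei : (i <= n)%N by rewrite -ltnS.
  rewrite /drift subnKC// [m n.+1]mean_addE !mT ?leq_subr//.
  set Q := \sum_(0 <= k < n.+1) _.
  have e : i.+1%:R + (n - i).+1%:R = n.+2%:R :> R.
    by rewrite -natrD addSn addnS subnKC.
  rewrite (_ : _ - _ = a i + a (n - i)%N - 2 * T i - 2 * T (n - i)%N); last first.
    by rewrite -e; ring.
  rewrite /u; set A := a i; set B := a _; set C := T i; set D := T _.
  have := sqr_ge0 (A - B); have := sqr_ge0 (A + 2 * C); have := sqr_ge0 (A + 2 * D).
  have := sqr_ge0 (B + 2 * C); have := sqr_ge0 (B + 2 * D); have := sqr_ge0 (2 * C - 2 * D).
  nra.
rewrite big_split /= (sum_rev_ord n u) -mulr2n -[_ *+ 2]mulr_natl mulrAC.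
rewrite mulrAC [leRHS]mulrAC ler_wpM2r ?invr_ge0//.
rewrite -mulr_sumr -(big_mkord xpredT (fun i => a i ^+ 2 + 4 * T i ^+ 2)) big_split /= -mulr_sumr.
have h : \sum_(0 <= i < n.+1) T i ^+ 2 <= (\sum_(0 <= k < n.+1) a k ^+ 2) / 2.
  exact: sum_mean_sqr.
by lra.
Qed.

Lemma split_toll_le n (w : R) : E2 n (fun l r => (g l r - a n.+1) ^+ 2) <= w ->
  E2 n (fun l r => H l r ^+ 2)
  <= 2 * w + 48 / n.+1%:R * \sum_(0 <= k < n.+1) a k ^+ 2.
Proof.
move=> lew; apply: (@le_trans _ _ (E2 n (fun l r => 2 * (g l r - a n.+1) ^+ 2 +
   2 * drift (size0 l) (size0 r) ^+ 2))).
  apply: le_E2 => l r lr; rewrite /H /drift lr.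
  set A := g l r; set B := m _; set C := m _; set D := m _; set A' := a _.
  by have := sqr_ge0 ((A - A') - (B + C - (D - A'))); nra.
rewrite E2D !E2Z; apply: lerD; first by rewrite ler_wpM2l.
apply: (le_trans (ler_wpM2l _ (drift_le n))) => //.
by rewrite le_eqVlt; apply/orP; left; apply/eqP; ring.
Qed.

(* If V i <= B (i + 1) for i <= n, then the recurrence bounds V (n + 1) by
   (3 e + 3 e sqrt B)(n + 2), and B = 6 e + 9 e ^ 2 is large enough to close the
   induction. *)
Lemma var_bound (w kappa : nat -> R) (e : R) : 0 <= e ->
  (forall n, E2 n (fun l r => (g l r - a n.+1) ^+ 2) <= w n.+1) ->
  (forall n B, 0 <= B -> (forall i, (i <= n)%N -> V i <= B * i.+1%:R) ->
     2 * E2 n (fun l r => g l r * (X l + X r)) <= kappa n.+1 * Num.sqrt B) ->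
  (forall n, 0 <= kappa n <= e * n.+1%:R) ->
  (forall n, \sum_(0 <= k < n) qweight k * kappa k <= e) ->
  let u n := 2 * w n + 48 / n%:R * \sum_(0 <= k < n) a k ^+ 2 in
  (forall n, 0 <= u n <= e * n.+1%:R) ->
  (forall n, \sum_(0 <= k < n) qweight k * u k <= e) ->
  forall n, V n <= (6 * e + 9 * e ^+ 2) * n.+1%:R.
Proof.
move=> e0 hw hk k0 sk u u0 su.
set B := 6 * e + 9 * e ^+ 2.
have B0 : 0 <= B by rewrite addr_ge0// mulr_ge0// sqr_ge0.
(* From 3 e sqrt B <= (9 e^2 + B) / 2; the value of B is the one for which 3 e + (9 e^2 + B) / 2 =
   B. *)
have sB : 3 * e + 3 * e * Num.sqrt B <= B.
  have := sqr_sqrtr B0; have := sqrtr_ge0 B; set s := Num.sqrt B => s0 sB.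
  by have := sqr_ge0 (s - 3 * e); rewrite /B in sB *; nra.
elim/ltn_ind => n IH.
have V0 : V 0%N <= u 0%N + kappa 0%N * Num.sqrt B.
  apply: (@le_trans _ _ 0).
    by rewrite /V E0 /X /= /m E0 /= subr0 expr0n.
  by rewrite addr_ge0// ?mulr_ge0 ?sqrtr_ge0//; [case/andP: (u0 0%N)|case/andP: (k0 0%N)].
have := @quicksort_le _ V (fun k => u k + kappa k * Num.sqrt B) V0 n.
have rec k : (k < n)%N ->
    V k.+1 <= u k.+1 + kappa k.+1 * Num.sqrt B + 2 / k.+1%:R * \sum_(0 <= i < k.+1) V i.
  move=> kn; rewrite var_rec lerD2r; apply: lerD; first exact: split_toll_le.
  by apply: hk => // i ik; apply: IH; exact: leq_ltn_trans kn.
move=> /(_ rec); move=> /le_trans; apply.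
have -> : \sum_(0 <= k < n) qweight k * (u k + kappa k * Num.sqrt B) =
    \sum_(0 <= k < n) qweight k * u k + (\sum_(0 <= k < n) qweight k * kappa k) * Num.sqrt B.
  rewrite mulr_suml -big_split /=; apply: eq_bigr => k _; ring.
apply: (@le_trans _ _ ((3 * e + 3 * e * Num.sqrt B) * n.+1%:R)); last by rewrite ler_wpM2r.
have [_ un] := andP (u0 n); have [_ kn] := andP (k0 n).
have := su n; have := sk n; set S1 := \sum_(0 <= k < n) _; set S2 := \sum_(0 <= k < n) _.
move=> h1 h2; have := sqrtr_ge0 B; set s := Num.sqrt B => s0.
have n0 : 0 <= n.+1%:R :> R by [].
have h3 : kappa n * s <= e * n.+1%:R * s by rewrite ler_wpM2r.
have h4 : (S2 + S1 * s) * n.+1%:R <= (e + e * s) * n.+1%:R.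
  by rewrite ler_wpM2r// lerD// ler_wpM2r.
by lra.
Qed.

End functional.

(** * Central limit theorem for truncated tolls *)

Section truncated_char.
Context {R : realType}.
Variables (g : tree0 -> tree0 -> R) (gam : tree0 -> R) (K : nat) (mu v : R).
Hypothesis v0 : 0 <= v.
Hypothesis K0 : (0 < K)%N.
(** The two models meet in these hypotheses: [gam] is 0 for search trees, whose toll sees the total
    size, and is the truncated toll itself for recursive trees. *)
Hypothesis g_right : forall l r, (K <= size0 r)%N -> g l r = gam l.
Hypothesis g_left : forall l r, (K <= size0 l)%N -> g l r = 0.
Hypothesis gam0 : forall l, (K <= size0 l)%N -> gam l = 0.
Hypothesis mean_lin : forall n, (K <= n)%N -> mean_add g n = n.+1%:R * mu.
Hypothesis var_lin : forall n, (K <= n)%N -> var_add g n = n.+1%:R * v.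

(** Centering by a multiple of the number of external positions, not by the mean, makes Y additive:
    Y (node l r) = Y' l + Y r as soon as one side is large, with the toll absorbed into Y'. *)
Let Y (t : tree0) : R := fringe_sum g t - (size0 t).+1%:R * mu.
Let Y' (t : tree0) : R := Y t + gam t.
Let q (t : R) : R := expR (- (v * t ^+ 2 / 2)).

Let Y_centered n t : (K <= n)%N -> size0 t = n -> Y t = centered g t.
Proof. by move=> Kn tn; rewrite /Y /centered tn mean_lin. Qed.

Let E_Y n : (K <= n)%N -> E n Y = 0.
Proof.
by move=> Kn; rewrite -(E_centered g n); apply: eq_E => t /Y_centered; exact.
Qed.

Let E_Y2 n : (K <= n)%N -> E n (fun t => Y t ^+ 2) = n.+1%:R * v.
Proof.
by move=> Kn; rewrite -var_lin//; apply: eq_E => t /Y_centered ->.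
Qed.

Let Y'_Y t : (K <= size0 t)%N -> Y' t = Y t.
Proof. by move=> Kt; rewrite /Y' gam0// addr0. Qed.

Let Y_node n l r : (K.*2 <= n)%N -> (size0 l + size0 r = n)%N -> Y (node l r) = Y' l + Y r.
Proof.
move=> Kn lr; have e : g l r = gam l.
  have [Kr|rK] := leqP K (size0 r); first exact: g_right.
  have Kl : (K <= size0 l)%N by lia.
  by rewrite g_left// gam0.
rewrite /Y' /Y fringe_sum_node e size_node.
rewrite (_ : (size0 l + size0 r).+2 = ((size0 l).+1 + (size0 r).+1)%N); last by lia.
by rewrite natrD; ring.
Qed.

Let sumK (x : nat -> R) n : (K <= n.+1)%N -> (forall i, (K <= i)%N -> x i = 0) ->
  \sum_(i < n.+1) x i = \sum_(i < K) x i.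
Proof.
move=> Kn x0; rewrite -!(big_mkord xpredT) (@big_cat_nat _ _ _ K)//=.
by rewrite [X in _ + X]big_nat_cond [X in _ + X]big1 ?addr0// => i /andP[/andP[/x0]].
Qed.

(* For n >= 2 K the recurrences for the first two moments of Y involve only the
   sizes i < K, so that their exact linearity beyond K makes these sums vanish. *)
Let moment1 : \sum_(i < K) (E i Y' + E i Y) = 0.
Proof.
have := E_Y (n := K.*2.+1); rewrite E_E2.
rewrite (eq_E2 (chi := fun l r => Y' l + Y r)); last by move=> l r /Y_node ->.
rewrite E2D E2_left E2_right -mulrDl -big_split /= => h.
rewrite -(sumK (x := fun i => E i Y' + E i Y) (n := K.*2)); [|by lia|].
  apply/eqP; have /eqP := h ltac:(by lia); rewrite mulf_eq0 => /orP[//|].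
  by rewrite invr_eq0 pnatr_eq0.
move=> i Ki; rewrite E_Y// addr0 -(E_Y Ki); apply: eq_E => t ti.
by rewrite Y'_Y// ti.
Qed.

Let moment2 : \sum_(i < K) (E i (fun t => Y' t ^+ 2) + E i (fun t => Y t ^+ 2)
   - 2 * i.+1%:R * v) = 0.
Proof.
have := E_Y2 (n := K.*2.+1); rewrite E_E2.
rewrite (eq_E2 (chi := fun l r => Y' l ^+ 2 + Y r ^+ 2 + 2 * (Y' l * Y r))); last first.
  by move=> l r /Y_node ->//; ring.
have prod0 : E2 K.*2 (fun l r => Y' l * Y r) = 0.
  rewrite E2_prod big1 ?mul0r// => i _; have [Ki|iK] := leqP K i; last first.
    by rewrite [X in _ * X](_ : _ = 0) ?mulr0//; apply: E_Y; lia.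
  rewrite [X in X * _](_ : _ = 0) ?mul0r// -(E_Y Ki); apply: eq_E => t ti.
  by rewrite Y'_Y// ti.
rewrite !E2D E2Z prod0 E2_left E2_right mulr0 addr0 -mulrDl -big_split /= => h.
rewrite -(sumK (x := fun i => E i (fun t => Y' t ^+ 2) + E i (fun t => Y t ^+ 2)
   - 2 * i.+1%:R * v) (n := K.*2)); [|by lia|].
  have := h ltac:(by lia); rewrite sumrB => /(canRL (divfK _)).
  rewrite pnatr_eq0 => /(_ isT) ->; rewrite -mulr_suml -mulr_sumr.
  by rewrite -(big_mkord xpredT (fun i => i.+1%:R)) sum_below; field.
move=> i Ki; rewrite E_Y2// [X in X + _ - _](_ : _ = i.+1%:R * v); first by ring.
rewrite -E_Y2//; apply: eq_E => t ti.
by rewrite Y'_Y// ti.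
Qed.

Let expRN_taylor (x : R) : 0 <= x -> `|expR (- x) - 1 + x| <= x ^+ 2.
Proof.
move=> x0; have h1 := expR_ge1Dx x; have h2 := expR_ge1Dx (- x).
rewrite ger0_norm; last by lra.
have h3 : expR (- x) <= (1 + x)^-1.
  by rewrite expRN lef_pV2// posrE ?expR_gt0// ltr_wpDr.
have : (1 + x)^-1 <= 1 - x + x ^+ 2.
  rewrite -[X in X <= _]mul1r ler_pdivrMr ?ltr_wpDr//.
  by rewrite (_ : _ * _ = 1 + x ^+ 3); [rewrite lerDl exprn_ge0|ring].
lra.
Qed.

(** The factor q^j stands for an independent centered normal summand of variance j v, so the
    variances add up in the second-order term. *)
Let char_taylor i j (U : tree0 -> R) : exists2 C : R, 0 <= C & forall t theta : R, `|t| <= 1 ->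
  `|E i (fun u => cos (t * U u + theta)) * q t ^+ j -
    (cos theta - t * E i U * sin theta
     - t ^+ 2 / 2 * (E i (fun u => U u ^+ 2) + j%:R * v) * cos theta)| <= C * `|t| ^+ 3.
Proof.
set m1 := E i U; set m2 := E i (fun u => U u ^+ 2); set m3 := E i (fun u => `|U u| ^+ 3).
have m20 : 0 <= m2 by apply: E_ge0 => u _; exact: sqr_ge0.
have m30 : 0 <= m3 by apply: E_ge0 => u _; rewrite exprn_ge0.
have [c c0 cE] : exists2 c, 0 <= c & c = j%:R * v / 2.
  by exists (j%:R * v / 2) => //; rewrite divr_ge0// mulr_ge0.
exists (m3 + (1 + `|m1| + m2) * c ^+ 2 + c * (`|m1| + m2)).
  by rewrite !addr_ge0// mulr_ge0 ?addr_ge0 ?sqr_ge0.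
move=> t theta t1.
set ec := E i _; set x := c * t ^+ 2.
have x0 : 0 <= x by rewrite mulr_ge0// sqr_ge0.
pose A := cos theta - t * m1 * sin theta - t ^+ 2 / 2 * m2 * cos theta.
have qj : q t ^+ j = expR (- x).
  by rewrite /q -expRM_natl; congr expR; rewrite /x cE; ring.
have h1 : `|ec - A| <= m3 * `|t| ^+ 3.
  have -> : ec - A = E i (fun u => cos (t * U u + theta) - cos theta + t * U u * sin theta
       + (t * U u) ^+ 2 / 2 * cos theta).
    rewrite (eq_E (psi := fun u => cos (t * U u + theta) - cos theta + (t * sin theta) * U u
       + (t ^+ 2 / 2 * cos theta) * U u ^+ 2)); last by move=> u _; ring.
    by rewrite !ED EN E_cst !EZ /A -/m1 -/m2 -/ec; ring.
  apply: (le_trans (normr_E _ _)); rewrite -EZr; apply: le_E => u _.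
  apply: (le_trans (cos_taylor3 _ _)).
  by rewrite normrM exprMn mulrC.
have h2 := expRN_taylor x0.
have t0 := normr_ge0 t.
have tt : t ^+ 2 = `|t| ^+ 2 by rewrite -normrX ger0_norm ?sqr_ge0.
have t23 : `|t| ^+ 2 <= 1 by rewrite exprn_ile1.
have s1 : `|sin theta| <= 1 := sin_max theta.
have c1 : `|cos theta| <= 1 := cos_max theta.
have hA' : `|A - cos theta| <= `|t| * (`|m1| + m2).
  rewrite (_ : A - _ = - (t * m1 * sin theta) - t ^+ 2 / 2 * m2 * cos theta); last by rewrite /A; ring.
  apply: (le_trans (ler_normB _ _)); rewrite normrN mulrDr; apply: lerD.
    by rewrite normrM normrM ler_piMr// mulr_ge0.
  rewrite normrM normrM (ger0_norm m20) normrM normfV (ger0_norm (sqr_ge0 t)) tt normr_nat.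
  apply: (@le_trans _ _ (`|t| ^+ 2 / 2 * m2)).
    by rewrite ler_piMr//; apply: mulr_ge0 => //; apply: mulr_ge0 => //; exact: sqr_ge0.
  rewrite ler_wpM2r//; nra.
have hA : `|A| <= 1 + `|m1| + m2.
  rewrite -[A](subrK (cos theta)); apply: (le_trans (ler_normD _ _)).
  have : `|t| * (`|m1| + m2) <= `|m1| + m2 by rewrite ler_piMl// addr_ge0.
  lra.
rewrite (_ : ec * _ - _ = (ec - A) * expR (- x) + A * (expR (- x) - 1 + x) - x * (A - cos theta));
  last by rewrite qj /A /x cE; field.
have e1 : `|expR (- x)| <= 1.
  by rewrite ger0_norm ?expR_ge0// -expR0 ler_expR oppr_le0.
have t3 : 0 <= `|t| ^+ 3 by rewrite exprn_ge0.
have b1 : `|(ec - A) * expR (- x)| <= m3 * `|t| ^+ 3.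
  by rewrite normrM; apply: le_trans h1; rewrite ler_piMr.
have b2 : `|A * (expR (- x) - 1 + x)| <= (1 + `|m1| + m2) * c ^+ 2 * `|t| ^+ 3.
  rewrite normrM -mulrA; apply: ler_pM => //.
  apply: (le_trans h2); rewrite /x exprMn ler_wpM2l ?sqr_ge0//.
  by rewrite tt -exprM (exprS `|t| 3) ler_piMl.
have b3 : `|x * (A - cos theta)| <= c * (`|m1| + m2) * `|t| ^+ 3.
  rewrite normrM (ger0_norm x0) /x tt -!mulrA ler_wpM2l//.
  apply: (@le_trans _ _ (`|t| ^+ 2 * (`|t| * (`|m1| + m2)))).
    by rewrite mulrA -expr2 ler_wpM2l// sqr_ge0.
  by rewrite mulrA -exprSr mulrC.
rewrite (mulrDl _ _ (`|t| ^+ 3)) (mulrDl _ _ (`|t| ^+ 3)).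
apply: (le_trans (ler_normB _ _)); apply: lerD => //.
by apply: (le_trans (ler_normD _ _)); apply: lerD.
Qed.

(** The error of a split whose small side, of size i < K, is kept exact while the large side is
    replaced by its normal approximation; the common factor q^(n + 1 - K) is taken out. *)
Let rho i U t theta := E i (fun u => cos (t * U u + theta)) * q t ^+ (K - i)
  - q t ^+ K.+1 * cos theta.

Let rho_bound : exists2 C : R, 0 <= C & forall t theta : R, `|t| <= 1 ->
  `|\sum_(i < K) (rho i Y' t theta + rho i Y t theta)| <= C * `|t| ^+ 3.
Proof.
(* Applied to the zero functional, the expansion is that of the power of q alone. *)
have [C0 C00 hC0] := char_taylor 0 K.+1 (fun=> 0).
have ex (i : 'I_K) : exists C1 : R, 0 <= C1 /\ forall t theta : R, `|t| <= 1 ->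
  `|rho i Y' t theta + rho i Y t theta
    - (- (t * sin theta) * (E i Y' + E i Y)
       - t ^+ 2 / 2 * cos theta * (E i (fun t => Y' t ^+ 2) + E i (fun t => Y t ^+ 2)
   - 2 * i.+1%:R * v))| <= C1 * `|t| ^+ 3.
  have [C1 C10 hC1] := char_taylor i (K - i) Y'.
  have [C2 C20 hC2] := char_taylor i (K - i) Y.
  exists (C1 + C2 + 2 * C0); split; first by rewrite !addr_ge0// mulr_ge0.
  move=> t theta t1; have := hC1 t theta t1; have := hC2 t theta t1; have := hC0 t theta t1.
  rewrite !E0 /= mulr0 add0r expr0n /= /rho.
  have eK : (K - i)%:R = K%:R - i%:R :> R by rewrite natrB// ltnW.
  rewrite eK -[K.+1%:R]natr1 -[i.+1%:R]natr1.
  set a1 := E i _; set b1 := E i _; set a2 := E i _; set b2 := E i _; set a3 := E i _; set b3 := E i _.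
  set Q := q t ^+ K.+1; set Q' := q t ^+ (K - i); set T := `|t| ^+ 3.
  set ct := cos theta; set st := sin theta.
  rewrite !ler_norml => /andP[? ?] /andP[? ?] /andP[? ?].
  by apply/andP; split; lra.
have [C1 hC1] := boolp.choice ex.
exists (\sum_i C1 i); first by apply: sumr_ge0 => i _; case: (hC1 i).
move=> t theta t1; rewrite mulr_suml.
pose lin (i : nat) := - (t * sin theta) * (E i Y' + E i Y)
       - t ^+ 2 / 2 * cos theta * (E i (fun t => Y' t ^+ 2) + E i (fun t => Y t ^+ 2)
   - 2 * i.+1%:R * v).
have lin0 : \sum_(i < K) lin i = 0.
  by rewrite /lin sumrB -!mulr_sumr moment1 moment2 !mulr0 subrr.
rewrite -[X in `|X|]subr0 -[X in _ - X]lin0 -sumrB; apply: (le_trans (ler_norm_sum _ _ _)).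
by apply: ler_sum => i _; case: (hC1 i) => _; exact.
Qed.

(* By [moment1] and [moment2], the sizes i < K contribute to the recurrence only
   from the third order in t on. *)
Lemma truncated_char : exists C : R, forall (t theta : R) n, `|t| <= 1 -> (K <= n)%N ->
  `|E n (fun u => cos (t * centered g u + theta)) - q t ^+ n.+1 * cos theta|
  <= C * n.+1%:R * `|t| ^+ 3.
Proof.
have [Cr Cr0 hCr] := rho_bound.
have ex n : exists Cb : R, 0 <= Cb /\ ((K <= n)%N -> forall t theta : R, `|t| <= 1 ->
    `|E n (fun u => cos (t * Y u + theta)) - q t ^+ n.+1 * cos theta| <= Cb * `|t| ^+ 3).
  have [C0 C00 hC0] := char_taylor 0 n.+1 (fun=> 0).
  have [C1 C10 hC1] := char_taylor n 0 Y.
  exists (C0 + C1); split; first by rewrite addr_ge0.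
  move=> Kn t theta t1; have := hC0 t theta t1; have := hC1 t theta t1.
  rewrite !E0 /= mulr0 add0r expr0n /= E_Y// E_Y2// expr0.
  set a1 := E n _; set Q := q t ^+ n.+1; set T := `|t| ^+ 3.
  set ct := cos theta; set st := sin theta.
  rewrite !ler_norml => /andP[? ?] /andP[? ?].
  by apply/andP; split; lra.
have [Cb hCb] := boolp.choice ex.
(* Cr serves the induction step, the sum serves the starting sizes up to 2 K. *)
pose C := Cr + \sum_(i < K.*2.+1) Cb i.
have C0 : 0 <= C by rewrite addr_ge0// sumr_ge0// => i _; case: (hCb i).
exists C => t theta n t1.
pose T := `|t| ^+ 3; have T0 : 0 <= T by rewrite exprn_ge0.
have q01 : 0 <= q t <= 1.
  rewrite expR_ge0 -expR0 ler_expR oppr_le0 divr_ge0// mulr_ge0// sqr_ge0.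
  by [].
have qk k : 0 <= q t ^+ k <= 1.
  by have /andP[q0 q1] := q01; rewrite exprn_ge0 ?exprn_ile1.
suff main : (K <= n)%N -> forall theta,
    `|E n (fun u => cos (t * Y u + theta)) - q t ^+ n.+1 * cos theta| <= C * n.+1%:R * T.
  move=> Kn; have := main Kn theta; congr (`|_ - _| <= _); apply: eq_E => u un.
  by rewrite (Y_centered Kn).
elim/ltn_ind: n => n IH Kn {}theta.
have [n2K|Kn2] := ltnP n K.*2.+1.
  have [_ /(_ Kn t theta t1) h] := hCb n; apply: (le_trans h); rewrite ler_wpM2r//.
  apply: (@le_trans _ _ C).
    rewrite /C (bigD1 (Ordinal n2K))//= addrCA lerDl addr_ge0// sumr_ge0// => i _.
    by case: (hCb i).
  by rewrite ler_peMr// ler1n.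
case: n IH Kn Kn2 => // n IH Kn; rewrite ltnS => Kn2.
(* Error charged to a subtree of size i. Subtrees below K are charged to [r] instead, where they
   cancel to second order. *)
pose d i := if (K <= i)%N then C * i.+1%:R * T else 0.
have dP i theta' : (K <= i)%N -> (i <= n)%N ->
    `|E i (fun u => cos (t * Y u + theta')) - q t ^+ i.+1 * cos theta'| <= d i.
  by move=> Ki lein; rewrite /d Ki; apply: IH.
pose r U i := if (i < K)%N then rho i U t theta else 0.
pose Q := q t ^+ (n.+1 - K).
have term (i : 'I_n.+1) :
   `|E i (fun l => E (n - i) (fun r => cos (t * Y' l + t * Y r + theta)))
     - q t ^+ n.+2 * cos theta - Q * (r Y' i + r Y (n - i)%N)| <= d i + d (n - i)%N.
  have lein : (i <= n)%N by rewrite -ltnS.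
  have e' : (K <= i)%N -> forall th, E i (fun l => cos (t * Y' l + th)) = E i (fun l => cos (t * Y l + th)).
    by move=> Ki th; apply: eq_E => u ui; rewrite Y'_Y// ui.
  have [Kj|jK] := leqP K (n - i)%N.
    (* For fixed l this is the induction hypothesis at the phase t Y' l + theta. *)
    have step : `|E i (fun l => E (n - i) (fun r => cos (t * Y' l + t * Y r + theta)))
        - q t ^+ (n - i).+1 * E i (fun l => cos (t * Y' l + theta))| <= d (n - i)%N.
      rewrite -EZ -EB; apply: (le_trans (normr_E _ _)).
      rewrite -[leRHS](E_cst i); apply: le_E => l _.
      have := dP (n - i)%N (t * Y' l + theta) Kj (leq_subr _ _).
      congr (`|_ - _| <= _); apply: eq_E => u _; congr cos; ring.
    have rY : r Y (n - i)%N = 0 by rewrite /r ltnNge Kj.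
    rewrite rY addr0; have [Ki|iK] := leqP K i.
      rewrite /r ltnNge Ki /= mulr0 subr0.
      have h2 := dP i theta Ki lein; rewrite -e'// in h2.
      have -> : q t ^+ n.+2 = q t ^+ (n - i).+1 * q t ^+ i.+1.
        by rewrite -exprD; congr (_ ^+ _); lia.
      move: step; set a := E i _; set b := E i _ => step.
      rewrite (_ : a - _ = (a - q t ^+ (n - i).+1 * b) +
         q t ^+ (n - i).+1 * (b - q t ^+ i.+1 * cos theta)); last by ring.
      rewrite addrC; apply: (le_trans (ler_normD _ _)); rewrite addrC [leRHS]addrC.
      apply: lerD => //; rewrite normrM; apply: le_trans h2.
      by rewrite ler_piMl// ger0_norm; have /andP[] := qk (n - i).+1.
    have -> : d i = 0 by rewrite /d leqNgt iK.
    rewrite add0r /r iK /rho /Q.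
    have -> : q t ^+ n.+2 = q t ^+ (n.+1 - K) * q t ^+ K.+1.
      by rewrite -exprD; congr (_ ^+ _); lia.
    move: step; have -> : q t ^+ (n - i).+1 = q t ^+ (n.+1 - K) * q t ^+ (K - i).
      by rewrite -exprD; congr (_ ^+ _); lia.
    by congr (`|_| <= _); ring.
  have Ki : (K <= i)%N by lia.
  have -> : d (n - i)%N = 0 by rewrite /d leqNgt jK.
  have -> : r Y' i = 0 by rewrite /r ltnNge Ki.
  rewrite addr0 add0r /r jK /rho /Q E_fubini.
  have step : `|E (n - i) (fun r => E i (fun l => cos (t * Y' l + t * Y r + theta)))
        - q t ^+ i.+1 * E (n - i) (fun r => cos (t * Y r + theta))| <= d i.
    rewrite -EZ -EB; apply: (le_trans (normr_E _ _)).
    rewrite -[leRHS](E_cst (n - i)); apply: le_E => r' _.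
    have := dP i (t * Y r' + theta) Ki lein; rewrite -e'//.
    congr (`|_ - _| <= _); apply: eq_E => u _; congr cos; ring.
  have -> : q t ^+ n.+2 = q t ^+ (n.+1 - K) * q t ^+ K.+1.
    by rewrite -exprD; congr (_ ^+ _); lia.
  move: step; have -> : q t ^+ i.+1 = q t ^+ (n.+1 - K) * q t ^+ (K - (n - i)).
    by rewrite -exprD; congr (_ ^+ _); lia.
  by congr (`|_| <= _); ring.
have n0 : 0 < n.+1%:R :> R by rewrite ltr0n.
rewrite E_E2 -(ler_pM2r n0) -[X in _ * X]gtr0_norm// -normrM mulrBl /E2 divfK ?pnatr_eq0//.
rewrite (eq_bigr (fun i : 'I_n.+1 =>
   E i (fun l => E (n - i) (fun r => cos (t * Y' l + t * Y r + theta))))); last first.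
  move=> i _; apply: eq_E => l li; apply: eq_E => r' ri.
  rewrite (Y_node Kn2) ?mulrDr// li ri subnKC//; by rewrite -ltnS.
have Kn1 : (K <= n.+1)%N by lia.
have rsum : \sum_(i < n.+1) (r Y' i + r Y (n - i)%N) = \sum_(i < K) (rho i Y' t theta + rho i Y t theta).
  rewrite big_split /= (sum_rev_ord n (r Y)) -big_split /= (sumK (x := fun i => r Y' i + r Y i))//.
    by apply: eq_bigr => i _; rewrite /r ltn_ord.
  by move=> i Ki; rewrite /r ltnNge Ki addr0.
have h1 : `|\sum_(i < n.+1) (E i (fun l => E (n - i) (fun r => cos (t * Y' l + t * Y r + theta)))
     - q t ^+ n.+2 * cos theta - Q * (r Y' i + r Y (n - i)%N))| <= \sum_(i < n.+1) (d i + d (n - i)%N).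
  by apply: (le_trans (ler_norm_sum _ _ _)); apply: ler_sum => i _; exact: term.
have e1 : \sum_(i < n.+1) (E i (fun l => E (n - i) (fun r => cos (t * Y' l + t * Y r + theta)))
     - q t ^+ n.+2 * cos theta - Q * (r Y' i + r Y (n - i)%N)) =
   \sum_(i < n.+1) E i (fun l => E (n - i) (fun r => cos (t * Y' l + t * Y r + theta)))
     - q t ^+ n.+2 * cos theta * n.+1%:R
     - Q * \sum_(i < K) (rho i Y' t theta + rho i Y t theta).
  rewrite -rsum mulr_sumr !sumrB sumr_const card_ord.
  by rewrite -[(q t ^+ n.+2 * cos theta) *+ n.+1]mulr_natr.
rewrite e1 in h1.
(* As K > 0, d 0 = 0; each of the two sums thereby saves C T. These savings pay for the term with
   [rho], so the constant C does not grow along the induction. *)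
have dsum : \sum_(i < n.+1) (d i + d (n - i)%N) <= C * T * (n.+1%:R * n.+2%:R - 2).
  rewrite big_split /= (sum_rev_ord n d).
  have -> : \sum_(i < n.+1) d i = \sum_(0 <= i < n.+1) d i by rewrite big_mkord.
  have hd : \sum_(0 <= i < n.+1) d i <= C * T * ((\sum_(0 <= i < n.+1) i.+1%:R) - 1).
    rewrite !big_nat_recl//= addrAC subrr add0r {1}/d leqNgt K0 /= add0r mulr_sumr.
    apply: ler_sum => i _; rewrite /d; case: ifP => _; first by rewrite mulrAC.
    by rewrite !mulr_ge0.
  by rewrite sum_below in hd; lra.
have h2 : `|Q * \sum_(i < K) (rho i Y' t theta + rho i Y t theta)| <= C * T * 2.
  rewrite normrM; apply: (@le_trans _ _ (Cr * T)).
    apply: (@le_trans _ _ `|\sum_(i < K) (rho i Y' t theta + rho i Y t theta)|).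
      by rewrite ler_piMl// ger0_norm; have /andP[] := qk (n.+1 - K)%N.
    exact: hCr.
  have : Cr <= C by rewrite /C lerDl sumr_ge0// => i _; case: (hCb i).
  by move=> CrC; have := ler_wpM2r T0 CrC; have := mulr_ge0 C0 T0; lra.
have := le_trans (ler_normD _ _) (lerD (le_trans h1 dsum) h2).
rewrite subrK => /le_trans; apply.
by rewrite le_eqVlt; apply/orP; left; apply/eqP; ring.
Qed.

End truncated_char.

(** * Covariances for binary search trees *)

Section cross_moment.
Context {R : realType}.
Variables g g' : tree0 -> tree0 -> R.
Local Notation F := (fringe_sum g).
Local Notation F' := (fringe_sum g').

Lemma cross_rec n : n.+1%:R * E n.+1 (fun t => F t * F' t) =
  2 * \sum_(0 <= i < n.+1) E i (fun t => F t * F' t)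
  + 2 * \sum_(0 <= i < n.+1) mean_add g i * mean_add g' (n - i)
  + n.+1%:R * (E2 n (fun l r => g l r * g' l r)
     + E2 n (fun l r => g l r * (F' l + F' r)) + E2 n (fun l r => g' l r * (F l + F r))).
Proof.
rewrite E_E2 (eq_E2 (chi := fun l r => F l * F' l + F r * F' r + F l * F' r + F' l * F r
  + (g l r * g' l r + g l r * (F' l + F' r) + g' l r * (F l + F r)))); last first.
  by move=> l r _; rewrite !fringe_sum_node; ring.
have e : E2 n (fun l r => F' l * F r) = E2 n (fun l r => F l * F' r).
  rewrite !E2_prod; congr (_ / _).
  rewrite -(sum_rev_ord n (fun i => E i F' * E (n - i) F)); apply: eq_bigr => i _.
  by rewrite mulrC subKn// -ltnS.
rewrite !E2D e E2_left (E2_right n (fun r => F r * F' r)) E2_prod !big_mkord.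
rewrite /mean_add; set S1 := \sum_(i < n.+1) _; set S2 := \sum_(i < n.+1) _.
by nat_field.
Qed.

End cross_moment.

Section indicator_sums.
Context {R : realType}.
Implicit Types x : nat -> R.

Lemma sum_indic x m n : (m < n)%N -> \sum_(0 <= i < n) x i * (i == m)%:R = x m.
Proof.
move=> mn; rewrite big_mkord (bigD1 (Ordinal mn))//= eqxx mulr1 big1 ?addr0// => i im.
by rewrite (_ : (i == m :> nat) = false) ?mulr0//; apply/negbTE; rewrite -val_eqE in im.
Qed.

Lemma sum_indic_lt x m n : (m <= n)%N ->
  \sum_(0 <= i < n) x i * (i < m)%:R = \sum_(0 <= i < m) x i.
Proof.
move=> mn; rewrite (big_nat_widen 0 m n)// [RHS]big_mkcond /=.
by apply: eq_bigr => i _; case: ltnP => _; rewrite ?mulr1 ?mulr0.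
Qed.

(** Differencing the convolution moves the difference onto y, which is constant where y is linear;
    only a few exceptional indices remain. *)
Lemma convolution_diff x (y : nat -> R) n : y 0%N = 0 ->
  \sum_(0 <= i < n.+2) x i * y (n.+1 - i)%N - \sum_(0 <= i < n.+1) x i * y (n - i)%N
  = \sum_(0 <= i < n.+1) x i * (y (n - i).+1 - y (n - i)%N).
Proof.
move=> y0; rewrite big_nat_recr//= subnn y0 mulr0 addr0 -sumrB.
by apply: eq_big_nat => i /andP[_ lei]; rewrite subSn// mulrBr.
Qed.

End indicator_sums.

Section bst_recurrence.
Context {R : realType}.
Implicit Types (k m n : nat) (a b : R).

Definition bst_mean k a n : R :=
  if (n < k)%N then 0 else if n == k then a else n.+1%:R * (2 * a / (k.+1 * k.+2)%:R).

Lemma bst_mean_lt k a n : (n < k)%N -> bst_mean k a n = 0.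
Proof. by rewrite /bst_mean => ->. Qed.

Lemma bst_mean_eq k a : bst_mean k a k = a.
Proof. by rewrite /bst_mean ltnn eqxx. Qed.

Lemma bst_mean_gt k a n : (k < n)%N -> bst_mean k a n = n.+1%:R * (2 * a / (k.+1 * k.+2)%:R).
Proof. by move=> kn; rewrite /bst_mean ltnNge (ltnW kn)/= gtn_eqF. Qed.

Lemma sum_bst_mean k a n : (k <= n)%N ->
  \sum_(0 <= i < n.+1) bst_mean k a i = a / (k.+1 * k.+2)%:R * (n.+1%:R * n.+2%:R).
Proof.
elim: n => [|n IH] kn.
  move: kn; rewrite leqn0 => /eqP->; rewrite big_nat1 bst_mean_eq.
  by field.
have [nk|nk] := ltnP n k.
  have -> : k = n.+1 by lia.
  rewrite big_nat_recr//= big_nat_cond big1 => [|i /andP[/andP[_ lti] _]]; last exact: bst_mean_lt.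
  by rewrite bst_mean_eq add0r natrM mulfVK// mulf_neq0// pnatr_eq0.
rewrite big_nat_recr//= IH// bst_mean_gt//.
by rewrite !natrM; nat_field.
Qed.

Lemma bst_mean_convolution_diff k m a b j : (0 < m)%N -> (k + m + 2 <= j)%N ->
  \sum_(0 <= i < j.+1) bst_mean k a i * bst_mean m b (j - i)
  - \sum_(0 <= i < j) bst_mean k a i * bst_mean m b (j.-1 - i)
  = (2 * a / (k.+1 * k.+2)%:R) * (2 * b / (m.+1 * m.+2)%:R) * (j.+1%:R * j.+2%:R / 2).
Proof.
case: j => [|j] m0 kmj; first by lia.
rewrite convolution_diff; last exact: bst_mean_lt.
set c := 2 * a / _; set c' := 2 * b / _.
rewrite (eq_big_nat _ _ (F2 := fun i => (bst_mean k a i * b) * (i == (j.+1 - m)%N)%:R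
   + (bst_mean k a i * (c' * m.+2%:R - b)) * (i == (j - m)%N)%:R
   + (bst_mean k a i * c') * (i < j - m)%N%:R)).
  rewrite !big_split /= !sum_indic ?sum_indic_lt; [|lia|lia|lia].
  rewrite -mulr_suml.
  have [u eu] : exists u, j = (u + m.+1)%N by exists (j - m.+1)%N; lia.
  have -> : (j - m = u.+1)%N by lia.
  have -> : (j.+1 - m = u.+2)%N by lia.
  rewrite sum_bst_mean; last by lia.
  rewrite !bst_mean_gt; [|lia|lia].
  have -> : a / (k.+1 * k.+2)%:R = c / 2 by rewrite /c natrM; nat_field.
  have -> : b = c' * (m.+1%:R * m.+2%:R / 2).
    by rewrite /c' natrM; nat_field.
  rewrite -/c eu (_ : (u + m.+1 = (u + m).+1)%N); last by lia.
  by rewrite -!natr1 natrD; field.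
move=> i /andP[_ lti].
case: (ltngtP i (j - m)%N) => [ij|ji|ij].
- have -> : (i == (j.+1 - m)%N) = false by lia.
  rewrite !mulr0 !add0r mulr1; congr (_ * _).
  rewrite !bst_mean_gt; [|lia|lia].
  by rewrite -/c' -natr1; ring.
- rewrite !mulr0 !addr0; case: eqVneq => [eij|nij].
    rewrite mulr1; congr (_ * _); rewrite (_ : (j - i).+1 = m); last by lia.
    by rewrite bst_mean_eq bst_mean_lt ?subr0//; lia.
  by rewrite !(@bst_mean_lt m b) ?subrr ?mulr0 ?mul0r//; lia.
- have -> : (i == (j.+1 - m)%N) = false by lia.
  rewrite !mulr0 addr0 add0r mulr1; congr (_ * _).
  rewrite (_ : (j - i)%N = m); last by lia.
  rewrite bst_mean_eq bst_mean_gt; last by lia.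
  by rewrite -/c'; ring.
Qed.

(** The convolution C vanishes below k + m, so S is linear from k + 1 to k + m. The values at k + m
    and k + m + 1 are irregular and produce [beta_bst]. From k + m + 2 on the increments of C follow
    one polynomial, S is quadratic, and its leading part c c' (n + 1)^2 is exactly the product of
    the means. *)
Lemma bst_recurrence (S : nat -> R) k m a b P n : (0 < m)%N -> (m <= k)%N ->
  (forall j, (j < k)%N -> S j = 0) -> S k = P ->
  (forall j, (k <= j)%N -> j.+1%:R * S j.+1 = 2 * \sum_(0 <= i < j.+1) S i
     + 2 * \sum_(0 <= i < j.+1) bst_mean k a i * bst_mean m b (j - i)) ->
  (k + m + 2 <= n)%N ->
  S n - bst_mean k a n * bst_mean m b n =
  n.+1%:R * (2 / ((k + 1) * (k + 2))%N%:R * P - beta_bst k m * a * b).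
Proof.
move=> m0 mk S0 Sk rec0.
have [C CE] : exists C : nat -> R, forall j, C j =
  \sum_(0 <= i < j.+1) bst_mean k a i * bst_mean m b (j - i) by eexists.
have rec j : (k <= j)%N -> j.+1%:R * S j.+1 = 2 * \sum_(0 <= i < j.+1) S i + 2 * C j.
  by move=> kj; rewrite rec0// CE.
have step j : (k < j)%N -> j.+1%:R * S j.+1 = j.+2%:R * S j + 2 * (C j - C j.-1).
  case: j => [//|j] kj; rewrite (rec _ (ltnW kj)) big_nat_recr//= mulrDr.
  by have := rec j kj; rewrite -[j.+3%:R]natr1 -[j.+2%:R]natr1 -natr1; lra.
have C0 j : (j < k + m)%N -> C j = 0.
  move=> jkm; rewrite CE big_nat_cond big1// => i /andP[/andP[_ lti] _].
  have [ik|ki] := ltnP i k; first by rewrite bst_mean_lt ?mul0r.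
  by rewrite [X in _ * X]bst_mean_lt ?mulr0//; lia.
have Ckm : C (k + m)%N = a * b.
  rewrite CE (eq_big_nat _ _ (F2 := fun i => (a * b) * (i == k)%:R)).
    by rewrite sum_indic//; lia.
  move=> i /andP[_ lti]; case: (ltngtP i k) => [ik|ki|->].
  - by rewrite bst_mean_lt// mul0r mulr0.
  - by rewrite [X in _ * X]bst_mean_lt ?mulr0//; lia.
  - by rewrite addKn !bst_mean_eq mulr1.
set c := 2 * a / (k.+1 * k.+2)%:R; set c' := 2 * b / (m.+1 * m.+2)%:R.
have Ck1 : C (k + m).+1 = a * (c' * m.+2%:R) + c * k.+2%:R * b.
  rewrite CE (eq_big_nat _ _ (F2 := fun i => (a * (c' * m.+2%:R)) * (i == k)%:R
     + (c * k.+2%:R * b) * (i == k.+1)%:R)).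
    by rewrite big_split /= !sum_indic//; lia.
  move=> i /andP[_ lti]; case: (ltngtP i k) => [ik|ki|->].
  - rewrite bst_mean_lt// mul0r mulr0 (_ : (i == k.+1) = false) ?mulr0 ?addr0//; lia.
  - rewrite mulr0 add0r; case: eqVneq => [->|ik].
      rewrite mulr1 subSS addKn bst_mean_eq bst_mean_gt//.
      by rewrite -/c [c * _]mulrC.
    by rewrite [X in _ * X]bst_mean_lt ?mulr0//; lia.
  - rewrite mulr1 (_ : (k == k.+1) = false) ?mulr0 ?addr0; last by lia.
    rewrite subSn ?leq_addr// addKn bst_mean_eq bst_mean_gt//.
    by rewrite -/c' [c' * _]mulrC.
have dC j : (k + m + 2 <= j)%N -> C j - C j.-1 = c * c' * (j.+1%:R * j.+2%:R / 2).
  move=> kmj; rewrite !CE prednK; last by lia.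
  exact: bst_mean_convolution_diff.
have SA j : (k < j)%N -> (j <= k + m)%N -> S j = j.+1%:R * (2 * P / (k.+1 * k.+2)%:R).
  elim: j => [//|j IH] kj jkm; move: kj; rewrite ltnS leq_eqVlt => /predU1P[ekj|kj].
    have := rec j; rewrite -ekj leqnn => /(_ isT); rewrite C0; last by lia.
    rewrite big_nat_recr//= big_nat_cond big1; last by move=> i /andP[/andP[_ /S0]].
    rewrite add0r mulr0 addr0 Sk => h.
    have -> : S k.+1 = 2 * P / k.+1%:R by rewrite -h mulrC mulKf// pnatr_eq0.
    by rewrite natrM; nat_field.
  have := step j kj; rewrite IH//; last exact: ltnW.
  rewrite !C0; [|lia|lia]; rewrite subr0 mulr0 addr0 => h.
  apply: (mulfI (_ : j.+1%:R != 0 :> R)); first by rewrite pnatr_eq0.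
  by rewrite h; ring.
have SB : (k + m).+1%:R * S (k + m).+1 = (k + m).+2%:R * S (k + m)%N + 2 * (a * b).
  rewrite step; last by lia.
  by rewrite Ckm C0 ?subr0//; lia.
have SC : (k + m).+2%:R * S (k + m).+2 = (k + m).+3%:R * S (k + m).+1
    + 2 * (a * (c' * m.+2%:R) + c * k.+2%:R * b - a * b).
  rewrite step; last by lia.
  by rewrite Ck1 Ckm.
set W := 2 / ((k + 1) * (k + 2))%N%:R * P - beta_bst k m * a * b.
have S2 : S (k + m).+2 = c * c' * (k + m).+3%:R ^+ 2 + (k + m).+3%:R * W.
  apply: (mulfI (_ : (k + m).+2%:R != 0 :> R)); first by rewrite pnatr_eq0.
  have ekm1 : S (k + m).+1 = ((k + m).+2%:R * S (k + m)%N + 2 * (a * b)) / (k + m).+1%:R.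
    by rewrite -SB mulrC mulKf// pnatr_eq0.
  rewrite SC ekm1 SA; [|lia|lia].
  rewrite /W /c /c' /beta_bst.
  rewrite (_ : (k ^ 2 + 3 * k * m + m ^ 2 + 4 * k + 4 * m + 3)%N%:R =
     k%:R ^+ 2 + 3 * k%:R * m%:R + m%:R ^+ 2 + 4 * k%:R + 4 * m%:R + 3 :> R); last first.
    by rewrite -!mulnn !natrD !natrM; ring.
  rewrite !addn1 !addn2 !addn3.
  have := ler0n R k; have := ler0n R m.
  rewrite !natrM -[(k + m).+3%:R]natr1 -[(k + m).+2%:R]natr1 -[(k + m).+1%:R]natr1.
  rewrite -[k.+2%:R]natr1 -[k.+1%:R]natr1 -[m.+2%:R]natr1 -[m.+1%:R]natr1 !natrD.
  move: (k%:R) (m%:R) => x y y0 x0.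
  by field; do ?[apply/andP; split]; apply: lt0r_neq0; lra.
have main j : (k + m + 2 <= j)%N -> S j = c * c' * j.+1%:R ^+ 2 + j.+1%:R * W.
  elim: j => [|j IH] kmj; first by lia.
  move: kmj; rewrite leq_eqVlt => /predU1P[e|kmj].
    by have -> : j.+1 = (k + m).+2 by lia.
  apply: (mulfI (_ : j.+1%:R != 0 :> R)); first by rewrite pnatr_eq0.
  rewrite step; last by lia.
  rewrite dC; last by lia.
  rewrite IH; last by lia.
  by rewrite -!natr1; field.
move=> kmn; rewrite main// !bst_mean_gt; [|lia|lia].
by rewrite -/c -/c'; ring.
Qed.

End bst_recurrence.

Section bst_covariance.
Context {R : realType}.
Variable f : btree -> R.

Definition bst_toll k (l r : tree0) : R :=
  if (size0 l + size0 r).+1 == k then f (BNode l r) else 0.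
Local Notation F k := (fringe_sum (bst_toll k)).
Local Notation M k := (mean_add (bst_toll k)).
Local Notation alpha k := (E k (oapp f 0)).

Lemma fringe_sum_small k t : (size0 t < k)%N -> F k t = 0.
Proof.
elim/tree0_ind: t => [//|l r IHl IHr]; rewrite size_node fringe_sum_node => lt.
rewrite IHl ?IHr; [|lia|lia]; rewrite /bst_toll ifN ?addr0//; lia.
Qed.

Lemma fringe_sum_size t : F (size0 t) t = oapp f 0 t.
Proof.
case: t => [[l r]|//]; rewrite -[Some _]/(node l r) fringe_sum_node !fringe_sum_small.
- by rewrite !addr0 /bst_toll eqxx.
- by rewrite size_node; lia.
- by rewrite size_node; lia.
Qed.

Lemma mean_bst_toll k n : (0 < k)%N ->
  mean_toll (bst_toll k) n = if n == k then alpha k else 0.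
Proof.
case: k => // k _; case: n => [//|n] /=; rewrite eqSS; case: eqP => [->|nk].
  by rewrite [RHS]E_E2; apply: eq_E2 => l r lr; rewrite /bst_toll lr eqxx.
by rewrite -[RHS](E2_cst n); apply: eq_E2 => l r lr; rewrite /bst_toll lr ifN// eqSS; apply/eqP.
Qed.

Lemma mean_bst k n : (0 < k)%N -> M k n = bst_mean k (alpha k) n.
Proof.
move=> k0; rewrite mean_addE mean_bst_toll// /bst_mean.
have [nk|kn] := ltnP n k.
  rewrite ltn_eqF// add0r big_nat_cond big1 ?mulr0// => i /andP[/andP[_ lti] _].
  by rewrite mean_bst_toll// ltn_eqF ?mulr0//; exact: ltn_trans nk.
rewrite (eq_bigr (fun i => qweight i * alpha k * (i == k)%:R)); last first.
  by move=> i _; rewrite mean_bst_toll//; case: eqP => [->|_]; rewrite ?mulr1 ?mulr0.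
case: eqVneq kn => [->|nk] kn.
  rewrite big_nat_cond big1 ?mulr0 ?addr0// => i /andP[/andP[_ lti] _].
  by rewrite ltn_eqF// mulr0.
rewrite add0r sum_indic; last by rewrite ltn_neqAle eq_sym nk.
by rewrite /qweight; ring.
Qed.

Lemma bst_cross k m n : (0 < m)%N -> (m <= k)%N -> (k + m + 2 <= n)%N ->
  E n (fun t => F k t * F m t) - M k n * M m n =
  n.+1%:R * (2 / ((k + 1) * (k + 2))%N%:R * E k (fun t => oapp f 0 t * F m t)
    - beta_bst k m * alpha k * alpha m).
Proof.
move=> m0 mk kmn; have k0 : (0 < k)%N by exact: leq_trans mk.
rewrite !mean_bst//.
apply: (@bst_recurrence _ (fun n => E n (fun t => F k t * F m t))) => //.
- move=> j jk; rewrite -[RHS](E_cst j); apply: eq_E => t tj.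
  by rewrite fringe_sum_small ?mul0r ?tj.
- by apply: eq_E => t tk; rewrite -tk fringe_sum_size.
move=> j kj; rewrite cross_rec.
under [X in _ + 2 * X + _]eq_bigr do rewrite !mean_bst//.
rewrite -[RHS]addr0; congr (_ + _).
have z1 (H : tree0 -> tree0 -> R) : E2 j (fun l r => bst_toll k l r * H l r) = 0.
  rewrite -[RHS](E2_cst j); apply: eq_E2 => l r lr.
  by rewrite /bst_toll lr ifN ?mul0r// gtn_eqF.
have z2 (H : tree0 -> tree0 -> R) : E2 j (fun l r => bst_toll m l r * H l r) = 0.
  rewrite -[RHS](E2_cst j); apply: eq_E2 => l r lr.
  by rewrite /bst_toll lr ifN ?mul0r// gtn_eqF// ltnS (leq_trans mk).
by rewrite !z1 z2 !addr0 mulr0.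
Qed.

End bst_covariance.

(** * Covariances for recursive trees *)

Section rrt_recurrence.
Context {R : realType}.
Implicit Types (k m n : nat) (a b : R).

Definition rrt_mean k a n : R := if (n < k)%N then 0 else n.+1%:R * (a / (k * k.+1)%:R).

Lemma rrt_mean_lt k a n : (n < k)%N -> rrt_mean k a n = 0.
Proof. by rewrite /rrt_mean => ->. Qed.

Lemma rrt_mean_ge k a n : (k <= n)%N -> rrt_mean k a n = n.+1%:R * (a / (k * k.+1)%:R).
Proof. by rewrite /rrt_mean leqNgt => /negbTE->. Qed.

Lemma sum_rrt_mean k a n : (k <= n)%N ->
  \sum_(0 <= i < n) rrt_mean k a i =
  a / (k * k.+1)%:R * ((n%:R * n.+1%:R - k%:R * k.+1%:R) / 2).
Proof.
elim: n => [|n IH] kn.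
  by move: kn; rewrite leqn0 => /eqP->; rewrite big_geq// subrr mul0r mulr0.
have [nk|nk] := ltnP n k.
  have -> : k = n.+1 by lia.
  rewrite big_nat_cond big1 => [|i /andP[/andP[_ lti] _]]; last exact: rrt_mean_lt.
  by rewrite subrr mul0r mulr0.
rewrite big_nat_recr//= IH// rrt_mean_ge//.
set c := a / _; rewrite -[n.+2%:R]natr1 -[n.+1%:R]natr1.
by field.
Qed.

Lemma rrt_mean_convolution_diff k m a b j : (0 < m)%N -> (k + m <= j)%N ->
  \sum_(0 <= i < j.+1) rrt_mean k a i * rrt_mean m b (j - i)
  - \sum_(0 <= i < j) rrt_mean k a i * rrt_mean m b (j.-1 - i)
  = (a / (k * k.+1)%:R) * (b / (m * m.+1)%:R) *
    ((j.+1%:R * j.+2%:R - k%:R * k.+1%:R - m%:R * m.+1%:R) / 2).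
Proof.
case: j => [|j] m0 kmj; first by lia.
rewrite convolution_diff; last exact: rrt_mean_lt.
set c := a / _; set c' := b / _.
rewrite (eq_big_nat _ _ (F2 := fun i => (rrt_mean k a i * (c' * m.+1%:R)) * (i == (j.+1 - m)%N)%:R
   + (rrt_mean k a i * c') * (i < j.+1 - m)%N%:R)).
  rewrite big_split /= sum_indic ?sum_indic_lt; [|lia|lia].
  rewrite -mulr_suml.
  have [u eu] : exists u, j.+1 = (u + m)%N by exists (j.+1 - m)%N; lia.
  have -> : (j.+1 - m = u)%N by lia.
  rewrite sum_rrt_mean; last by lia.
  rewrite rrt_mean_ge; last by lia.
  rewrite -/c eu.
  by rewrite -!natr1 natrD; field.
move=> i /andP[_ lti].
case: (ltngtP i (j.+1 - m)%N) => [ij|ji|ij].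
- rewrite mulr0 add0r mulr1; congr (_ * _).
  rewrite !rrt_mean_ge; [|lia|lia].
  by rewrite -/c' -natr1; ring.
- rewrite !mulr0 addr0; by rewrite !(@rrt_mean_lt m b) ?subrr ?mulr0//; lia.
- rewrite mulr0 addr0 mulr1; congr (_ * _).
  rewrite (_ : (j - i).+1 = m); last by lia.
  rewrite [X in _ - X]rrt_mean_lt; last by lia.
  rewrite rrt_mean_ge// -/c' subr0; ring.
Qed.

(** The scheme of [bst_recurrence], with tolls that persist at all large sizes: in a tree of size j
    + 1 the left subtree has size k - 1 with probability 1 / (j + 1). The means are linear from k on
    without an exceptional value, so the regular regime starts already at k + m. *)
Lemma rrt_recurrence (S : nat -> R) k m a b P n : (0 < m)%N -> (m <= k)%N ->
  (forall j, (j < k)%N -> S j = 0) ->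
  (forall j, (k <= j.+1)%N -> j.+1%:R * S j.+1 = 2 * \sum_(0 <= i < j.+1) S i
     + 2 * (\sum_(0 <= i < j.+1) rrt_mean k a i * rrt_mean m b (j - i))
     + (P + a * rrt_mean m b (j.+1 - k) + b * rrt_mean k a (j.+1 - m))) ->
  (k + m <= n)%N ->
  S n - rrt_mean k a n * rrt_mean m b n =
  n.+1%:R * (1 / (k * (k + 1))%N%:R * P - beta_rrt k m * a * b).
Proof.
move=> m0 mk S0 rec0.
have k0 : (0 < k)%N by exact: leq_trans mk.
have [D DE] : exists D : nat -> R, forall j, D j =
  2 * (\sum_(0 <= i < j.+1) rrt_mean k a i * rrt_mean m b (j - i))
  + a * rrt_mean m b (j.+1 - k) + b * rrt_mean k a (j.+1 - m) by eexists.
have rec j : (k <= j.+1)%N -> j.+1%:R * S j.+1 = 2 * \sum_(0 <= i < j.+1) S i + P + D j.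
  by move=> kj; rewrite rec0// DE; ring.
have step j : (k <= j)%N -> j.+1%:R * S j.+1 = j.+2%:R * S j + (D j - D j.-1).
  case: j => [|j] kj; first by lia.
  rewrite (rec _ (leqW kj)) big_nat_recr//= mulrDr.
  by have := rec j kj; rewrite -[j.+3%:R]natr1 -[j.+2%:R]natr1 -natr1; lra.
have conv0 j : (j < k + m)%N ->
    \sum_(0 <= i < j.+1) rrt_mean k a i * rrt_mean m b (j - i) = 0.
  move=> jkm; rewrite big_nat_cond big1// => i /andP[/andP[_ lti] _].
  have [ik|ki] := ltnP i k; first by rewrite rrt_mean_lt ?mul0r.
  by rewrite [X in _ * X]rrt_mean_lt ?mulr0//; lia.
have D0 j : (j.+1 < k + m)%N -> D j = 0.
  move=> jkm; rewrite DE conv0; last by lia.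
  by rewrite !rrt_mean_lt ?mulr0 ?addr0//; lia.
set c := a / (k * k.+1)%:R; set c' := b / (m * m.+1)%:R.
have D1 : D (k + m).-1 = a * (m.+1%:R * c') + b * (k.+1%:R * c).
  rewrite DE conv0; last by lia.
  rewrite prednK; last by lia.
  by rewrite addKn addnK !rrt_mean_ge// mulr0 add0r.
have dD j : (k + m <= j)%N -> D j - D j.-1 = c * c' * (j.+1%:R * j.+2%:R).
  move=> kmj; rewrite !DE prednK; last by lia.
  have := @rrt_mean_convolution_diff k m a b j m0 kmj; rewrite -/c -/c'.
  have d1 : rrt_mean m b (j.+1 - k) - rrt_mean m b (j - k) = c'.
    rewrite !rrt_mean_ge; [|lia|lia].
    rewrite -/c' (_ : (j.+1 - k).+1 = ((j - k).+1 + 1)%N); last by lia.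
    by rewrite natrD; ring.
  have d2 : rrt_mean k a (j.+1 - m) - rrt_mean k a (j - m) = c.
    rewrite !rrt_mean_ge; [|lia|lia].
    rewrite -/c (_ : (j.+1 - m).+1 = ((j - m).+1 + 1)%N); last by lia.
    by rewrite natrD; ring.
  have ea : a = c * (k%:R * k.+1%:R).
    by rewrite /c -natrM divfK// pnatr_eq0 muln_eq0 negb_or -lt0n k0.
  have eb : b = c' * (m%:R * m.+1%:R).
    by rewrite /c' -natrM divfK// pnatr_eq0 muln_eq0 negb_or -lt0n m0.
  set s1 := \sum_(0 <= i < j.+1) _; set s2 := \sum_(0 <= i < j) _ => e.
  transitivity (2 * (s1 - s2) + a * c' + b * c); first by rewrite -d1 -d2; ring.
  by rewrite e {1}ea {1}eb; field.
have SA j : (k <= j)%N -> (j < k + m)%N -> S j = j.+1%:R * (P / (k * k.+1)%:R).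
  elim: j => [|j IH] kj jkm; first by lia.
  move: kj; rewrite leq_eqVlt => /predU1P[ekj|kj].
    have := rec j; rewrite -ekj leqnn => /(_ isT); rewrite D0; last by lia.
    rewrite big_nat_cond big1; last by move=> i /andP[/andP[_ /S0]].
    rewrite mulr0 add0r addr0 => h.
    have -> : S k = P / k%:R by rewrite -h mulrC mulKf// pnatr_eq0 -lt0n.
    rewrite natrM; field.
    have : 0 < k%:R :> R by rewrite ltr0n.
    by move=> kp; apply/andP; split; apply: lt0r_neq0; lra.
  have := step j kj; rewrite IH//; last exact: ltnW.
  rewrite !D0; [|lia|lia]; rewrite subr0 addr0 => h.
  apply: (mulfI (_ : j.+1%:R != 0 :> R)); first by rewrite pnatr_eq0.
  by rewrite h; ring.
set W := 1 / (k * (k + 1))%N%:R * P - beta_rrt k m * a * b.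
have S1 : S (k + m)%N = c * c' * (k + m).+1%:R ^+ 2 + (k + m).+1%:R * W.
  apply: (mulfI (_ : (k + m)%:R != 0 :> R)); first by rewrite pnatr_eq0; lia.
  have ekm : (k + m)%N = (k + m).-1.+1 by rewrite prednK//; lia.
  have := step (k + m).-1; rewrite -ekm => ->; last by lia.
  rewrite D1 D0; last by lia.
  rewrite subr0 SA; [|lia|lia]; rewrite -ekm.
  rewrite /W /c /c' /beta_rrt.
  rewrite (_ : (k ^ 2 + k * m + m ^ 2 + k + m)%N%:R =
     k%:R ^+ 2 + k%:R * m%:R + m%:R ^+ 2 + k%:R + m%:R :> R); last first.
    by rewrite -!mulnn !natrD !natrM; ring.
  rewrite !addn1.
  have := ler0n R k; have := ler0n R m.
  have kp : 0 < k%:R :> R by rewrite ltr0n.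
  have mp : 0 < m%:R :> R by rewrite ltr0n.
  rewrite !natrM -[(k + m).+1%:R]natr1.
  rewrite -[k.+1%:R]natr1 -[m.+1%:R]natr1 !natrD.
  move: (k%:R) (m%:R) kp mp => x y kp mp y0 x0.
  by field; do ?[apply/andP; split]; apply: lt0r_neq0; lra.
have main j : (k + m <= j)%N -> S j = c * c' * j.+1%:R ^+ 2 + j.+1%:R * W.
  elim: j => [|j IH] kmj; first by lia.
  move: kmj; rewrite leq_eqVlt => /predU1P[<-//|kmj].
  apply: (mulfI (_ : j.+1%:R != 0 :> R)); first by rewrite pnatr_eq0.
  rewrite step; last by lia.
  rewrite dD; last by lia.
  rewrite IH; last by lia.
  by rewrite -!natr1; field.
move=> kmn; rewrite main// !rrt_mean_ge; [|lia|lia].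
by rewrite -/c -/c'; ring.
Qed.

End rrt_recurrence.

Section rrt_covariance.
Context {R : realType}.
Variable h : tree0 -> R.

(* In the left child, right sibling encoding a node with left subtree [l] stands
   for a node whose fringe subtree is [rtree l]. *)
Definition rrt_toll k (l r : tree0) : R := if (size0 l).+1 == k then h l else 0.
Local Notation F k := (fringe_sum (rrt_toll k)).
Local Notation M k := (mean_add (rrt_toll k)).
Local Notation alpha k := (E k.-1 h).

Lemma rrt_fringe_sum_small k t : (size0 t < k)%N -> F k t = 0.
Proof.
elim/tree0_ind: t => [//|l r IHl IHr]; rewrite size_node fringe_sum_node => lt.
rewrite IHl ?IHr; [|lia|lia]; rewrite /rrt_toll ifN ?addr0//; lia.
Qed.

Lemma E2_rrt_toll k n (phi : tree0 -> tree0 -> R) : (0 < k)%N -> (k <= n.+1)%N ->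
  n.+1%:R * E2 n (fun l r => rrt_toll k l r * phi l r)
  = E k.-1 (fun l => h l * E (n.+1 - k) (fun r => phi l r)).
Proof.
case: k => // k _; rewrite ltnS => kn; rewrite /E2 mulrC divfK ?pnatr_eq0//.
have kn' : (k < n.+1)%N by rewrite ltnS.
rewrite (bigD1 (Ordinal kn'))//= big1 ?addr0.
  by apply: eq_E => l lk; rewrite subSS -EZ; apply: eq_E => r _; rewrite /rrt_toll lk eqxx.
move=> i; rewrite -val_eqE /= => ik; rewrite -[RHS](E_cst i); apply: eq_E => l li.
rewrite -[RHS](E_cst (n - i)); apply: eq_E => r _.
by rewrite /rrt_toll li eqSS (negbTE ik) mul0r.
Qed.

Lemma mean_rrt_toll k n : (0 < k)%N ->
  mean_toll (rrt_toll k) n = if (n < k)%N then 0 else alpha k / n%:R.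
Proof.
move=> k0; case: n => [|n] /=; first by rewrite k0.
case: ltnP => nk.
  by rewrite -[RHS](E2_cst n); apply: eq_E2 => l r lr; rewrite /rrt_toll ifN//; lia.
apply: (mulfI (_ : n.+1%:R != 0 :> R)); first by rewrite pnatr_eq0.
have := @E2_rrt_toll k n (fun _ _ => 1) k0 nk.
under eq_E2 => l r _ do rewrite mulr1.
move=> ->; rewrite [RHS]mulrC divfK ?pnatr_eq0//.
by apply: eq_E => l _; rewrite E_cst mulr1.
Qed.

Lemma mean_rrt k n : (0 < k)%N -> M k n = rrt_mean k (alpha k) n.
Proof.
move=> k0; rewrite mean_addE mean_rrt_toll// /rrt_mean.
case: ltnP => nk.
  rewrite add0r big_nat_cond big1 ?mulr0// => i /andP[/andP[_ lti] _].
  by rewrite mean_rrt_toll// (ltn_trans lti nk) mulr0.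
(* For i >= k the summand is alpha / (i (i + 1) (i + 2)), which telescopes. *)
have -> : \sum_(0 <= i < n) qweight i * mean_toll (rrt_toll k) i =
   alpha k / 2 * ((k%:R * k.+1%:R)^-1 - (n%:R * n.+1%:R)^-1).
  elim: n nk => [|n IH] nk; first by lia.
  move: nk; rewrite leq_eqVlt => /predU1P[->|nk].
    rewrite subrr mulr0 big_nat_cond big1// => i /andP[/andP[_ lti] _].
    by rewrite mean_rrt_toll// lti mulr0.
  rewrite big_nat_recr//= IH// mean_rrt_toll// ltnNge (nk : (k <= n)%N) /= /qweight natrM.
  have np : 0 < n%:R :> R by rewrite ltr0n; lia.
  have kp : 0 < k%:R :> R by rewrite ltr0n.
  by field; do ?[apply/andP; split]; apply: lt0r_neq0; lra.
have np : 0 < n%:R :> R by rewrite ltr0n; lia.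
have kp : 0 < k%:R :> R by rewrite ltr0n.
rewrite natrM.
by field; do ?[apply/andP; split]; apply: lt0r_neq0; lra.
Qed.

(** [F m t] ranges over the proper fringe subtrees of [rtree t]. The indicator of k = m adds the
    whole tree, so the bracket is the sum over all its fringe subtrees of size m. *)
Lemma rrt_cross k m n : (0 < m)%N -> (m <= k)%N -> (k + m <= n)%N ->
  E n (fun t => F k t * F m t) - M k n * M m n =
  n.+1%:R * (1 / (k * (k + 1))%N%:R *
      E k.-1 (fun t => h t * ((k == m)%:R * h t + F m t))
    - beta_rrt k m * alpha k * alpha m).
Proof.
move=> m0 mk kmn; have k0 : (0 < k)%N by exact: leq_trans mk.
rewrite !mean_rrt//.
apply: (@rrt_recurrence _ (fun n => E n (fun t => F k t * F m t))) => //.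
  move=> j jk; rewrite -[RHS](E_cst j); apply: eq_E => t tj.
  by rewrite rrt_fringe_sum_small ?mul0r ?tj.
move=> j kj; rewrite cross_rec.
under [X in _ + 2 * X + _]eq_bigr do rewrite !mean_rrt//.
congr (_ + _); rewrite !mulrDr !E2_rrt_toll//; last exact: leq_trans kj.
have e1 : E k.-1 (fun l => h l * E (j.+1 - k) (fun r => rrt_toll m l r)) =
    E k.-1 (fun t => h t * ((k == m)%:R * h t)).
  apply: eq_E => l lk; rewrite /rrt_toll lk prednK// E_cst.
  by case: eqP; rewrite ?mul1r ?mul0r.
have e2 : E k.-1 (fun l => h l * E (j.+1 - k) (fun r => F m l + F m r)) =
    E k.-1 (fun t => h t * F m t) + alpha k * rrt_mean m (alpha m) (j.+1 - k).
  rewrite -EZr -ED; apply: eq_E => l lk; rewrite ED E_cst -mean_rrt// -/(M m _).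
  by rewrite mulrDr.
have e3 : E m.-1 (fun l => h l * E (j.+1 - m) (fun r => F k l + F k r)) =
    alpha m * rrt_mean k (alpha k) (j.+1 - m).
  rewrite -EZr; apply: eq_E => l lk; rewrite ED E_cst -mean_rrt// rrt_fringe_sum_small ?add0r//.
  by rewrite lk prednK.
rewrite e1 e2 e3.
have -> : E k.-1 (fun t => h t * ((k == m)%:R * h t + F m t)) =
   E k.-1 (fun t => h t * ((k == m)%:R * h t)) + E k.-1 (fun t => h t * F m t).
  by rewrite -ED; apply: eq_E => t _; rewrite mulrDr.
by rewrite !addrA.
Qed.

End rrt_covariance.

(** * Approximation by truncated tolls *)

Section limits.
Context {R : realType}.

Lemma cos_lip (x y : R) : `|cos x - cos y| <= `|x - y|.
Proof.
wlog xy : x y / x < y => [h|].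
  case: (ltgtP x y) => [|yx|->]; [exact: h| |by rewrite !subrr].
  by rewrite distrC [leRHS]distrC h.
have [|c _ e] := @MVT R cos (fun z => - sin z) x y xy (fun z _ => is_derive_cos z).
  by apply: continuous_subspaceT => z; exact: continuous_cos.
rewrite distrC e normrM normrN [leRHS]distrC ler_piMl// ler_norml.
by rewrite sin_geN1 sin_le1.
Qed.

Lemma cvg_dist_le (u b : nat -> R) (l : R) : b n @[n --> \oo] --> 0 ->
  (\forall n \near \oo, `|l - u n| <= b n) -> u n @[n --> \oo] --> l.
Proof.
move=> b0 ub; apply/cvgrPdist_le => e e0.
near=> n; apply: (@le_trans _ _ (b n)); first by near: n.
by near: n; exact: (cvgr_le 0).
Unshelve. all: by end_near. Qed.

Lemma near_cvg (u w : nat -> R) (l : R) : (\forall n \near \oo, w n = u n) ->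
  u n @[n --> \oo] --> l -> w n @[n --> \oo] --> l.
Proof.
move=> uw cu; apply: cvg_trans cu; apply: near_eq_cvg.
by near=> n; rewrite (near uw).
Unshelve. all: by end_near. Qed.

Lemma cvg_inv_sqrt : (Num.sqrt n.+1%:R)^-1 @[n --> \oo] --> (0 : R).
Proof.
have := cvg_comp _ _ (@cvg_harmonic R) (@sqrt_continuous R 0).
rewrite sqrtr0; apply: near_cvg; near=> n.
by rewrite /= sqrtrV.
Unshelve. all: by end_near. Qed.

End limits.

Section l2_norm.
Context {R : realType}.
Implicit Types (f h : tree0 -> R) (n : nat).

Definition nrm2 n f : R := Num.sqrt (E n (fun t => f t ^+ 2)).

Lemma nrm2_ge0 n f : 0 <= nrm2 n f. Proof. exact: sqrtr_ge0. Qed.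

Lemma sqr_nrm2 n f : nrm2 n f ^+ 2 = E n (fun t => f t ^+ 2).
Proof. by rewrite sqr_sqrtr// E_ge0// => t _; exact: sqr_ge0. Qed.

Lemma eq_nrm2 n f h : (forall t, size0 t = n -> f t = h t) -> nrm2 n f = nrm2 n h.
Proof. by move=> e; congr Num.sqrt; apply: eq_E => t /e->. Qed.

Lemma nrm2Z n a f : nrm2 n (fun t => a * f t) = `|a| * nrm2 n f.
Proof.
rewrite /nrm2; under eq_E => t _ do rewrite exprMn.
by rewrite EZ sqrtrM ?sqr_ge0// sqrtr_sqr.
Qed.

Lemma nrm2D n f h : nrm2 n (fun t => f t + h t) <= nrm2 n f + nrm2 n h.
Proof.
rewrite -(@ler_pXn2r _ 2)// ?nnegrE ?addr_ge0 ?nrm2_ge0//.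
rewrite sqrrD !sqr_nrm2.
have cs : E n (fun t => f t * h t) <= nrm2 n f * nrm2 n h.
  apply: (le_trans (ler_norm _)).
  rewrite -(@ler_pXn2r _ 2)// ?nnegrE ?mulr_ge0 ?nrm2_ge0//.
  by rewrite -normrX ger0_norm ?sqr_ge0// [in leRHS]exprMn !sqr_nrm2 E_cauchy_schwarz.
under eq_E => t _ do rewrite sqrrD.
have -> : E n (fun t => f t ^+ 2 + f t * h t *+ 2 + h t ^+ 2) =
    E n (fun t => f t ^+ 2) + E n (fun t => f t * h t) * 2 + E n (fun t => h t ^+ 2).
  by rewrite -EZr -!ED; apply: eq_E => t _; rewrite mulr_natr.
by rewrite lerD2r lerD2l -[leRHS]mulr_natr ler_wpM2r.
Qed.

Lemma nrm2B n f h : `|nrm2 n f - nrm2 n h| <= nrm2 n (fun t => f t - h t).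
Proof.
have le u w : nrm2 n u <= nrm2 n (fun t => u t - w t) + nrm2 n w.
  apply: le_trans (nrm2D _ _ _); rewrite (@eq_nrm2 _ u (fun t => u t - w t + w t))// => t _.
  by rewrite subrK.
have e : nrm2 n (fun t => h t - f t) = nrm2 n (fun t => f t - h t).
  transitivity (nrm2 n (fun t => -1 * (f t - h t))).
    by apply: eq_nrm2 => t _; ring.
  by rewrite nrm2Z normrN1 mul1r.
rewrite ler_norml; have := le f h; have := le h f; rewrite e; lra.
Qed.

Lemma E_norm_le n f : E n (fun t => `|f t|) <= nrm2 n f.
Proof.
rewrite -(@ler_pXn2r _ 2)// ?nnegrE ?nrm2_ge0//; last by apply: E_ge0.
rewrite sqr_nrm2; apply: (le_trans (sqr_E_le _ _)).
by apply: le_E => t _; rewrite -normrX ger0_norm ?sqr_ge0.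
Qed.

Lemma E_cos_lip n (f h : tree0 -> R) (s theta : R) :
  `|E n (fun t => cos (s * f t + theta)) - E n (fun t => cos (s * h t + theta))|
  <= `|s| * nrm2 n (fun t => f t - h t).
Proof.
rewrite -EB; apply: (le_trans (normr_E _ _)).
apply: (@le_trans _ _ (E n (fun t => `|s| * `|f t - h t|))).
  apply: le_E => t _; apply: le_trans (cos_lip _ _) _.
  by rewrite le_eqVlt -normrM; apply/orP; left; apply/eqP; congr (`|_|); ring.
by rewrite EZ ler_wpM2l// E_norm_le.
Qed.

End l2_norm.

Section additive_in_toll.
Context {R : realType}.
Implicit Types g : tree0 -> tree0 -> R.

Lemma eq_fringe_sum g g' : (forall l r, g l r = g' l r) -> fringe_sum g =1 fringe_sum g'.
Proof.
by move=> e; elim/tree0_ind => [//|l r IHl IHr]; rewrite !fringe_sum_node e IHl IHr.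
Qed.

Lemma fringe_sumB g g' t :
  fringe_sum (fun l r => g l r - g' l r) t = fringe_sum g t - fringe_sum g' t.
Proof.
elim/tree0_ind: t => [|l r IHl IHr]; first by rewrite /= subrr.
by rewrite !fringe_sum_node IHl IHr; ring.
Qed.

Lemma fringe_sum_sum (I : Type) (s : seq I) (g : I -> tree0 -> tree0 -> R) t :
  fringe_sum (fun l r => \sum_(i <- s) g i l r) t = \sum_(i <- s) fringe_sum (g i) t.
Proof.
elim/tree0_ind: t => [|l r IHl IHr]; first by rewrite /= big1.
by rewrite !fringe_sum_node IHl IHr -!big_split.
Qed.

Lemma centeredB g g' t :
  centered (fun l r => g l r - g' l r) t = centered g t - centered g' t.
Proof.
rewrite /centered fringe_sumB /mean_add.
under eq_E => u _ do rewrite fringe_sumB.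
by rewrite EB; ring.
Qed.

End additive_in_toll.

Section truncated_limit.
Context {R : realType}.

(** At t = s / sqrt(n + 1) the error C (n + 1) |t|^3 of [truncated_char] is C |s|^3 / sqrt(n + 1),
    and q(t)^(n + 1) no longer depends on n. *)
Lemma truncated_limit (g : tree0 -> tree0 -> R) gam K mu v : 0 <= v -> (0 < K)%N ->
  (forall l r, (K <= size0 r)%N -> g l r = gam l) ->
  (forall l r, (K <= size0 l)%N -> g l r = 0) ->
  (forall l, (K <= size0 l)%N -> gam l = 0) ->
  (forall n, (K <= n)%N -> mean_add g n = n.+1%:R * mu) ->
  (forall n, (K <= n)%N -> var_add g n = n.+1%:R * v) ->
  forall s theta : R, E n (fun t => cos (s * (centered g t / Num.sqrt n.+1%:R) + theta))
    @[n --> \oo] --> expR (- (v * s ^+ 2 / 2)) * cos theta.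
Proof.
move=> v0 K0 g1 g2 g3 ml vl s theta.
have [C hC] := truncated_char v0 K0 g1 g2 g3 ml vl.
apply: (@cvg_dist_le _ _ (fun n => C * `|s| ^+ 3 * (Num.sqrt n.+1%:R)^-1)).
  rewrite -(mulr0 (C * `|s| ^+ 3)); apply: cvgMr; exact: cvg_inv_sqrt.
near=> n; have r0 : 0 < Num.sqrt n.+1%:R :> R by rewrite sqrtr_gt0.
have -> : E n (fun t => cos (s * (centered g t / Num.sqrt n.+1%:R) + theta)) =
   E n (fun t => cos (s / Num.sqrt n.+1%:R * centered g t + theta)).
  by apply: eq_E => t _; congr (cos (_ + _)); ring.
have r2 : Num.sqrt n.+1%:R ^+ 2 = n.+1%:R :> R by rewrite sqr_sqrtr.
have := hC (s / Num.sqrt n.+1%:R) theta n; rewrite distrC.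
have -> : expR (- (v * (s / Num.sqrt n.+1%:R) ^+ 2 / 2)) ^+ n.+1 = expR (- (v * s ^+ 2 / 2)).
  rewrite -expRM_natl; congr expR; rewrite exprMn exprVn r2.
  by nat_field.
have -> : C * n.+1%:R * `|s / Num.sqrt n.+1%:R| ^+ 3 = C * `|s| ^+ 3 * (Num.sqrt n.+1%:R)^-1.
  rewrite normrM (@gtr0_norm _ (_^-1)) ?invr_gt0// -{1}r2; move: r0 {r2}.
  by generalize (Num.sqrt n.+1%:R : R) => r r0; field; rewrite lt0r_neq0.
apply; last by near: n; exact: nbhs_infty_ge.
rewrite normrM (@gtr0_norm _ (_^-1)) ?invr_gt0// ler_pdivrMr// mul1r.
have : s ^+ 2 <= n%:R by near: n; exact: nbhs_infty_ger.
move=> sn; rewrite -(@ler_pXn2r _ 2)// ?nnegrE ?sqrtr_ge0// r2 -normrX ger0_norm ?sqr_ge0//.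
by apply: (le_trans sn); rewrite ler_nat.
Unshelve. all: by end_near. Qed.

End truncated_limit.

Section approximation.
Context {R : realType}.
Variables (g : tree0 -> tree0 -> R) (gN : nat -> tree0 -> tree0 -> R).
Variables (v : nat -> R) (K : nat -> nat).
Hypothesis v0 : forall N, 0 <= v N.
Hypothesis char_gN : forall N (s theta : R),
  E n (fun t => cos (s * (centered (gN N) t / Num.sqrt n.+1%:R) + theta))
    @[n --> \oo] --> expR (- (v N * s ^+ 2 / 2)) * cos theta.
Hypothesis var_gN : forall N n, (K N <= n)%N -> var_add (gN N) n = n.+1%:R * v N.
Hypothesis tail : forall e : R, 0 < e -> exists N0, forall N, (N0 <= N)%N ->
  forall n, var_add (fun l r => g l r - gN N l r) n <= e * n.+1%:R.

Let Z n (t : tree0) : R := centered g t / Num.sqrt n.+1%:R.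
Let ZN N n (t : tree0) : R := centered (gN N) t / Num.sqrt n.+1%:R.

Lemma nrm2_scaled (h : tree0 -> tree0 -> R) n :
  nrm2 n (fun t => centered h t / Num.sqrt n.+1%:R) = Num.sqrt (var_add h n / n.+1%:R).
Proof.
rewrite (@eq_nrm2 _ _ _ (fun t => (Num.sqrt n.+1%:R)^-1 * centered h t)).
  rewrite nrm2Z ger0_norm ?invr_ge0 ?sqrtr_ge0// sqrtrM ?var_add_ge0// sqrtrV//.
  by rewrite mulrC.
by move=> t _; rewrite mulrC.
Qed.

Lemma tail_nrm2 (e : R) : 0 < e -> exists N0, forall N, (N0 <= N)%N ->
  forall n, nrm2 n (fun t => Z n t - ZN N n t) <= e.
Proof.
move=> e0; have [N0 hN0] := tail (exprn_gt0 2 e0); exists N0 => N /hN0 hN n.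
have -> : nrm2 n (fun t => Z n t - ZN N n t) =
    Num.sqrt (var_add (fun l r => g l r - gN N l r) n / n.+1%:R).
  by rewrite -nrm2_scaled; apply: eq_nrm2 => t _; rewrite centeredB mulrBl.
rewrite -[leRHS]ger0_norm ?(ltW e0)// -sqrtr_sqr ler_wsqrtr// ler_pdivrMr//.
Qed.

Lemma nrm2_ZN N n : (K N <= n)%N -> nrm2 n (ZN N n) = Num.sqrt (v N).
Proof. by move=> Kn; rewrite nrm2_scaled var_gN// mulrC mulKf ?pnatr_eq0. Qed.

Lemma sd_near (e : R) : 0 < e -> exists N0, forall N, (N0 <= N)%N ->
  forall n, (K N <= n)%N -> `|nrm2 n (Z n) - Num.sqrt (v N)| <= e.
Proof.
move=> e0; have [N0 hN0] := tail_nrm2 e0; exists N0 => N /hN0 hN n Kn.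
by rewrite -(nrm2_ZN Kn); apply: le_trans (nrm2B _ _ _) (hN n).
Qed.

(** Two truncation levels are compared through g itself: at one sufficiently large size its
    normalized standard deviation is close to both sqrt(v N0) and sqrt(v N). *)
Lemma sd_cauchy : cvgn (fun N => Num.sqrt (v N)).
Proof.
apply: cauchy_cvg; apply/cauchy_exP => e e0.
have [N0 hN0] := sd_near (divr_gt0 e0 (ltr0n R 3)).
exists (Num.sqrt (v N0)); exists N0 => // N /= leN.
have := hN0 N0 (leqnn _) (maxn (K N0) (K N)) (leq_maxl _ _).
have := hN0 N leN (maxn (K N0) (K N)) (leq_maxr _ _).
rewrite /ball /= !ler_norml => /andP[a1 a2] /andP[b1 b2].
by rewrite ltr_norml; apply/andP; split; lra.
Qed.

(** The quantification over Y leaves room for a negligible change: the scale sqrt n in place of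
    sqrt(n + 1) for search trees, the toll of the root for recursive trees. *)
Lemma clt_approximation : exists w : R, [/\ 0 <= w, v N @[N --> \oo] --> w,
  var_add g n / n.+1%:R @[n --> \oo] --> w &
  forall Y : nat -> tree0 -> R,
    nrm2 n (fun t => Y n t - centered g t / Num.sqrt n.+1%:R) @[n --> \oo] --> 0 ->
    forall s theta : R, E n (fun t => cos (s * Y n t + theta))
      @[n --> \oo] --> expR (- (w * s ^+ 2 / 2)) * cos theta].
Proof.
have [w cw] : exists w : R, Num.sqrt (v N) @[N --> \oo] --> w.
  by apply/cvg_ex; exact: sd_cauchy.
have w0 : 0 <= w.
  by apply: (cvgr_to_ge cw); near=> n; exact: sqrtr_ge0.
have cv : v N @[N --> \oo] --> w ^+ 2.
  rewrite expr2; apply: near_cvg (cvgM cw cw).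
  by near=> n; rewrite /= -expr2 sqr_sqrtr.
exists (w ^+ 2); split => //.
- exact: sqr_ge0.
- have cs : nrm2 n (Z n) @[n --> \oo] --> w.
    apply/cvgrPdist_le => e e0; have e2 := divr_gt0 e0 (ltr0n R 2).
    have [N0 hN0] := sd_near e2.
    have [N1 _ hN1] : \forall N \near \oo, `|w - Num.sqrt (v N)| <= e / 2.
      by move/cvgrPdist_le: cw; exact.
    near=> n; have := hN1 (maxn N0 N1) (leq_maxr _ _).
    have := hN0 (maxn N0 N1) (leq_maxl _ _) n; rewrite !ler_norml.
    have -> : (K (maxn N0 N1) <= n)%N by near: n; exact: nbhs_infty_ge.
    by move=> /(_ isT) /andP[a1 a2] /andP[b1 b2]; apply/andP; split; lra.
  rewrite expr2; apply: near_cvg (cvgM cs cs).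
  near=> n; rewrite /= -expr2 nrm2_scaled sqr_sqrtr// divr_ge0 ?var_add_ge0//.
move=> Y cY s theta; apply/cvgrPdist_le => e e0.
have es : 0 < e / 4 / (`|s| + 1) by rewrite !divr_gt0// ltr_wpDl.
have [N0 hN0] := tail_nrm2 es.
have cq : expR (- (v N * s ^+ 2 / 2)) * cos theta @[N --> \oo]
    --> expR (- (w ^+ 2 * s ^+ 2 / 2)) * cos theta.
  have ci : - (v N * s ^+ 2 / 2) @[N --> \oo] --> - (w ^+ 2 * s ^+ 2 / 2).
    by apply: cvgN; apply: cvgMl; apply: cvgMl.
  by apply: cvgMl; exact: (cvg_comp _ _ ci (@continuous_expR R _)).
have [N1 _ hN1] : \forall N \near \oo,
    `|expR (- (w ^+ 2 * s ^+ 2 / 2)) * cos theta - expR (- (v N * s ^+ 2 / 2)) * cos theta| <= e / 4.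
  by move/cvgrPdist_le: cq; apply; rewrite divr_gt0.
pose N := maxn N0 N1.
near=> n.
have := hN1 N (leq_maxr _ _).
have : `|expR (- (v N * s ^+ 2 / 2)) * cos theta
   - E n (fun t => cos (s * ZN N n t + theta))| <= e / 4.
  near: n; have cN := char_gN (N := N) (s := s) (theta := theta).
  by move/cvgrPdist_le : cN; apply; rewrite divr_gt0.
have : `|E n (fun t => cos (s * ZN N n t + theta)) - E n (fun t => cos (s * Z n t + theta))|
    <= e / 4.
  rewrite distrC; apply: (le_trans (E_cos_lip _ _ _ _ _)).
  apply: (@le_trans _ _ ((`|s| + 1) * (e / 4 / (`|s| + 1)))).
    apply: ler_pM; [exact: normr_ge0|exact: nrm2_ge0|lra|exact: (hN0 N (leq_maxl _ _))].
  by rewrite mulrC divfK// gt_eqF// ltr_wpDl.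
have : `|E n (fun t => cos (s * Z n t + theta)) - E n (fun t => cos (s * Y n t + theta))|
    <= e / 4.
  rewrite distrC; apply: (le_trans (E_cos_lip _ _ _ _ _)).
  apply: (@le_trans _ _ ((`|s| + 1) * (e / 4 / (`|s| + 1)))).
    apply: ler_pM; [exact: normr_ge0|exact: nrm2_ge0|lra|].
    by near: n; exact: (cvgr_le 0).
  by rewrite mulrC divfK// gt_eqF// ltr_wpDl.
rewrite !ler_norml => /andP[? ?] /andP[? ?] /andP[? ?] /andP[? ?].
by apply/andP; split; lra.
Unshelve. all: by end_near. Qed.

End approximation.

(** * Variance of small tolls *)

Section averages.
Context {R : realType}.
Implicit Types x y : nat -> R.

(** The left subtree has a uniform size, so a toll that depends on it alone has mean and second
    moment of this form. The value at n = 0 is 0. *)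
Definition avg x n : R := (\sum_(0 <= i < n) x i) / n%:R.

Lemma avg_ge0 x n : (forall k, 0 <= x k) -> 0 <= avg x n.
Proof. by move=> x0; rewrite divr_ge0// sumr_ge0. Qed.

Lemma avgD x y n : avg (fun k => x k + y k) n = avg x n + avg y n.
Proof. by rewrite /avg big_split mulrDl. Qed.

Lemma avg_le x n (c : R) : 0 <= c -> (forall k, (k < n)%N -> x k <= c) -> avg x n <= c.
Proof.
move=> c0 xc; case: n xc => [|n] xc; first by rewrite /avg big_geq// mul0r.
rewrite ler_pdivrMr ?ltr0n//.
apply: (@le_trans _ _ (\sum_(0 <= k < n.+1) c)).
  by apply: ler_sum_nat => k /andP[_]; exact: xc.
by rewrite sumr_const_nat subn0 mulr_natr.
Qed.

Lemma sqr_avg_le x n : avg x n ^+ 2 <= avg (fun k => x k ^+ 2) n.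
Proof.
case: n => [|n]; first by rewrite /avg !big_geq// !mul0r expr0n.
have := @sum_cauchy_schwarz R nat (index_iota 0 n.+1) (fun=> 1) x (fun=> ler01).
under eq_bigr do rewrite mul1r; under [X in X * _]eq_bigr do rewrite mul1r.
rewrite sumr_const_nat subn0 /avg => h.
rewrite exprMn exprVn ler_pdivrMr ?exprn_gt0// expr2 mulrA divfK//.
Qed.

Lemma sum_qweight_avg x n : \sum_(0 <= k < n) qweight k * avg x k =
  (\sum_(0 <= k < n) qweight k * x k) / 2 - avg x n / (2 * n.+1%:R).
Proof.
elim: n => [|n IH]; first by rewrite /avg !big_geq// !mul0r subrr.
rewrite !big_nat_recr//= IH /avg big_nat_recr//=.
case: n {IH} => [|n].
  by rewrite !big_geq//= !mul0r mulr0 subr0 !add0r /qweight natrM divr1; field.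
set S1 := \sum_(_ <= _ < _) _; set S2 := \sum_(_ <= _ < _) _.
by rewrite /qweight natrM; nat_field.
Qed.

Lemma sum_qweight_avg_le x n : (forall k, 0 <= x k) ->
  \sum_(0 <= k < n) qweight k * avg x k <= (\sum_(0 <= k < n) qweight k * x k) / 2.
Proof.
by move=> x0; rewrite sum_qweight_avg gerBl divr_ge0// ?avg_ge0// mulr_ge0.
Qed.

End averages.

Section small.
Context {R : realType}.

(* [s] and [a] stand for the standard deviations and means of a toll. *)
Definition small (e : R) (s a : nat -> R) : Prop :=
  [/\ forall n, 0 <= s n <= e * Num.sqrt n.+1%:R,
      forall n, \sum_(0 <= k < n) qweight k * (s k * Num.sqrt k.+1%:R) <= e &
      forall n, \sum_(0 <= k < n) qweight k * a k ^+ 2 <= e].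

Variables (e : R) (s a : nat -> R).
Hypothesis sm : small e s a.
Hypothesis e1 : 0 <= e <= 1.

Let e0 : 0 <= e. Proof. by case/andP: e1. Qed.

Lemma small_ge0 n : 0 <= s n. Proof. by case: sm => /(_ n)/andP[]. Qed.

Lemma small_sqr n : s n ^+ 2 <= e * n.+1%:R.
Proof.
case: sm => /(_ n)/andP[s0 se] _ _.
apply: (@le_trans _ _ ((e * Num.sqrt n.+1%:R) ^+ 2)).
  by rewrite ler_pXn2r// nnegrE (le_trans s0).
rewrite exprMn sqr_sqrtr// ler_wpM2r// expr2 ler_piMl//; by case/andP: e1.
Qed.

Lemma small_sum_sqr n : \sum_(0 <= k < n) qweight k * s k ^+ 2 <= e.
Proof.
case: sm => h1 /(_ n) h2 _; apply: le_trans h2; apply: ler_sum => k _.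
rewrite ler_wpM2l ?qweight_ge0// expr2 ler_wpM2l ?small_ge0//.
case/andP: (h1 k) => _ /le_trans; apply; rewrite ler_piMl ?sqrtr_ge0//; by case/andP: e1.
Qed.

Lemma small_avg n : avg (fun k => a k ^+ 2) n <= e * n.+1%:R.
Proof.
case: sm => _ _ /(_ n) h; case: n h => [|n] h.
  by rewrite /avg big_geq// mul0r mulr_ge0.
rewrite ler_pdivrMr//.
apply: (@le_trans _ _ (\sum_(0 <= k < n.+1) (n.+1%:R * n.+2%:R) * (qweight k * a k ^+ 2))).
  apply: ler_sum_nat => k /andP[_ kn]; rewrite mulrA ler_peMl ?sqr_ge0// /qweight natrM.
  rewrite ler_pdivlMr ?mulr_gt0// mul1r ler_pM// ler_nat//.
by rewrite -mulr_sumr [leLHS]mulrC -mulrA [n.+2%:R * _]mulrC ler_wpM2r.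
Qed.

Variable g : tree0 -> tree0 -> R.
Local Notation V := (var_add g).
Local Notation X := (centered g).

(** In the correlation term g may be centered at no cost, as X l and X r are centered. By
    Cauchy-Schwarz it is at most s (n + 1) sqrt(B (n + 2)) when V i <= B (i + 1) for all i <= n. *)
Lemma var_small_bst :
  (forall n, E2 n g = a n.+1) -> a 0%N = 0 -> (forall n, E2 n (fun l r => (g l r - a n.+1) ^+ 2) <= s n.+1 ^+ 2) ->
  forall n, V n <= (6 * (52 * e) + 9 * (52 * e) ^+ 2) * n.+1%:R.
Proof.
move=> Eg a0 Vg n.
have ma k : mean_toll g k = a k by case: k => [|k] //=; rewrite a0.
have [_ h2 h3] := sm.
apply: (@var_bound _ g (fun n => s n ^+ 2) (fun n => 2 * (s n * Num.sqrt n.+1%:R))).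
  - by rewrite mulr_ge0.
  - by move=> k; rewrite ma.
  - move=> k B B0 VB.
    have -> : E2 k (fun l r => g l r * (X l + X r)) = E2 k (fun l r => (g l r - a k.+1) * (X l + X r)).
      rewrite -[LHS]subr0 -(E2_centered g k (fun _ _ => a k.+1)) -E2B.
      by apply: eq_E2 => l r _; rewrite mulrBl.
    rewrite -mulrA ler_wpM2l//.
    apply: (le_trans (ler_norm _)); rewrite -(@ler_pXn2r _ 2)// ?nnegrE ?mulr_ge0 ?sqrtr_ge0 ?small_ge0//.
    rewrite -normrX ger0_norm ?sqr_ge0//; apply: (le_trans (E2_cauchy_schwarz _ _ _)).
    rewrite 2!exprMn !sqr_sqrtr// -mulrA; apply: ler_pM => //.
    + by apply: E2_ge0 => l r; exact: sqr_ge0.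
    + by apply: E2_ge0 => l r; exact: sqr_ge0.
    rewrite E2_sqr_centered.
    apply: (@le_trans _ _ (2 / k.+1%:R * \sum_(0 <= i < k.+1) B * i.+1%:R)).
      rewrite ler_wpM2l ?divr_ge0//; apply: ler_sum_nat => i /andP[_]; rewrite ltnS; exact: VB.
    rewrite -mulr_sumr sum_below le_eqVlt; apply/orP; left; apply/eqP.
    by nat_field.
  - move=> k; have [/(_ k)/andP[s0 se] _ _] := sm; apply/andP; split.
      by rewrite mulr_ge0// mulr_ge0// sqrtr_ge0.
    have : s k * Num.sqrt k.+1%:R <= e * Num.sqrt k.+1%:R * Num.sqrt k.+1%:R.
      by rewrite ler_wpM2r ?sqrtr_ge0.
    rewrite -mulrA -expr2 sqr_sqrtr// => h.
    have := mulr_ge0 e0 (ler0n R k.+1); lra.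
  - move=> k; under eq_bigr do rewrite mulrCA.
    by rewrite -mulr_sumr; have := h2 k; have := e0; lra.
  - move=> k; rewrite -mulrA [_^-1 * _]mulrC.
    rewrite -/(avg (fun k => mean_toll g k ^+ 2) k) /=.
    have -> : avg (fun k => mean_toll g k ^+ 2) k = avg (fun k => a k ^+ 2) k.
      by rewrite /avg; under eq_bigr do rewrite ma.
    have := small_avg k; have := small_sqr k; have := sqr_ge0 (s k).
    have := @avg_ge0 _ (fun k => a k ^+ 2) k (fun i => sqr_ge0 _).
    have := mulr_ge0 e0 (ler0n R k.+1).
    by set A := avg _ _ => *; apply/andP; split; lra.
  - move=> k.
    apply: (@le_trans _ _ (\sum_(0 <= i < k) (2 * (qweight i * s i ^+ 2) + 48 * (qweight i * avg (fun i => a i ^+ 2) i)))).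
      apply: ler_sum => i _; rewrite le_eqVlt; apply/orP; left; apply/eqP.
      rewrite /avg; under eq_bigr do rewrite ma.
      by ring.
    rewrite big_split /= -!mulr_sumr.
    have := small_sum_sqr k; have := h3 k.
    have := @sum_qweight_avg_le _ (fun i => a i ^+ 2) k (fun i => sqr_ge0 _).
    have := e0; lra.
Qed.

(** Here [var_bound] is fed with averages over the size of the left subtree. The toll has variance
    at most its second moment, bounded by averages of s^2 + a^2; the resulting 2 * 2 + 48 explains
    the constant 52. *)
Lemma var_small_rrt (h : tree0 -> R) : (forall l r, g l r = h l) ->
  (forall n, E n h = a n) -> (forall n, E n (fun t => (h t - a n) ^+ 2) <= s n ^+ 2) ->
  forall n, V n <= (6 * (52 * e) + 9 * (52 * e) ^+ 2) * n.+1%:R.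
Proof.
move=> gh Eh Vh n.
have ma k : mean_toll g k = avg a k.
  case: k => [|k] /=; first by rewrite /avg big_geq// mul0r.
  transitivity (E2 k (fun l _ => h l)); first by apply: eq_E2 => l r _.
  by rewrite E2_left -(big_mkord xpredT (fun i => E i h)); under eq_bigr do rewrite Eh.
have Eh2 k : E k (fun t => h t ^+ 2) <= s k ^+ 2 + a k ^+ 2.
  rewrite -[X in X <= _](subrK (a k ^+ 2)) lerD2r; apply: le_trans (Vh k).
  rewrite le_eqVlt; apply/orP; left; apply/eqP; symmetry.
  transitivity (E k (fun t => h t ^+ 2 + - (2 * a k) * h t + a k ^+ 2)).
    by apply: eq_E => t _; ring.
  by rewrite !ED E_cst EZ Eh; ring.
have [h1 h2 h3] := sm.
have S0 k : 0 <= s k * Num.sqrt k.+1%:R by rewrite mulr_ge0 ?sqrtr_ge0 ?small_ge0.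
have a2 i : avg a i ^+ 2 <= avg (fun j => a j ^+ 2) i by exact: sqr_avg_le.
have a20 i : 0 <= a i ^+ 2 by exact: sqr_ge0.
apply: (@var_bound _ g (fun n => avg (fun k => s k ^+ 2 + a k ^+ 2) n)
     (fun n => 2 * avg (fun k => s k * Num.sqrt k.+1%:R) n)).
  - by rewrite mulr_ge0.
  - move=> k; rewrite -/(mean_toll g k.+1).
    apply: (@le_trans _ _ (E2 k (fun l r => h l ^+ 2))).
      have -> : E2 k (fun l r => (g l r - mean_toll g k.+1) ^+ 2) =
         E2 k (fun l r => h l ^+ 2) - mean_toll g k.+1 ^+ 2.
        transitivity (E2 k (fun l r => h l ^+ 2 + - (2 * mean_toll g k.+1) * g l r
           + mean_toll g k.+1 ^+ 2)).
          by apply: eq_E2 => l r _; rewrite gh; ring.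
        by rewrite !E2D E2_cst E2Z -/(mean_toll g k.+1); ring.
      by rewrite gerBl sqr_ge0.
    rewrite E2_left -(big_mkord xpredT (fun i => E i (fun t => h t ^+ 2))) ler_wpM2r ?invr_ge0//.
    by apply: ler_sum => i _.
  - move=> k B B0 VB; rewrite -mulrA ler_wpM2l//.
    have -> : E2 k (fun l r => g l r * (X l + X r)) =
        E2 k (fun l r => (h l - a (size0 l)) * X l).
      rewrite -[LHS]subr0 -(E2_centered g k (fun i _ => a i)) -E2B.
      transitivity (E2 k (fun l r => (h l - a (size0 l)) * X l) + E2 k (fun l r => (h l - a (size0 l)) * X r)).
        by rewrite -E2D; apply: eq_E2 => l r _; rewrite gh; ring.
      (* The toll is a function of l and so independent of X r given the sizes; only its correlation
         with X l is left. *)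
      by rewrite E2_prod [X in _ + X / _]big1 ?mul0r ?addr0// => i _; rewrite E_centered mulr0.
    rewrite E2_left -(big_mkord xpredT (fun i => E i (fun l => (h l - a (size0 l)) * X l))).
    rewrite mulrAC ler_wpM2r ?invr_ge0// mulr_suml; apply: ler_sum_nat => i /andP[_ ik].
    apply: (le_trans (ler_norm _)).
    rewrite -(@ler_pXn2r _ 2)// ?nnegrE ?mulr_ge0 ?sqrtr_ge0 ?small_ge0//.
    rewrite -normrX ger0_norm ?sqr_ge0//; apply: (le_trans (E_cauchy_schwarz _ _ _)).
    rewrite 2!exprMn !sqr_sqrtr// -mulrA; apply: ler_pM.
    + by apply: E_ge0 => t _; exact: sqr_ge0.
    + by apply: E_ge0 => t _; exact: sqr_ge0.
    + apply: le_trans (Vh i); rewrite le_eqVlt; apply/orP; left; apply/eqP.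
      by apply: eq_E => t ->.
    by rewrite mulrC; apply: VB; rewrite -ltnS.
  - move=> k; rewrite mulr_ge0 ?avg_ge0//=.
    have : avg (fun k => s k * Num.sqrt k.+1%:R) k <= e * k.+1%:R.
      apply: avg_le => [|i ik]; first exact: mulr_ge0.
      have /andP[_ se] := h1 i.
      apply: (@le_trans _ _ (e * Num.sqrt i.+1%:R * Num.sqrt i.+1%:R)).
        by rewrite ler_wpM2r ?sqrtr_ge0.
      by rewrite -mulrA -expr2 sqr_sqrtr// ler_wpM2l// ler_nat ltnW.
    have := mulr_ge0 e0 (ler0n R k.+1); lra.
  - move=> k; under eq_bigr do rewrite mulrCA.
    rewrite -mulr_sumr; have := h2 k; have := sum_qweight_avg_le k S0; have := e0; lra.
  - move=> k.
    have : avg (fun k => s k ^+ 2 + a k ^+ 2) k <= 2 * e * k.+1%:R.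
      rewrite avgD.
      have : avg (fun k => s k ^+ 2) k <= e * k.+1%:R.
        apply: avg_le => [|i ik]; first exact: mulr_ge0.
        by apply: (le_trans (small_sqr i)); rewrite ler_wpM2l// ler_nat ltnW.
      have := small_avg k; lra.
    have : avg (fun i => mean_toll g i ^+ 2) k <= e * k.+1%:R.
      apply: avg_le => [|i ik]; first exact: mulr_ge0.
      rewrite ma; apply: (le_trans (a2 i)); apply: (le_trans (small_avg i)).
      by rewrite ler_wpM2l// ler_nat ltnS ltnW.
    have -> : 48 / k%:R * \sum_(0 <= i < k) mean_toll g i ^+ 2 =
      48 * avg (fun i => mean_toll g i ^+ 2) k by rewrite /avg; ring.
    have := @avg_ge0 _ (fun i => mean_toll g i ^+ 2) k (fun i => sqr_ge0 _).
    have := @avg_ge0 _ (fun i => s i ^+ 2 + a i ^+ 2) k (fun i => addr_ge0 (sqr_ge0 _) (sqr_ge0 _)).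
    have := mulr_ge0 e0 (ler0n R k.+1).
    move=> *; apply/andP; split; lra.
  - move=> k.
    apply: (@le_trans _ _ (\sum_(0 <= i < k) (2 * (qweight i * avg (fun i => s i ^+ 2 + a i ^+ 2) i)
       + 48 * (qweight i * avg (fun i => mean_toll g i ^+ 2) i)))).
      apply: ler_sum => i _; rewrite le_eqVlt; apply/orP; left; apply/eqP.
      by rewrite [X in _ = _ + 48 * (_ * X)]/avg; ring.
    rewrite big_split /= -!mulr_sumr.
    have := @sum_qweight_avg_le _ (fun i => s i ^+ 2 + a i ^+ 2) k (fun i => addr_ge0 (sqr_ge0 _) (sqr_ge0 _)).
    have -> : \sum_(0 <= i < k) qweight i * (s i ^+ 2 + a i ^+ 2) =
       \sum_(0 <= i < k) qweight i * s i ^+ 2 + \sum_(0 <= i < k) qweight i * a i ^+ 2.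
      by rewrite -big_split /=; apply: eq_bigr => i _; rewrite mulrDr.
    have := @sum_qweight_avg_le _ (fun i => mean_toll g i ^+ 2) k (fun i => sqr_ge0 _).
    have : \sum_(0 <= i < k) qweight i * mean_toll g i ^+ 2
       <= \sum_(0 <= i < k) qweight i * avg (fun j => a j ^+ 2) i.
      by apply: ler_sum => i _; rewrite ler_wpM2l ?qweight_ge0// ma.
    have := @sum_qweight_avg_le _ (fun i => a i ^+ 2) k a20.
    have := small_sum_sqr k; have := h3 k; have := e0; lra.
Qed.

End small.

Section mean_rrt_toll.
Context {R : realType}.

(** Averaging halves the weighted sum, which removes the factor 2 of [mean_addE], and the boundary
    term of the summation by parts cancels the last toll. *)
Lemma mean_add_left (h : tree0 -> R) (n : nat) :
  mean_add (fun l _ => h l) n = n.+1%:R * \sum_(0 <= k < n) qweight k * E k h.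
Proof.
have ma k : mean_toll (fun l _ : tree0 => h l) k = avg (E^~ h) k.
  case: k => [|k] /=; first by rewrite /avg big_geq// mul0r.
  by rewrite E2_left -(big_mkord xpredT (fun i => E i h)).
rewrite mean_addE; under eq_bigr do rewrite ma.
by rewrite ma sum_qweight_avg; nat_field.
Qed.

End mean_rrt_toll.

(** * Limit theorems for binary trees grown at random *)

Section tails.
Context {R : realType}.

Definition tail (N : nat) (x : nat -> R) k : R := if (N <= k)%N then x k else 0.

Lemma series_tail (u : nat -> R) : (forall k, 0 <= u k) ->
  cvgn (fun n => \sum_(0 <= k < n) u k) -> forall e : R, 0 < e ->
  exists N0, forall N, (N0 <= N)%N -> forall n, \sum_(0 <= k < n) tail N u k <= e.
Proof.
move=> u0 cu e e0.
have nd : nondecreasing_seq (fun n => \sum_(0 <= k < n) u k).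
  apply/nondecreasing_seqP => n; rewrite big_nat_recr//= lerDl; exact: u0.
have [N0 _ hN0] : \forall n \near \oo, `|limn (fun n => \sum_(0 <= k < n) u k) -
    \sum_(0 <= k < n) u k| <= e.
  by move/cvgrPdist_le: cu; exact.
exists N0 => N leN n.
have := hN0 N0 (leqnn _); rewrite /= ler_norml => /andP[_]; rewrite lerBlDr => hl.
have [nN|Nn] := leqP n N0.
  rewrite big_nat_cond big1 ?ltW// => i /andP[/andP[_ lti] _].
  by rewrite /tail leqNgt (leq_trans lti) ?(leq_trans nN).
rewrite (@big_cat_nat _ _ _ N0)//=; last exact: ltnW.
rewrite big_nat_cond big1 ?add0r; last first.
  move=> i /andP[/andP[_ lti] _].
  by rewrite /tail leqNgt (leq_trans lti).
apply: (@le_trans _ _ (\sum_(N0 <= k < n) u k)).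
  by apply: ler_sum => i _; rewrite /tail; case: ifP.
have := nondecreasing_cvgn_le nd cu n; rewrite (@big_cat_nat _ _ _ N0)//=; last exact: ltnW.
move: hl; set L := limn _ => hl hl'; lra.
Qed.

Lemma tail_small (s a : nat -> R) : (forall k, 0 <= s k) ->
  cvgn (fun n => \sum_(0 <= k < n) qweight k * (s k * Num.sqrt k.+1%:R)) ->
  s n ^+ 2 / n.+1%:R @[n --> \oo] --> 0 ->
  cvgn (fun n => \sum_(0 <= k < n) qweight k * a k ^+ 2) ->
  forall e : R, 0 < e -> exists N0, forall N, (N0 <= N)%N -> small e (tail N s) (tail N a).
Proof.
move=> s0 c1 c2 c3 e e0.
have [N1 hN1] := series_tail (fun k => mulr_ge0 (qweight_ge0 k) (mulr_ge0 (s0 k) (sqrtr_ge0 _))) c1 e0.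
have [N3 hN3] := series_tail (fun k => mulr_ge0 (qweight_ge0 k) (sqr_ge0 (a k))) c3 e0.
have [N2 _ hN2] : \forall n \near \oo, `|0 - s n ^+ 2 / n.+1%:R| <= e ^+ 2.
  by move/cvgrPdist_le: c2; apply; rewrite exprn_gt0.
exists (maxn N1 (maxn N2 N3)) => N; rewrite !geq_max => /and3P[le1 le2 le3]; split.
- move=> n; rewrite /tail; case: ifP => Nn; last by rewrite lexx mulr_ge0 ?sqrtr_ge0 ?ltW.
  rewrite s0/=; have := hN2 n (leq_trans le2 Nn); rewrite sub0r normrN ger0_norm; last first.
    by rewrite divr_ge0 ?sqr_ge0.
  rewrite ler_pdivrMr// => h.
  rewrite -(@ler_pXn2r _ 2)// ?nnegrE ?mulr_ge0 ?sqrtr_ge0 ?(ltW e0)//.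
  by rewrite exprMn sqr_sqrtr.
- move=> n; apply: le_trans (hN1 N le1 n); apply: ler_sum => k _.
  by rewrite /tail; case: ifP => _; rewrite ?mul0r ?mulr0.
- move=> n; apply: le_trans (hN3 N le3 n); apply: ler_sum => k _.
  by rewrite /tail; case: ifP => _; rewrite ?expr0n ?mulr0.
Qed.

Lemma small_const (x : R) : 0 < x -> exists e : R,
  [/\ 0 < e, e <= 1 & 6 * (52 * e) + 9 * (52 * e) ^+ 2 <= x].
Proof.
move=> x0; exists (Num.min 1 (x / 15) / 52).
set y := Num.min 1 (x / 15).
have y0 : 0 < y by rewrite lt_min ltr01 divr_gt0.
have y1 : y <= 1 by rewrite ge_min lexx.
have yx : y <= x / 15 by rewrite ge_min lexx orbT.
split; first by rewrite divr_gt0.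
  by rewrite ler_pdivrMr//; lra.
have -> : 52 * (y / 52) = y by field.
nra.
Qed.

(** Absolute convergence follows from |a| <= 1 + a^2. The second claim holds because the terms of
    the given series tend to 0 and a^2 / (n + 1)^2 is at most twice such a term. *)
Lemma cvg_qweight_mean (a : nat -> R) :
  cvgn (fun n => \sum_(0 <= k < n) qweight k * a k ^+ 2) ->
  cvgn (fun n => \sum_(0 <= k < n) qweight k * a k) /\ a n / n.+1%:R @[n --> \oo] --> 0.
Proof.
move=> ca; split.
  apply: normed_cvg.
  apply: (@series_le_cvg _ _ (fun k => qweight k + qweight k * a k ^+ 2)).
  - by move=> n /=.
  - by move=> n; exact: addr_ge0 (qweight_ge0 _) (mulr_ge0 (qweight_ge0 _) (sqr_ge0 _)).
  - move=> n /=; rewrite normrM (ger0_norm (qweight_ge0 n)) -[X in X + _]mulr1 -mulrDr.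
    rewrite ler_wpM2l ?qweight_ge0//.
    rewrite -[a n ^+ 2]ger0_norm ?sqr_ge0// normrX; have := sqr_ge0 (`|a n| - 1); have := normr_ge0 (a n).
    nra.
  rewrite (_ : series _ = (fun n => \sum_(0 <= k < n) qweight k + \sum_(0 <= k < n) qweight k * a k ^+ 2)); last first.
    by apply/funext => n; rewrite /series /= big_split.
  apply: is_cvgD => //.
  apply/cvg_ex; exists (1 - 0 : R).
  apply: (@near_cvg _ (fun n => 1 - n.+1%:R^-1)).
    by near=> n; rewrite sum_qweight// invr1.
  apply: cvgB; [exact: cvg_cst|exact: cvg_harmonic].
have t0 : qweight n * a n ^+ 2 @[n --> \oo] --> 0 := cvg_series_cvg_0 ca.
have t1 : 2 * (qweight n * a n ^+ 2) @[n --> \oo] --> 0.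
  by rewrite -(mulr0 2); exact: cvgMr.
have t2 : Num.sqrt (2 * (qweight n * a n ^+ 2)) @[n --> \oo] --> 0.
  by rewrite -sqrtr0; exact: (cvg_comp _ _ t1 (@sqrt_continuous R _)).
apply: (@cvg_dist_le _ _ _ _ t2); near=> n.
rewrite sub0r normrN -sqrtr_sqr ler_wsqrtr// exprMn exprVn mulrC mulrA ler_wpM2r ?sqr_ge0//.
rewrite /qweight -[n.+1%:R ^- 2]mul1r ler_pdivrMr ?exprn_gt0//.
rewrite natrM -[n.+2%:R]natr1; have := ltr0Sn R n; set x := n.+1%:R => x0.
rewrite mulrAC ler_pdivlMr ?mulr_gt0//; last by lra.
have x1 : 1 <= x by rewrite ler1n.
nra.
Unshelve. all: by end_near. Qed.

End tails.

Section truncation.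
Context {R : realType}.
Variables (tau : nat -> tree0 -> tree0 -> R) (nu : nat -> R) (gam : nat -> nat -> R).
Hypothesis mean_tau : forall k n, (0 < k)%N -> (k < n)%N ->
  mean_add (tau k) n = n.+1%:R * nu k.
Hypothesis cross_tau : forall k m n, (0 < m)%N -> (m <= k)%N -> (k + m + 2 <= n)%N ->
  E n (fun t => fringe_sum (tau k) t * fringe_sum (tau m) t)
  - mean_add (tau k) n * mean_add (tau m) n = n.+1%:R * gam k m.

Definition truncated N (l r : tree0) : R := \sum_(1 <= k < N.+1) tau k l r.
(** [gam k m] is a covariance constant for m <= k only, whence the maximum and the minimum. *)
Definition truncated_var N : R :=
  \sum_(1 <= k < N.+1) \sum_(1 <= m < N.+1) gam (maxn k m) (minn k m).

Lemma mean_truncated_sum N n :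
  mean_add (truncated N) n = \sum_(1 <= k < N.+1) mean_add (tau k) n.
Proof. by rewrite -E_sum; apply: eq_E => t _; rewrite fringe_sum_sum. Qed.

Lemma mean_truncated N n : (N < n)%N ->
  mean_add (truncated N) n = n.+1%:R * \sum_(1 <= k < N.+1) nu k.
Proof.
move=> Nn; rewrite mean_truncated_sum mulr_sumr; apply: eq_big_nat => k /andP[k0 kN].
by rewrite mean_tau//; lia.
Qed.

Lemma var_truncated N n : (2 * N + 2 <= n)%N ->
  var_add (truncated N) n = n.+1%:R * truncated_var N.
Proof.
move=> Nn; rewrite var_addE.
have -> : E n (fun t => (fringe_sum (truncated N) t - mean_add (truncated N) n) ^+ 2) =
   E n (fun t => fringe_sum (truncated N) t ^+ 2) - mean_add (truncated N) n ^+ 2.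
  transitivity (E n (fun t => fringe_sum (truncated N) t ^+ 2
     + - (2 * mean_add (truncated N) n) * fringe_sum (truncated N) t + mean_add (truncated N) n ^+ 2)).
    by apply: eq_E => t _; ring.
  by rewrite !ED E_cst EZ -/(mean_add _ n); ring.
rewrite mean_truncated_sum expr2 mulr_suml mulr_sumr.
transitivity (\sum_(1 <= k < N.+1) \sum_(1 <= m < N.+1)
   (E n (fun t => fringe_sum (tau k) t * fringe_sum (tau m) t)
     - mean_add (tau k) n * mean_add (tau m) n)).
  under [RHS]eq_bigr do rewrite sumrB.
  rewrite sumrB; congr (_ - _).
    under [RHS]eq_bigr do rewrite -E_sum.
    rewrite -E_sum; apply: eq_E => t _.
    rewrite fringe_sum_sum expr2 mulr_suml; apply: eq_bigr => k _.
    by rewrite mulr_sumr.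
  by apply: eq_bigr => k _; rewrite mulr_sumr.
apply: eq_big_nat => k /andP[k0 kN]; rewrite mulr_sumr; apply: eq_big_nat => m /andP[m0 mN].
have [mk|km] := leqP m k; first by rewrite cross_tau//; lia.
rewrite -cross_tau ?(ltnW km)//; last by lia.
by rewrite [X in _ - X]mulrC; congr (_ - _); apply: eq_E => t _; rewrite mulrC.
Qed.

Lemma truncated_var_ge0 N : 0 <= truncated_var N.
Proof.
have := var_add_ge0 (truncated N) (2 * N + 2); rewrite var_truncated//.
by rewrite pmulr_rge0.
Qed.

End truncation.

Lemma truncated_indic (R : realType) (c : R) x N :
  \sum_(1 <= k < N.+1) (if x.+1 == k then c else 0) = if (x < N)%N then c else 0.
Proof.
rewrite -big_mkcond /=; case: ltnP => xN.
  by rewrite (eq_bigl (fun k => k == x.+1)) ?big_nat1_eq ?ltnS ?xN.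
by rewrite big_nat_cond big1// => i /andP[/andP[_ iN] /eqP ei]; lia.
Qed.

Section bst_limit.
Context {R : realType}.
Variable f : btree -> R.
Let a k : R := E k (oapp f 0).
Let s k : R := Num.sqrt (E k (fun t => (oapp f 0 t - a k) ^+ 2)).
Let g (l r : tree0) : R := f (BNode l r).

Definition bst_gamma k m : R := 2 / ((k + 1) * (k + 2))%N%:R *
    E k (fun t => oapp f 0 t * fringe_sum (bst_toll f m) t)
  - beta_bst k m * E k (oapp f 0) * E m (oapp f 0).

Hypothesis c1 : cvgn (fun n => \sum_(0 <= k < n) qweight k * (s k * Num.sqrt k.+1%:R)).
Hypothesis c2 : s n ^+ 2 / n.+1%:R @[n --> \oo] --> 0.
Hypothesis c3 : cvgn (fun n => \sum_(0 <= k < n) qweight k * a k ^+ 2).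

Lemma bst_limit : exists w : R, [/\ 0 <= w,
  truncated_var bst_gamma N @[N --> \oo] --> w,
  var_add g n / n.+1%:R @[n --> \oo] --> w &
  forall Y : nat -> tree0 -> R,
    nrm2 n (fun t => Y n t - centered g t / Num.sqrt n.+1%:R) @[n --> \oo] --> 0 ->
    forall u theta : R, E n (fun t => cos (u * Y n t + theta))
      @[n --> \oo] --> expR (- (w * u ^+ 2 / 2)) * cos theta].
Proof.
have mean_tau k n : (0 < k)%N -> (k < n)%N ->
    mean_add (bst_toll f k) n = n.+1%:R * (2 * a k / (k.+1 * k.+2)%:R).
  by move=> k0 kn; rewrite mean_bst// bst_mean_gt.
have cross := @bst_cross R f : forall k m n, (0 < m)%N -> (m <= k)%N -> (k + m + 2 <= n)%N ->
  E n (fun t => fringe_sum (bst_toll f k) t * fringe_sum (bst_toll f m) t)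
  - mean_add (bst_toll f k) n * mean_add (bst_toll f m) n = n.+1%:R * bst_gamma k m.
have truncE N l r : truncated (bst_toll f) N l r =
    if ((size0 l + size0 r)%N < N)%N then g l r else 0.
  by rewrite -truncated_indic.
apply: (@clt_approximation _ g (truncated (bst_toll f)) _ (fun N => 2 * N + 2)%N).
- exact: (truncated_var_ge0 (gam := bst_gamma) cross).
- move=> N u theta.
  apply: (@truncated_limit _ _ (fun=> 0) (2 * N + 2) (\sum_(1 <= k < N.+1) (2 * a k / (k.+1 * k.+2)%:R))) => //.
  + exact: (truncated_var_ge0 (gam := bst_gamma) cross).
  + by rewrite addn2.
  + by move=> l r Nr; rewrite truncE ifN// -leqNgt; lia.
  + by move=> l r Nr; rewrite truncE ifN// -leqNgt; lia.
  + by move=> n Nn; apply: mean_truncated => //; lia.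
  + by move=> n Nn; exact: var_truncated.
- by move=> N n Nn; exact: var_truncated.
move=> x /small_const[e [e0 e1 ex]].
have [N0 hN0] := tail_small (fun k => sqrtr_ge0 _) c1 c2 c3 e0.
exists N0 => N leN n.
(* The truncation keeps fringe subtrees of size up to N, so the tail starts at N + 1. *)
have sm := hN0 N.+1 (leq_trans leN (leqnSn _)).
apply: le_trans (ler_wpM2r (ler0n R _) ex).
have gE l r : g l r - truncated (bst_toll f) N l r =
    if (N <= (size0 l + size0 r)%N)%N then g l r else 0.
  by rewrite truncE; case: ltnP => _; rewrite ?subr0 ?subrr.
apply: (var_small_bst sm).
- by rewrite ltW.
- move=> k; rewrite /tail ltnS /a E_E2; case: ifP => Nk.
    by apply: eq_E2 => l r lr; rewrite gE lr Nk.
  by rewrite -[RHS](E2_cst k); apply: eq_E2 => l r lr; rewrite gE lr Nk.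
- by [].
move=> k; rewrite /tail ltnS; case: ifP => Nk.
  rewrite sqr_sqrtr; last by apply: E_ge0 => t _; exact: sqr_ge0.
  rewrite E_E2 le_eqVlt; apply/orP; left; apply/eqP.
  by apply: eq_E2 => l r lr; rewrite gE lr Nk.
rewrite expr0n /= -[leRHS](E2_cst k); apply: le_E2 => l r lr.
by rewrite gE lr Nk subr0 expr0n.
Qed.

End bst_limit.

Section rrt_limit.
Context {R : realType}.
Variable h : tree0 -> R.
Let a k : R := E k h.
Let s k : R := Num.sqrt (E k (fun t => (h t - a k) ^+ 2)).
Let g (l r : tree0) : R := h l.

Definition rrt_gamma k m : R := 1 / (k * (k + 1))%N%:R *
      E k.-1 (fun t => h t * ((k == m)%:R * h t + fringe_sum (rrt_toll h m) t))
    - beta_rrt k m * E k.-1 h * E m.-1 h.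

Hypothesis c1 : cvgn (fun n => \sum_(0 <= k < n) qweight k * (s k * Num.sqrt k.+1%:R)).
Hypothesis c2 : s n ^+ 2 / n.+1%:R @[n --> \oo] --> 0.
Hypothesis c3 : cvgn (fun n => \sum_(0 <= k < n) qweight k * a k ^+ 2).

Lemma rrt_limit : exists w : R, [/\ 0 <= w,
  truncated_var rrt_gamma N @[N --> \oo] --> w,
  var_add g n / n.+1%:R @[n --> \oo] --> w &
  forall Y : nat -> tree0 -> R,
    nrm2 n (fun t => Y n t - centered g t / Num.sqrt n.+1%:R) @[n --> \oo] --> 0 ->
    forall u theta : R, E n (fun t => cos (u * Y n t + theta))
      @[n --> \oo] --> expR (- (w * u ^+ 2 / 2)) * cos theta].
Proof.
have mean_tau k n : (0 < k)%N -> (k < n)%N ->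
    mean_add (rrt_toll h k) n = n.+1%:R * (a k.-1 / (k * k.+1)%:R).
  by move=> k0 kn; rewrite mean_rrt// rrt_mean_ge// ltnW.
have cross : forall k m n, (0 < m)%N -> (m <= k)%N -> (k + m + 2 <= n)%N ->
  E n (fun t => fringe_sum (rrt_toll h k) t * fringe_sum (rrt_toll h m) t)
  - mean_add (rrt_toll h k) n * mean_add (rrt_toll h m) n = n.+1%:R * rrt_gamma k m.
  by move=> k m n m0 mk kmn; apply: rrt_cross => //; apply: leq_trans kmn; rewrite leq_addr.
have truncE N l r : truncated (rrt_toll h) N l r = if (size0 l < N)%N then h l else 0.
  by rewrite -truncated_indic.
apply: (@clt_approximation _ g (truncated (rrt_toll h)) _ (fun N => 2 * N + 2)%N).
- exact: (truncated_var_ge0 (gam := rrt_gamma) cross).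
- move=> N u theta.
  apply: (@truncated_limit _ _ (fun l => if (size0 l < N)%N then h l else 0) (2 * N + 2)
    (\sum_(1 <= k < N.+1) (a k.-1 / (k * k.+1)%:R))) => //.
  + exact: (truncated_var_ge0 (gam := rrt_gamma) cross).
  + by rewrite addn2.
  + by move=> l r Nr; rewrite truncE ifN// -leqNgt; lia.
  + by move=> l Nr; rewrite ifN// -leqNgt; lia.
  + by move=> n Nn; apply: mean_truncated => //; lia.
  + by move=> n Nn; exact: var_truncated.
- by move=> N n Nn; exact: var_truncated.
move=> x /small_const[e [e0 e1 ex]].
have [N0 hN0] := tail_small (fun k => sqrtr_ge0 _) c1 c2 c3 e0.
exists N0 => N leN n.
(* A recursive tree of size at most N is encoded with fewer than N nodes, so in this indexing the
   tail starts at N. *)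
have sm := hN0 N leN.
apply: le_trans (ler_wpM2r (ler0n R _) ex).
pose h' t := if (N <= size0 t)%N then h t else 0.
have gE l r : g l r - truncated (rrt_toll h) N l r = h' l.
  by rewrite truncE /h'; case: ltnP => _; rewrite ?subr0 ?subrr.
apply: (var_small_rrt sm _ gE).
- by rewrite ltW.
- move=> k; rewrite /tail /h' /a; case: ifP => Nk.
    by apply: eq_E => t tk; rewrite tk Nk.
  by rewrite -[RHS](E_cst k); apply: eq_E => t tk; rewrite tk Nk.
move=> k; rewrite /tail /h'; case: ifP => Nk.
  rewrite sqr_sqrtr; last by apply: E_ge0 => t _; exact: sqr_ge0.
  by apply: le_E => t tk; rewrite tk Nk.
rewrite expr0n /= -[leRHS](E_cst k); apply: le_E => t tk.
by rewrite tk Nk subr0 expr0n.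
Qed.

End rrt_limit.

(** * Sums over pairs of trees *)

Section sum_by_size.
Context {R : realType} (T : choiceType) (sz : T -> nat) (fr : T -> seq T).
Context (Om : nat -> finType) (X : forall n, Om n -> T).
Hypothesis sz_gt0 : forall t, (0 < sz t)%N.
Hypothesis szX : forall n w, sz (@X n.+1 w) = n.+1.
Hypothesis fin : forall N, finite_set [set t | (sz t <= N)%N].
Variables (b : nat -> R) (beta : nat -> nat -> R) (f : T -> R).

Let p t : R := Prob (fun w : Om (sz t) => X w == t).
Let cov t t' : R := b (sz t) * (count_mem t' (fr t))%:R * p t
  - beta (sz t) (sz t') * p t * p t'.
Let sigma t t' : R := if (sz t' <= sz t)%N then cov t t' else cov t' t.
Let gam k m : R :=
  b k * Mean (fun w : Om k => f (X w) * \sum_(s <- fr (X w) | sz s == m) f s)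
  - beta k m * Mean (fun w : Om k => f (X w)) * Mean (fun w : Om m => f (X w)).

Lemma sum_if_eq (S : seq T) (x : T) (phi : T -> R) : uniq S -> x \in S ->
  \sum_(t <- S) (x == t)%:R * phi t = phi x.
Proof.
move=> uS xS; rewrite (bigD1_seq x)//= eqxx mul1r big1 ?addr0// => t tx.
by rewrite eq_sym (negbTE tx) mul0r.
Qed.

Lemma Mean_by_value (S : seq T) N k (phi : T -> R) : uniq S ->
  S =i [pred t | (sz t <= N)%N] -> (0 < k)%N -> (k <= N)%N ->
  Mean (fun w : Om k => phi (X w)) = \sum_(t <- S | sz t == k) p t * phi t.
Proof.
move=> uS mS; case: k => // k _ kN.
transitivity (\sum_(t <- S | sz t == k.+1) Prob (fun w : Om k.+1 => X w == t) * phi t);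
    last first.
  by apply: eq_bigr => t /eqP tk; rewrite /p tk.
transitivity (\sum_(t <- S | sz t == k.+1)
   ((\sum_(w : Om k.+1) (X w == t)%:R) / #|Om k.+1|%:R * phi t) : R); last first.
  apply: eq_bigr => t _; congr (_ / _ * _).
  rewrite -sum1_card natr_sum [RHS]big_mkcond /=; apply: eq_bigr => w _.
  by rewrite unfold_in; case: eqP.
rewrite /Mean mulr_suml.
transitivity (\sum_(w : Om k.+1) \sum_(t <- S | sz t == k.+1)
   ((X w == t)%:R * (phi t / #|Om k.+1|%:R))).
  apply: eq_bigr => w _; rewrite big_mkcond /=.
  rewrite (eq_bigr (fun t => (X w == t)%:R * (phi t / #|Om k.+1|%:R))).
    by rewrite (sum_if_eq (fun t => phi t / _))// mS inE szX.
  move=> t _; case: ifP => // tk; case: eqP => [e|]; last by rewrite mul0r.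
  by rewrite -e szX eqxx in tk.
rewrite exchange_big /=; apply: eq_bigr => t _.
by rewrite !mulr_suml; apply: eq_bigr => w _; rewrite mulrA mulrAC.
Qed.

Lemma sum_partition_size (S : seq T) N (phi : T -> R) :
  (forall t, t \in S -> (sz t <= N)%N) ->
  \sum_(t <- S) phi t = \sum_(1 <= k < N.+1) \sum_(t <- S | sz t == k) phi t.
Proof.
move=> SN; under [RHS]eq_bigr do rewrite big_mkcond.
rewrite exchange_big /= big_seq [RHS]big_seq; apply: eq_bigr => t tS.
rewrite -big_mkcond /= (eq_bigl (fun k => k == sz t)).
  by rewrite big_nat1_eq sz_gt0 ltnS SN.
by move=> k; rewrite eq_sym.
Qed.

(** Grouping the pairs by their two sizes removes the individual tree probabilities: each group
    becomes an expression in means over random trees, which is what the recurrences compute. *)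
Lemma sum_sigma_by_size N :
  \sum_(q \in [set q : T * T | (sz q.1 <= N)%N /\ (sz q.2 <= N)%N])
     f q.1 * f q.2 * sigma q.1 q.2
  = \sum_(1 <= k < N.+1) \sum_(1 <= m < N.+1) gam (maxn k m) (minn k m).
Proof.
have [S0 eS0] := iffLR (finite_seqP _) (fin N).
pose S := undup S0; have uS : uniq S by exact: undup_uniq.
have mS : S =i [pred t | (sz t <= N)%N].
  move=> t; rewrite mem_undup inE; apply/idP/idP => h.
    by have : [set` S0] t by []; rewrite -eS0.
  by have : [set t | (sz t <= N)%N] t by []; rewrite eS0.
have -> : [set q : T * T | (sz q.1 <= N)%N /\ (sz q.2 <= N)%N]
    = [set` [seq (t, t') | t <- S, t' <- S]].
  apply/seteqP; split => [[t t'] /= [h h']|[t t'] /=].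
    by apply/allpairsP; exists (t, t'); rewrite !mS !inE.
  by move=> /allpairsP[[u u'] /= [h h' [-> ->]]]; move: h h'; rewrite !mS !inE.
rewrite -fsbig_seq; last by apply: allpairs_uniq => // -[? ?] [? ?] _ _ [-> ->].
rewrite big_allpairs_dep /=.
have cov_sum k m : (0 < k <= N)%N -> (0 < m <= N)%N ->
    \sum_(t <- S | sz t == k) \sum_(t' <- S | sz t' == m) f t * f t' * cov t t' = gam k m.
  move=> /andP[k0 kN] /andP[m0 mN]; rewrite /gam.
  rewrite (Mean_by_value (fun t => f t * \sum_(s <- fr t | sz s == m) f s) uS mS)//.
  rewrite (Mean_by_value f uS mS k0 kN) (Mean_by_value f uS mS m0 mN).
  rewrite mulr_sumr -[in X in _ - X]mulrA mulr_suml mulr_sumr -sumrB.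
  apply: eq_bigr => t /eqP tk.
  (* Collecting equal fringe subtrees produces the numbers of copies that appear in [cov]. *)
  have -> : \sum_(s <- fr t | sz s == m) f s =
      \sum_(t' <- S | sz t' == m) f t' * (count_mem t' (fr t))%:R.
    transitivity (\sum_(s <- fr t | sz s == m) \sum_(t' <- S | sz t' == m) (s == t')%:R * f t').
      apply: eq_bigr => s /eqP sm; rewrite big_mkcond /=.
      rewrite (eq_bigr (fun t' => (s == t')%:R * f t')).
        by rewrite sum_if_eq// mS inE sm.
      move=> t' _; case: ifP => // t'm; case: eqP => [e|]; last by rewrite mul0r.
      by rewrite -e sm eqxx in t'm.
    rewrite exchange_big /=; apply: eq_bigr => t' t'm.
    rewrite -mulr_suml mulrC; congr (_ * _).
    rewrite -sum1_count natr_sum big_mkcond [RHS]big_mkcond /=; apply: eq_bigr => s _.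
    by case: (s =P t') => [->|]; rewrite ?t'm//; case: ifP.
  rewrite !mulr_sumr -sumrB; apply: eq_bigr => t' /eqP t'm.
  by rewrite /cov tk t'm; ring.
have SN t : t \in S -> (sz t <= N)%N by rewrite mS inE.
rewrite (sum_partition_size _ SN); apply: eq_big_nat => k /andP[k0 kN].
rewrite (eq_bigr _ (fun t _ => sum_partition_size (fun t' => f t * f t' * sigma t t') SN)).
rewrite exchange_big /=; apply: eq_big_nat => m /andP[m0 mN].
have [mk|km] := leqP m k.
  rewrite -cov_sum ?k0 ?m0//; apply: eq_bigr => t /eqP tk; apply: eq_bigr => t' /eqP t'm.
  by rewrite /sigma tk t'm mk.
rewrite -cov_sum ?k0 ?m0// exchange_big /=.
apply: eq_bigr => t /eqP tm; apply: eq_bigr => t' /eqP t'k.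
by rewrite /sigma tm t'k leqNgt km /= [f t' * f t]mulrC.
Qed.

End sum_by_size.

(** * Transfer to the tree models *)

Section tree_identities.
Context {R : realType}.

Lemma bsum_fringe_sum (f : btree -> R) t :
  bsum f t = fringe_sum (fun l r => f (BNode l r)) (Some t).
Proof.
suff h u : fringe_sum (fun l r => f (BNode l r)) u = \sum_(s <- oapp bfringe [::] u) f s.
  by rewrite h.
elim/tree0_ind: u => [|l r IHl IHr]; first by rewrite big_nil.
by rewrite fringe_sum_node IHl IHr [in RHS]/= big_cons big_cat addrA.
Qed.

Lemma bsum_size (f : btree -> R) m t :
  \sum_(s <- bfringe t | bsize s == m) f s = fringe_sum (bst_toll f m) (Some t).
Proof.
rewrite big_mkcond -[LHS]/(bsum (fun s => if bsize s == m then f s else 0) t).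
exact: bsum_fringe_sum.
Qed.

(** The root of [rtree t] is not a node of t, so its contribution stands apart from the additive
    functional. *)
Lemma osum_rtree (f : otree -> R) t :
  osum f (rtree t) = f (rtree t) + fringe_sum (fun l _ => f (rtree l)) t.
Proof.
suff h u : fringe_sum (fun l _ => f (rtree l)) u =
    \sum_(s <- flatten (map ofringe (forest u))) f s.
  by rewrite h /osum [in LHS]/= big_cons.
elim/tree0_ind: u => [|l r IHl IHr]; first by rewrite big_nil.
rewrite fringe_sum_node IHl IHr forest_node [in RHS]/= big_cons big_cat.
by rewrite !addrA.
Qed.

Lemma osum_size (f : otree -> R) m t :
  \sum_(s <- ofringe (rtree t) | osize s == m) f s =
  ((size0 t).+1 == m)%:R * f (rtree t) + fringe_sum (rrt_toll (f \o rtree) m) t.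
Proof.
rewrite big_mkcond -[LHS]/(osum (fun s => if osize s == m then f s else 0) (rtree t)).
rewrite osum_rtree osize_rtree; congr (_ + _).
  by case: eqP => _; rewrite ?mul1r ?mul0r.
by apply: eq_fringe_sum => l r; rewrite osize_rtree.
Qed.

Lemma usum_pi (f : utree -> R) t :
  usum f (\pi_utree t)%qT = osum (fun s => f (\pi_utree s)%qT) t.
Proof. by rewrite /usum (perm_big _ (ufringe_pi t)) /= big_map. Qed.

Lemma usum_size_pi (f : utree -> R) m t :
  \sum_(s <- ufringe (\pi_utree t)%qT | usize s == m) f s =
  \sum_(s <- ofringe t | osize s == m) f (\pi_utree s)%qT.
Proof.
rewrite (perm_big _ (ufringe_pi t)) /= big_map.
by apply: eq_bigl => s; rewrite usize_pi.
Qed.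

(** Lets the sizes of [bst] and [rrt] be read off from their laws: an indicator with mean 0 under a
    uniform law vanishes at every outcome. *)
Lemma size_of_Mean_eq0 (T : Type) (sz : T -> nat) (Om : finType) (X : Om -> T) n :
  Mean (fun w => (sz (X w) != n)%:R : R) = 0 -> forall w, sz (X w) = n.
Proof.
move=> M0 w; apply/eqP; move: M0; rewrite /Mean => /eqP.
rewrite mulf_eq0 invr_eq0 pnatr_eq0 => /orP[|/eqP c0]; last first.
  by have := fintype0 w c0.
rewrite psumr_eq0 => [/allP/(_ w)|i _]; last by case: (_ != _).
by move=> /(_ (mem_index_enum w)) /=; case: (sz (X w) =P n) => // _; rewrite oner_eq0.
Qed.

Lemma bsize_bst n (s : 'S_n.+1) : bsize (bst s) = n.+1.
Proof.
apply: (@size_of_Mean_eq0 _ bsize _ (@bst n.+1)).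
rewrite (Mean_bst (fun t => (bsize t != n.+1)%:R)) -[RHS](E_cst n.+1).
by apply: eq_E => -[t|//] /= tn; rewrite tn eqxx.
Qed.

Lemma osize_rrt n (w : parents n.+1) : osize (rrt w) = n.+1.
Proof.
apply: (@size_of_Mean_eq0 _ osize _ (@rrt n.+1)).
rewrite (Mean_rrt (fun t => (osize t != n.+1)%:R)) -[RHS](E_cst n).
by apply: eq_E => t tn; rewrite /comp osize_rtree tn eqxx.
Qed.

Lemma usize_urrt n (w : parents n.+1) : usize (urrt w) = n.+1.
Proof. by rewrite usize_pi osize_rrt. Qed.

Lemma Mean_bst_some n (phi : tree0 -> R) :
  Mean (fun s : 'S_n.+1 => phi (Some (bst s))) = E n.+1 phi.
Proof.
by rewrite (Mean_bst (fun t => phi (Some t))); apply: eq_E => -[].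
Qed.

Lemma usize_gt0 t : (0 < usize t)%N. Proof. exact: osize_gt0. Qed.

Lemma bsize_gt0 t : (0 < bsize t)%N. Proof. by case: t. Qed.

End tree_identities.

(** * The summability hypotheses in terms of [qweight] *)

Section sequences.
Context {R : realType}.

Lemma cvg_series_from1 (u : nat -> R) (l : R) : u 0%N = 0 ->
  \sum_(0 <= k < n) u k.+1 @[n --> \oo] --> l -> \sum_(0 <= k < n) u k @[n --> \oo] --> l.
Proof.
move=> u0 h; rewrite -[X in X @ _ --> _]/(series u) -cvg_shiftS.
by apply: near_cvg h; near=> n; rewrite /series /= big_nat_recl//= u0 add0r.
Unshelve. all: by end_near. Qed.

Lemma cvgn_series_le (u w : nat -> R) : (forall k, 0 <= u k <= w k) ->
  cvgn (fun n => \sum_(0 <= k < n) w k) -> cvgn (fun n => \sum_(0 <= k < n) u k).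
Proof.
move=> uw; apply: series_le_cvg => k; have /andP[u0 le] := uw k => //.
exact: le_trans le.
Qed.

Lemma powR32 k : k.+1%:R `^ (3 / 2) = k.+1%:R * Num.sqrt k.+1%:R :> R.
Proof.
rewrite (_ : 3 / 2 = 1 + 2^-1); last by field.
rewrite powRD ?powRr1 ?powR12_sqrt//; apply/implyP => _; exact: lt0r_neq0.
Qed.

Variables (S A : nat -> R).
Hypothesis S0 : forall k, 0 <= S k.
Hypothesis h1 : cvgn (fun n => \sum_(1 <= k < n.+1) S k / k%:R `^ (3 / 2)).
Hypothesis h2 : S k ^+ 2 / k%:R @[k --> \oo] --> 0.
Hypothesis h3 : cvgn (fun n => \sum_(1 <= k < n.+1) A k ^+ 2 / k%:R ^+ 2).

(** The shifted forms serve recursive trees, where n + 1 nodes are encoded by n; the unshifted forms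
    further down serve search trees. *)
Lemma cvg_qweight_sdS : cvgn (fun n => \sum_(0 <= k < n) qweight k * (S k.+1 * Num.sqrt k.+1%:R)).
Proof.
apply: (@cvgn_series_le _ (fun k => S k.+1 / k.+1%:R `^ (3 / 2))); last first.
  apply: cvgP; apply: near_cvg h1; near=> n; by rewrite big_add1.
move=> k; have sk0 : 0 < Num.sqrt k.+1%:R :> R by rewrite sqrtr_gt0.
rewrite mulr_ge0 ?qweight_ge0 ?mulr_ge0 ?sqrtr_ge0//= mulrCA ler_wpM2l// powR32.
rewrite /qweight natrM -[k.+2%:R]natr1.
have [r r0 [-> ->]] : exists2 r : R, 0 < r & Num.sqrt k.+1%:R = r /\ k.+1%:R = r ^+ 2.
  by exists (Num.sqrt k.+1%:R) => //; rewrite sqr_sqrtr.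
have x0 : 0 < r ^+ 2 + 1 by rewrite ltr_wpDl// sqr_ge0.
rewrite (_ : _ * r = (r ^+ 2 * r)^-1 * (r ^+ 2 / (r ^+ 2 + 1))); last first.
  by field; rewrite !lt0r_neq0.
have r3 : 0 <= (r ^+ 2 * r)^-1 by rewrite invr_ge0 ltW// mulr_gt0// exprn_gt0.
by rewrite ler_piMr// ler_pdivrMr// mul1r lerDl.
Unshelve. all: by end_near. Qed.

Lemma cvg_var_ratioS : S n.+1 ^+ 2 / n.+1%:R @[n --> \oo] --> 0.
Proof. by have := h2; rewrite -cvg_shiftS. Qed.

Lemma cvg_qweight_sqr_meanS : cvgn (fun n => \sum_(0 <= k < n) qweight k * A k.+1 ^+ 2).
Proof.
apply: (@cvgn_series_le _ (fun k => A k.+1 ^+ 2 / k.+1%:R ^+ 2)); last first.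
  apply: cvgP; apply: near_cvg h3; near=> n; by rewrite big_add1.
move=> k; rewrite mulr_ge0 ?qweight_ge0 ?sqr_ge0//= mulrC ler_wpM2l ?sqr_ge0//.
rewrite /qweight natrM lef_pV2 ?posrE ?mulr_gt0 ?exprn_gt0//.
by rewrite expr2 ler_wpM2l// ler_nat.
Unshelve. all: by end_near. Qed.

Hypothesis S00 : S 0%N = 0.
Hypothesis A00 : A 0%N = 0.

Lemma qweightS k : qweight k.+1 <= qweight k :> R.
Proof. by rewrite lef_pV2 ?posrE// ler_nat; lia. Qed.

Lemma cvg_qweight_sd : cvgn (fun n => \sum_(0 <= k < n) qweight k * (S k * Num.sqrt k.+1%:R)).
Proof.
have : cvgn (fun n => \sum_(0 <= k < n) qweight k.+1 * (S k.+1 * Num.sqrt k.+2%:R)).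
  apply: (cvgn_series_le _ cvg_qweight_sdS) => k.
  rewrite mulr_ge0 ?qweight_ge0 ?mulr_ge0 ?sqrtr_ge0//= mulrCA [leRHS]mulrCA ler_wpM2l//.
  rewrite /qweight !natrM !invfM.
  have r1 : 0 < Num.sqrt k.+1%:R :> R by rewrite sqrtr_gt0.
  have r2 : 0 < Num.sqrt k.+2%:R :> R by rewrite sqrtr_gt0.
  have e1 : k.+1%:R = Num.sqrt k.+1%:R ^+ 2 :> R by rewrite sqr_sqrtr.
  have e2 : k.+2%:R = Num.sqrt k.+2%:R ^+ 2 :> R by rewrite sqr_sqrtr.
  have le : (Num.sqrt k.+2%:R)^-1 <= (Num.sqrt k.+1%:R)^-1 :> R.
    by rewrite lef_pV2 ?posrE// ler_wsqrtr// ler_nat.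
  have le' : k.+3%:R^-1 <= k.+2%:R^-1 :> R by rewrite lef_pV2 ?posrE// ler_nat.
  apply: (@le_trans _ _ ((Num.sqrt k.+2%:R)^-1 * k.+3%:R^-1)).
    rewrite {1}e2 le_eqVlt; apply/orP; left; apply/eqP.
    by field; rewrite !lt0r_neq0//= ltr_wpDl.
  apply: (@le_trans _ _ ((Num.sqrt k.+1%:R)^-1 * k.+2%:R^-1)).
    by apply: ler_pM; rewrite ?invr_ge0 ?sqrtr_ge0.
  rewrite {2}e1 le_eqVlt; apply/orP; left; apply/eqP.
  by field; rewrite !lt0r_neq0//= ltr_wpDl.
by move=> h; apply: cvgP; apply: cvg_series_from1 h; rewrite S00 mul0r mulr0.
Qed.

Lemma cvg_var_ratio : S n ^+ 2 / n.+1%:R @[n --> \oo] --> 0.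
Proof.
apply: (cvg_dist_le h2); near=> n.
rewrite sub0r normrN ger0_norm ?divr_ge0 ?sqr_ge0// ler_wpM2l ?sqr_ge0//.
by rewrite lef_pV2 ?posrE ?ltr0n ?ler_nat//; near: n; exact: nbhs_infty_gt.
Unshelve. all: by end_near. Qed.

Lemma cvg_qweight_sqr_mean : cvgn (fun n => \sum_(0 <= k < n) qweight k * A k ^+ 2).
Proof.
have : cvgn (fun n => \sum_(0 <= k < n) qweight k.+1 * A k.+1 ^+ 2).
  apply: (cvgn_series_le _ cvg_qweight_sqr_meanS) => k.
  by rewrite mulr_ge0 ?qweight_ge0 ?sqr_ge0//= ler_wpM2r ?sqr_ge0// qweightS.
by move=> h; apply: cvgP; apply: cvg_series_from1 h; rewrite A00 expr0n mulr0.
Qed.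

End sequences.

Section sequence_shifts.
Context {R : realType}.

Lemma cvgn_shiftS (u : nat -> R) (l : R) :
  u n.+1 @[n --> \oo] --> l -> u n @[n --> \oo] --> l.
Proof. by move=> h; rewrite -[X in X @ _ --> _]/u -cvg_shiftS. Qed.

Lemma cvg_rescale (u : nat -> R) (l : R) :
  u n / n.+1%:R @[n --> \oo] --> l -> u n / n%:R @[n --> \oo] --> l.
Proof.
move=> h; have h' : u n / n.+1%:R * (1 + n%:R^-1) @[n --> \oo] --> l * (1 + 0).
  apply: cvgM => //; apply: cvgD; first exact: cvg_cst.
  by apply: cvgn_shiftS; exact: cvg_harmonic.
rewrite addr0 mulr1 in h'; apply: near_cvg h'; near=> n.
have n0 : 0 < n%:R :> R by rewrite ltr0n; near: n; exact: nbhs_infty_gt.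
by rewrite -natr1; field; rewrite !lt0r_neq0// ltr_wpDl.
Unshelve. all: by end_near. Qed.

Lemma clt_of_char (Om : nat -> finType) (G : forall n, Om n -> R) (w : R) : 0 <= w ->
  (forall n, (0 < #|Om n|)%N) -> Var (G n) / n%:R @[n --> \oo] --> w ->
  (forall s theta : R, Mean (fun o => cos (s * ((G n o - Mean (G n)) / Num.sqrt n%:R) + theta))
     @[n --> \oo] --> expR (- (w * s ^+ 2 / 2)) * cos theta) ->
  cvg_in_distribution (fun n o => (G n o - Mean (G n)) / Num.sqrt n%:R) (centered_normal w).
Proof.
move=> w0 Om0 cV cG; apply: (@levy_continuity _ _ _ w (w + 1)) => //.
near=> n; have -> : Mean (fun o => ((G n o - Mean (G n)) / Num.sqrt n%:R) ^+ 2) = Var (G n) / n%:R.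
  rewrite /Var [RHS]mulrC -MeanZ; apply: eq_Mean => o.
  by rewrite exprMn exprVn sqr_sqrtr// mulrC.
by near: n; apply: (cvgr_le w) => //; rewrite ltrDl.
Unshelve. all: by end_near. Qed.

End sequence_shifts.

(** * The limit theorem for binary search trees *)

Section bst_theorem.
Context {R : realType}.
Variable f : btree -> R.
Let a k : R := E k (oapp f 0).
Let s k : R := Num.sqrt (E k (fun t => (oapp f 0 t - a k) ^+ 2)).
Let g (l r : tree0) : R := f (BNode l r).

Lemma Mean_bst_a k : Mean (fun w : 'S_k.+1 => f (bst w)) = a k.+1.
Proof. exact: Mean_bst. Qed.

Lemma Var_bst k : Var (fun w : 'S_k.+1 => f (bst w)) = s k.+1 ^+ 2.
Proof.
rewrite sqr_sqrtr; last by apply: E_ge0 => t _; exact: sqr_ge0.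
rewrite /Var Mean_bst_a; exact: (Mean_bst_some k (fun t => (oapp f 0 t - a k.+1) ^+ 2)).
Qed.

Lemma Mean_bsum k : Mean (fun w : 'S_k.+1 => bsum f (bst w)) = mean_add g k.+1.
Proof.
rewrite /mean_add -(Mean_bst_some k (fringe_sum g)); apply: eq_Mean => w; exact: bsum_fringe_sum.
Qed.

Lemma centered_bsum k (w : 'S_k.+1) :
  bsum f (bst w) - Mean (fun w : 'S_k.+1 => bsum f (bst w)) = centered g (Some (bst w)).
Proof.
by rewrite /centered Mean_bsum -[size0 _]/(bsize (bst w)) (bsize_bst (R := R)) bsum_fringe_sum.
Qed.

Lemma Var_bsum k : Var (fun w : 'S_k.+1 => bsum f (bst w)) = var_add g k.+1.
Proof.
rewrite /var_add -(Mean_bst_some k (fun t => centered g t ^+ 2)); apply: eq_Mean => w.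
by rewrite centered_bsum.
Qed.

Lemma sum_bsigma N :
  \sum_(p \in [set p : btree * btree | (bsize p.1 <= N)%N /\ (bsize p.2 <= N)%N])
     f p.1 * f p.2 * bsigma p.1 p.2 = truncated_var (bst_gamma f) N.
Proof.
rewrite (@sum_sigma_by_size R _ bsize bfringe (fun n => 'S_n) bst bsize_gt0 (@bsize_bst R) finite_btree
  (fun k => 2 / ((k + 1) * (k + 2))%N%:R) beta_bst f N).
apply: eq_big_nat => k /andP[k0 _]; apply: eq_big_nat => m /andP[m0 _].
have : (0 < maxn k m)%N by rewrite leq_max k0.
have : (0 < minn k m)%N by rewrite leq_min k0.
case: (maxn k m) => // K; case: (minn k m) => // M _ _.
rewrite /bst_gamma !Mean_bst_a; congr (_ * _ - _).
rewrite -(Mean_bst_some K (fun t => oapp f 0 t * fringe_sum (bst_toll f M.+1) t)).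
by apply: eq_Mean => w; rewrite bsum_size.
Qed.

Hypothesis h1 : cvgn (fun n => \sum_(1 <= k < n.+1)
  Num.sqrt (Var (fun w : 'S_k => f (bst w))) / k%:R `^ (3 / 2)).
Hypothesis h2 : Var (fun w : 'S_k => f (bst w)) / k%:R @[k --> \oo] --> 0.
Hypothesis h3 : cvgn (fun n => \sum_(1 <= k < n.+1)
  Mean (fun w : 'S_k => f (bst w)) ^+ 2 / k%:R ^+ 2).

Lemma bst_theorem : exists mu sigma2 : R,
    [/\ \sum_(1 <= k < n.+1) 2 / ((k + 1) * (k + 2))%N%:R *
          Mean (fun w : 'S_k => f (bst w)) @[n --> \oo] --> mu,
        Mean (fun w : 'S_n => bsum f (bst w)) / n%:R @[n --> \oo] --> mu,
        \sum_(p \in [set p : btree * btree |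
                      (bsize p.1 <= N)%N /\ (bsize p.2 <= N)%N])
            f p.1 * f p.2 * bsigma p.1 p.2 @[N --> \oo] --> sigma2,
        Var (fun w : 'S_n => bsum f (bst w)) / n%:R @[n --> \oo] --> sigma2 &
        cvg_in_distribution
          (fun n (w : 'S_n) =>
             (bsum f (bst w) - Mean (fun w : 'S_n => bsum f (bst w)))
             / Num.sqrt n%:R)
          (centered_normal sigma2)].
Proof.
have a0 : a 0%N = 0 by rewrite /a E0.
have s0 : s 0%N = 0 by rewrite /s E0 a0 /= subr0 expr0n sqrtr0.
have h1' : cvgn (fun n => \sum_(1 <= k < n.+1) s k / k%:R `^ (3 / 2)).
  apply: cvgP; apply: near_cvg h1; near=> n; apply: eq_big_nat => -[//|k] _.
  by rewrite Var_bst sqrtr_sqr ger0_norm ?sqrtr_ge0.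
have h2' : s k ^+ 2 / k%:R @[k --> \oo] --> 0.
  apply: cvgn_shiftS; have := h2; rewrite -cvg_shiftS; apply: near_cvg.
  by near=> n; rewrite /= Var_bst.
have h3' : cvgn (fun n => \sum_(1 <= k < n.+1) a k ^+ 2 / k%:R ^+ 2).
  apply: cvgP; apply: near_cvg h3; near=> n; apply: eq_big_nat => -[//|k] _.
  by rewrite Mean_bst_a.
have sg0 k : 0 <= s k by exact: sqrtr_ge0.
have c1 := cvg_qweight_sd sg0 h1' s0; have c2 := cvg_var_ratio h2'; have c3 := cvg_qweight_sqr_mean h3' a0.
have [w [w0 cw cV clt]] := @bst_limit R f c1 c2 c3.
have [cL ca] := cvg_qweight_mean c3.
have [L hL] : exists L : R, \sum_(0 <= k < n) qweight k * a k @[n --> \oo] --> L.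
  by apply/cvg_ex.
exists (2 * L), w.
have cM : mean_add g n / n.+1%:R @[n --> \oo] --> 2 * L.
  have c : a n / n.+1%:R + 2 * \sum_(0 <= k < n) qweight k * a k @[n --> \oo] --> 0 + 2 * L.
    by apply: cvgD => //; exact: cvgMr.
  rewrite add0r in c; apply: near_cvg c; near=> n; rewrite mean_addE.
  have mt k : mean_toll g k = a k by case: k => [|k] //=; rewrite /a E_E2.
  under eq_bigr do rewrite mt.
  by rewrite mt /=; nat_field.
have cVn : Var (fun w : 'S_n => bsum f (bst w)) / n%:R @[n --> \oo] --> w.
  apply: cvgn_shiftS; have := cvg_rescale cV; rewrite -cvg_shiftS; apply: near_cvg.
  by near=> n; rewrite /= Var_bsum.
split => //.
- have c : 2 * \sum_(0 <= k < n) qweight k * a k @[n --> \oo] --> 2 * L by exact: cvgMr.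
  rewrite -cvg_shiftS in c; apply: near_cvg c; near=> n.
  rewrite [in RHS]/= [in RHS]big_nat_recl//= a0 mulr0 add0r big_add1 /= mulr_sumr.
  by apply: eq_bigr => k _; rewrite Mean_bst_a /qweight !addn1 !addn2; ring.
- apply: cvgn_shiftS; have := cvg_rescale cM; rewrite -cvg_shiftS; apply: near_cvg.
  by near=> n; rewrite /= Mean_bsum.
- by apply: near_cvg cw; near=> N; exact: sum_bsigma.
apply: clt_of_char => //; first by move=> n; rewrite card_Sn fact_gt0.
move=> u theta; apply: cvgn_shiftS.
(* The recurrences normalize by the number n + 1 of external positions, the theorem by n; [cY] shows
   that the difference is negligible. *)
pose Y n t : R := centered g t / Num.sqrt n%:R.
have cY : nrm2 n (fun t => Y n t - centered g t / Num.sqrt n.+1%:R) @[n --> \oo] --> 0.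
  have cs : Num.sqrt (var_add g n.+1 / n.+2%:R) * (Num.sqrt n.+1%:R)^-1 @[n --> \oo] --> 0.
    rewrite -(mulr0 (Num.sqrt w)); apply: cvgM; last exact: cvg_inv_sqrt.
    have cV1 : var_add g n.+1 / n.+2%:R @[n --> \oo] --> w by have := cV; rewrite -cvg_shiftS.
    exact: cvg_comp cV1 (@sqrt_continuous R w).
  apply: cvgn_shiftS; apply: (cvg_dist_le cs); near=> n.
  rewrite sub0r normrN ger0_norm ?nrm2_ge0// -nrm2_scaled.
  set r1 := Num.sqrt n.+1%:R; set r2 := Num.sqrt n.+2%:R.
  have r10 : 0 < r1 by rewrite sqrtr_gt0.
  have r12 : r1 <= r2 by rewrite ler_wsqrtr// ler_nat.
  have r20 : 0 < r2 by exact: lt_le_trans r12.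
  have r21 : r2 <= r1 + 1.
    rewrite -(@ler_pXn2r _ 2)// ?nnegrE ?addr_ge0 ?sqrtr_ge0//.
    rewrite sqrrD1 !sqr_sqrtr// -addrA -natr1 lerD2l; have := ltW r10; rewrite -mulr_natr; lra.
  rewrite (@eq_nrm2 _ _ _ (fun t => (r2 / r1 - 1) * (centered g t / r2))); last first.
    by move=> t _; rewrite /Y -/r1; field; rewrite !lt0r_neq0.
  rewrite nrm2Z mulrC ler_wpM2l ?nrm2_ge0// ger0_norm.
    by rewrite lerBlDr ler_pdivrMr// mulrDl mulVf ?lt0r_neq0// mul1r addrC.
  by rewrite subr_ge0 ler_pdivlMr// mul1r.
have := clt Y cY u theta; rewrite -cvg_shiftS; apply: near_cvg; near=> n.
rewrite /= -(Mean_bst_some n (fun t => cos (u * Y n.+1 t + theta))); apply: eq_Mean => o.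
by rewrite centered_bsum.
Unshelve. all: by end_near. Qed.

End bst_theorem.

(** * The limit theorem for recursive trees *)

Section rrt_theorem.
Context {R : realType}.
Variable f : otree -> R.
Let h := f \o rtree.
Let a k : R := E k h.
Let s k : R := Num.sqrt (E k (fun t => (h t - a k) ^+ 2)).
Let g (l r : tree0) : R := h l.

Lemma Mean_rrt_a k : Mean (fun w : parents k.+1 => f (rrt w)) = a k.
Proof. exact: Mean_rrt. Qed.

Lemma Var_rrt k : Var (fun w : parents k.+1 => f (rrt w)) = s k ^+ 2.
Proof.
rewrite sqr_sqrtr; last by apply: E_ge0 => t _; exact: sqr_ge0.
rewrite /Var Mean_rrt_a; exact: (Mean_rrt (fun t => (f t - a k) ^+ 2)).
Qed.

Lemma Mean_osum k : Mean (fun w : parents k.+1 => osum f (rrt w)) = a k + mean_add g k.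
Proof.
rewrite (Mean_rrt (osum f)) /a /mean_add -ED; apply: eq_E => t _; exact: osum_rtree.
Qed.

Lemma Mean_centered_osum (phi : R -> R) k :
  Mean (fun w : parents k.+1 =>
    phi (osum f (rrt w) - Mean (fun w : parents k.+1 => osum f (rrt w))))
  = E k (fun t => phi (h t - a k + centered g t)).
Proof.
rewrite Mean_osum (Mean_rrt (fun t => phi (osum f t - _))); apply: eq_E => t tk.
by rewrite /= osum_rtree /centered tk; congr phi; rewrite /h /=; ring.
Qed.

Lemma rrt_gamma_Mean k m : (0 < m)%N -> (0 < k)%N ->
  1 / (k * (k + 1))%N%:R * Mean (fun w : parents k =>
     f (rrt w) * \sum_(s <- ofringe (rrt w) | osize s == m) f s)
  - beta_rrt k m * Mean (fun w : parents k => f (rrt w)) * Mean (fun w : parents m => f (rrt w))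
  = rrt_gamma h k m.
Proof.
case: m => // m _; case: k => // k _; rewrite /rrt_gamma !Mean_rrt_a; congr (_ * _ - _).
rewrite (Mean_rrt (fun t => f t * \sum_(s <- ofringe t | osize s == m.+1) f s)).
by apply: eq_E => t tk; rewrite /= osum_size tk.
Qed.

Lemma sum_osigma N :
  \sum_(p \in [set p : otree * otree | (osize p.1 <= N)%N /\ (osize p.2 <= N)%N])
     f p.1 * f p.2 * osigma p.1 p.2 = truncated_var (rrt_gamma h) N.
Proof.
rewrite (@sum_sigma_by_size R _ osize ofringe parents rrt osize_gt0 (@osize_rrt R) finite_otree
  (fun k => 1 / (k * (k + 1))%N%:R) beta_rrt f N).
apply: eq_big_nat => k /andP[k0 _]; apply: eq_big_nat => m /andP[m0 _].
by rewrite rrt_gamma_Mean// ?leq_max ?leq_min k0.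
Qed.

Hypothesis h1 : cvgn (fun n => \sum_(1 <= k < n.+1)
  Num.sqrt (Var (fun w : parents k => f (rrt w))) / k%:R `^ (3 / 2)).
Hypothesis h2 : Var (fun w : parents k => f (rrt w)) / k%:R @[k --> \oo] --> 0.
Hypothesis h3 : cvgn (fun n => \sum_(1 <= k < n.+1)
  Mean (fun w : parents k => f (rrt w)) ^+ 2 / k%:R ^+ 2).

Lemma rrt_theorem : exists mu sigma2 : R,
    [/\ \sum_(1 <= k < n.+1) 1 / (k * (k + 1))%N%:R *
          Mean (fun w : parents k => f (rrt w)) @[n --> \oo] --> mu,
        Mean (fun w : parents n => osum f (rrt w)) / n%:R @[n --> \oo] --> mu,
        truncated_var (rrt_gamma h) N @[N --> \oo] --> sigma2,
        Var (fun w : parents n => osum f (rrt w)) / n%:R @[n --> \oo] --> sigma2 &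
        cvg_in_distribution
          (fun n (w : parents n) =>
             (osum f (rrt w) - Mean (fun w : parents n => osum f (rrt w)))
             / Num.sqrt n%:R)
          (centered_normal sigma2)].
Proof.
have h1' : cvgn (fun n => \sum_(1 <= k < n.+1) s k.-1 / k%:R `^ (3 / 2)).
  apply: cvgP; apply: near_cvg h1; near=> n; apply: eq_big_nat => -[//|k] _.
  by rewrite Var_rrt sqrtr_sqr ger0_norm ?sqrtr_ge0.
have h2' : s k.-1 ^+ 2 / k%:R @[k --> \oo] --> 0.
  apply: cvgn_shiftS; have := h2; rewrite -cvg_shiftS; apply: near_cvg.
  by near=> n; rewrite /= Var_rrt.
have h3' : cvgn (fun n => \sum_(1 <= k < n.+1) a k.-1 ^+ 2 / k%:R ^+ 2).
  apply: cvgP; apply: near_cvg h3; near=> n; apply: eq_big_nat => -[//|k] _.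
  by rewrite Mean_rrt_a.
have sg0 k : 0 <= s k.-1 by exact: sqrtr_ge0.
have c1 := cvg_qweight_sdS sg0 h1'; have c2 := cvg_var_ratioS h2'; have c3 := cvg_qweight_sqr_meanS h3'.
have [w [w0 cw cV clt]] := @rrt_limit R h c1 c2 c3.
have [cL ca] := cvg_qweight_mean c3.
have [L hL] : exists L : R, \sum_(0 <= k < n) qweight k * a k @[n --> \oo] --> L.
  by apply/cvg_ex.
(* A recursive tree encoded by n nodes has n + 1, so this scale is already that of the theorem. The
   extra term is the centered toll of the root, negligible by the second hypothesis. *)
pose Y n t : R := (h t - a n + centered g t) / Num.sqrt n.+1%:R.
have cY : nrm2 n (fun t => Y n t - centered g t / Num.sqrt n.+1%:R) @[n --> \oo] --> 0.
  have := cvg_comp _ _ c2 (@sqrt_continuous R 0); rewrite sqrtr0; apply: near_cvg; near=> n.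
  rewrite (@eq_nrm2 _ _ _ (fun t => (Num.sqrt n.+1%:R)^-1 * (h t - a n))); last first.
    by move=> t _; rewrite /Y -mulrBl addrK mulrC.
  rewrite nrm2Z ger0_norm ?invr_ge0 ?sqrtr_ge0// /= sqrtrM ?sqr_ge0// sqrtrV//.
  by rewrite sqrtr_sqr ger0_norm ?sqrtr_ge0// mulrC.
(* The toll of the root may be correlated with the rest, so variances do not add; the triangle
   inequality for [nrm2] suffices. *)
have cYn : nrm2 n (Y n) @[n --> \oo] --> Num.sqrt w.
  have cZ : Num.sqrt (var_add g n / n.+1%:R) @[n --> \oo] --> Num.sqrt w.
    exact: cvg_comp cV (@sqrt_continuous R w).
  have cD : nrm2 n (Y n) - Num.sqrt (var_add g n / n.+1%:R) @[n --> \oo] --> 0.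
    apply: (cvg_dist_le cY); near=> n.
    by rewrite sub0r normrN -nrm2_scaled; exact: nrm2B.
  rewrite -[Num.sqrt w]add0r; apply: near_cvg (cvgD cD cZ); near=> n.
  by rewrite /= subrK.
exists L, w.
have cVn : Var (fun w : parents n => osum f (rrt w)) / n%:R @[n --> \oo] --> w.
  apply: cvgn_shiftS; rewrite -[w]sqr_sqrtr// expr2.
  apply: near_cvg (cvgM cYn cYn); near=> n.
  rewrite /= -expr2 sqr_nrm2 /Var (Mean_centered_osum (fun x => x ^+ 2)) mulrC -EZ.
  by apply: eq_E => t _; rewrite /Y exprMn exprVn sqr_sqrtr// mulrC.
split => //.
- apply: near_cvg hL; near=> n; rewrite big_add1 /=.
  by apply: eq_bigr => k _; rewrite Mean_rrt_a /qweight !addn1 mul1r.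
- apply: cvgn_shiftS; rewrite -[L]add0r; apply: near_cvg (cvgD ca hL); near=> n.
  by rewrite Mean_osum /= mean_add_left; nat_field.
apply: clt_of_char => //.
  by move=> [|n]; [rewrite (card_parents 0)|rewrite card_parents fact_gt0].
move=> u theta; apply: cvgn_shiftS.
have := clt Y cY u theta; apply: near_cvg; near=> n.
exact: (Mean_centered_osum (fun x => cos (u * (x / Num.sqrt n.+1%:R) + theta))).
Unshelve. all: by end_near. Qed.

End rrt_theorem.

Section urrt.
Context {R : realType}.
Variable f : utree -> R.

(** Ordered and unordered constants differ tree by tree. Grouped by sizes, both become means of sums
    over fringe subtrees, which are the same for f on the quotient and for its pullback to ordered
    trees. *)
Lemma sum_usigma N :
  \sum_(p \in [set p : utree * utree | (usize p.1 <= N)%N /\ (usize p.2 <= N)%N])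
     f p.1 * f p.2 * usigma p.1 p.2
  = truncated_var (rrt_gamma ((fun t => f (\pi_utree t)%qT) \o rtree)) N.
Proof.
rewrite (@sum_sigma_by_size R _ usize ufringe parents urrt usize_gt0 (@usize_urrt R) finite_utree
  (fun k => 1 / (k * (k + 1))%N%:R) beta_rrt f N).
apply: eq_big_nat => k /andP[k0 _]; apply: eq_big_nat => m /andP[m0 _].
rewrite -rrt_gamma_Mean ?leq_max ?leq_min ?k0//; congr (_ * _ - _).
by apply: eq_Mean => w; rewrite usum_size_pi.
Qed.

End urrt.

Theorem theorem1p20 (R : realType) :
  (forall f : btree -> R,
    cvgn (fun n => \sum_(1 <= k < n.+1)
      Num.sqrt (Var (fun w : 'S_k => f (bst w))) / k%:R `^ (3 / 2)) ->
    Var (fun w : 'S_k => f (bst w)) / k%:R @[k --> \oo] --> 0 ->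
    cvgn (fun n => \sum_(1 <= k < n.+1)
      Mean (fun w : 'S_k => f (bst w)) ^+ 2 / k%:R ^+ 2) ->
    exists mu sigma2 : R,
    [/\ \sum_(1 <= k < n.+1) 2 / ((k + 1) * (k + 2))%N%:R *
          Mean (fun w : 'S_k => f (bst w)) @[n --> \oo] --> mu,
        Mean (fun w : 'S_n => bsum f (bst w)) / n%:R @[n --> \oo] --> mu,
        \sum_(p \in [set p : btree * btree |
                      (bsize p.1 <= N)%N /\ (bsize p.2 <= N)%N])
            f p.1 * f p.2 * bsigma p.1 p.2 @[N --> \oo] --> sigma2,
        Var (fun w : 'S_n => bsum f (bst w)) / n%:R @[n --> \oo] --> sigma2 &
        cvg_in_distribution
          (fun n (w : 'S_n) =>
             (bsum f (bst w) - Mean (fun w : 'S_n => bsum f (bst w)))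
             / Num.sqrt n%:R)
          (centered_normal sigma2)])
  /\
  (forall f : otree -> R,
    cvgn (fun n => \sum_(1 <= k < n.+1)
      Num.sqrt (Var (fun w : parents k => f (rrt w))) / k%:R `^ (3 / 2)) ->
    Var (fun w : parents k => f (rrt w)) / k%:R @[k --> \oo] --> 0 ->
    cvgn (fun n => \sum_(1 <= k < n.+1)
      Mean (fun w : parents k => f (rrt w)) ^+ 2 / k%:R ^+ 2) ->
    exists mu sigma2 : R,
    [/\ \sum_(1 <= k < n.+1) 1 / (k * (k + 1))%N%:R *
          Mean (fun w : parents k => f (rrt w)) @[n --> \oo] --> mu,
        Mean (fun w : parents n => osum f (rrt w)) / n%:R @[n --> \oo] --> mu,
        \sum_(p \in [set p : otree * otree |
                      (osize p.1 <= N)%N /\ (osize p.2 <= N)%N])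
            f p.1 * f p.2 * osigma p.1 p.2 @[N --> \oo] --> sigma2,
        Var (fun w : parents n => osum f (rrt w)) / n%:R @[n --> \oo] --> sigma2 &
        cvg_in_distribution
          (fun n (w : parents n) =>
             (osum f (rrt w) - Mean (fun w : parents n => osum f (rrt w)))
             / Num.sqrt n%:R)
          (centered_normal sigma2)])
  /\
  (forall f : utree -> R,
    cvgn (fun n => \sum_(1 <= k < n.+1)
      Num.sqrt (Var (fun w : parents k => f (urrt w))) / k%:R `^ (3 / 2)) ->
    Var (fun w : parents k => f (urrt w)) / k%:R @[k --> \oo] --> 0 ->
    cvgn (fun n => \sum_(1 <= k < n.+1)
      Mean (fun w : parents k => f (urrt w)) ^+ 2 / k%:R ^+ 2) ->
    exists mu sigma2 : R,
    [/\ \sum_(1 <= k < n.+1) 1 / (k * (k + 1))%N%:R *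
          Mean (fun w : parents k => f (urrt w)) @[n --> \oo] --> mu,
        Mean (fun w : parents n => usum f (urrt w)) / n%:R @[n --> \oo] --> mu,
        \sum_(p \in [set p : utree * utree |
                      (usize p.1 <= N)%N /\ (usize p.2 <= N)%N])
            f p.1 * f p.2 * usigma p.1 p.2 @[N --> \oo] --> sigma2,
        Var (fun w : parents n => usum f (urrt w)) / n%:R @[n --> \oo] --> sigma2 &
        cvg_in_distribution
          (fun n (w : parents n) =>
             (usum f (urrt w) - Mean (fun w : parents n => usum f (urrt w)))
             / Num.sqrt n%:R)
          (centered_normal sigma2)]).
Proof.
split; first by move=> f h1 h2 h3; exact: bst_theorem.
split => f h1 h2 h3.
  have [mu [w [m1 m2 cw cV cd]]] := rrt_theorem h1 h2 h3.
  exists mu, w; split => //.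
  by apply: near_cvg cw; near=> N; exact: sum_osigma.
have [mu [w [m1 m2 cw cV cd]]] := @rrt_theorem R (fun t => f (\pi_utree t)%qT) h1 h2 h3.
have e n : (fun w : parents n => usum f (urrt w)) =
    (fun w : parents n => osum (fun t => f (\pi_utree t)%qT) (rrt w)).
  by apply/funext => v; exact: usum_pi.
exists mu, w; split => //.
- by apply: near_cvg m2; near=> n; rewrite e.
- by apply: near_cvg cw; near=> N; exact: sum_usigma.
- by apply: near_cvg cV; near=> n; rewrite e.
move=> phi cphi bphi; apply: near_cvg (cd phi cphi bphi); near=> n.
by rewrite e; apply: eq_Mean => v; rewrite usum_pi.
Unshelve. all: by end_near. Qed.
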